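(* Let $A$ be a locally $C^*$-algebra (not necessarily unital) and let $E$ be a countably generated Hilbert $A$-module. Then $\mathcal{H}_A \approx E\oplus \mathcal{H}_A$, i.e. the Hilbert $A$-modules $\mathcal{H}_A$ and $E\oplus\mathcal{H}_A$ are unitarily equivalent.
   Context: A locally $C^*$-algebra is a complete Hausdorff complex topological $*$-algebra $A$ whose topology is determined by its continuous $C^*$-seminorms: a net $(a_i)$ converges to $0$ iff $p(a_i)\to 0$ for every continuous $C^*$-seminorm $p$. $S(A)$ denotes the set of all continuous $C^*$-seminorms on $A$. A pre-Hilbert $A$-module is a complex vector space $E$ that is also a right $A$-module (compatible with the complex algebra structure), with an $A$-valued inner product $\langle\cdot,\cdot\rangle:E\times E\to A$ that is $\mathbb{C}$- and $A$-linear in the second variable and satisfies $\langle\xi,\eta\rangle^*=\langle\eta,\xi\rangle$, $\langle\xi,\xi\rangle\ge 0$, and $\langle\xi,\xi\rangle=0$ iff $\xi=0$. It is a Hilbert $A$-module if it is complete for the topology given by the seminorms $\overline{p}_E(\xi)=\sqrt{p(\langle\xi,\xi\rangle)}$, $p\in S(A)$. A subset $G\subseteq E$ is a generating set for $E$ if the closed submodule of $E$ generated by $G$ is all of $E$; $E$ is countably generated if it has a countable generating set. $\mathcal{H}_A=\{(a_n)_{n\ge 1}: a_n\in A,\ \sum_{n=1}^\infty a_n^*a_n \text{ converges in } A\}$, a Hilbert $A$-module with componentwise operations and $\langle (a_n)_n,(b_n)_n\rangle=\sum_n a_n^*b_n$. The direct sum $E\oplus F$ of Hilbert $A$-modules has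 $(\xi\oplus\eta)a=\xi a\oplus\eta a$ and $\langle\xi_1\oplus\eta_1,\xi_2\oplus\eta_2\rangle=\langle\xi_1,\xi_2\rangle+\langle\eta_1,\eta_2\rangle$. $L_A(E,F)$ is the set of adjointable $A$-module homomorphisms $E\to F$. $U\in L_A(E,F)$ is unitary if $U^*U=\mathrm{id}_E$ and $UU^*=\mathrm{id}_F$. $E$ and $F$ are unitarily equivalent, written $E\approx F$, if there is a unitary operator in $L_A(E,F)$. *)

(* Defs.v *)
From HB Require Import structures.
From mathcomp Require Import all_boot all_order all_algebra.
From mathcomp Require Import complex.
From mathcomp Require Import all_classical all_reals all_analysis.

Set Implicit Arguments.
Unset Strict Implicit.
Unset Printing Implicit Defensive.

Import Order.TTheory GRing.Theory Num.Theory.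
Import numFieldNormedType.Exports.

Local Open Scope classical_set_scope.
Local Open Scope ring_scope.

Reserved Notation "a ** b" (at level 40, left associativity).
Reserved Notation "x <* a" (at level 40, left associativity).
Reserved Notation "H ~=u K" (at level 70, no associativity).

(* MathComp's algebras are unital, so complex *-algebras without a unit are
   built from complex vector spaces. *)
HB.mixin Record isStarAlgebra (R : realType) A & GRing.Lmodule R[i] A := {
  smul : A -> A -> A;
  star : A -> A;
  smulA : associative smul;
  smulDl : left_distributive smul +%R;
  smulDr : right_distributive smul +%R;
  smulZl : forall (c : R[i]) (a b : A), smul (c *: a) b = c *: smul a b;
  smulZr : forall (c : R[i]) (a b : A), smul a (c *: b) = c *: smul a b;
  starD : {morph star : a b / a + b};
  starZ : forall (c : R[i]) (a : A), star (c *: a) = conjc c *: star a;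
  starM : forall a b : A, star (smul a b) = smul (star b) (star a);
  starK : involutive star
}.

#[short(type="starAlgType")]
HB.structure Definition StarAlgebra (R : realType) :=
  {A of GRing.Lmodule R[i] A & isStarAlgebra R A}.

Notation "a ** b" := (smul a b) : ring_scope.

#[short(type="topStarAlgType")]
HB.structure Definition TopStarAlgebra (R : realType) :=
  {A of StarAlgebra R A & TopologicalLmodule R[i] A}.

Definition pos_elt (R : realType) (A : starAlgType R) (a : A) : Prop :=
  exists b : A, a = star b ** b.

Record Cstar_seminorm (R : realType) (A : starAlgType R) (p : A -> R) :
    Prop := {
  Cstar_seminorm_ge0 : forall a, 0 <= p a;
  Cstar_seminormD : forall a b, p (a + b) <= p a + p b;
  Cstar_seminormZ : forall (c : R[i]) a, p (c *: a) = Normc.normc c * p a;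
  Cstar_seminormM : forall a b, p (a ** b) <= p a * p b;
  Cstar_seminorm_star : forall a, p (star a ** a) = p a ^+ 2
}.

Definition cont_Cstar_seminorms (R : realType) (A : topStarAlgType R) :
    set (A -> R) :=
  [set p | Cstar_seminorm p /\ continuous p].

(* Proper filters play the role of nets; completeness is that of the additive
   topological group. *)
HB.mixin Record isLocallyCstar (R : realType) A & TopStarAlgebra R A := {
  smul_continuous : continuous (fun ab : A * A => ab.1 ** ab.2);
  star_continuous : continuous (star : A -> A);
  Cstar_hausdorff : hausdorff_space A;
  Cstar_complete : forall F : set_system A, ProperFilter F ->
    (fun xy : A * A => xy.1 - xy.2) @ (F, F) --> (0 : A) ->
    exists l : A, F --> l;
  cvg0_Cstar_seminorms : forall F : set_system A, ProperFilter F ->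
    (F --> (0 : A)) <->
    (forall p, @cont_Cstar_seminorms R A p -> p @ F --> (0 : R))
}.

#[short(type="locallyCstarType")]
HB.structure Definition LocallyCstar (R : realType) :=
  {A of TopStarAlgebra R A & isLocallyCstar R A}.

HB.mixin Record isRightModule (R : realType) (A : starAlgType R) E
    & GRing.Lmodule R[i] E := {
  ract : E -> A -> E;
  ractDl : forall (x y : E) (a : A), ract (x + y) a = ract x a + ract y a;
  ractDr : forall (x : E) (a b : A), ract x (a + b) = ract x a + ract x b;
  ractA : forall (x : E) (a b : A), ract x (a ** b) = ract (ract x a) b;
  ractZl : forall (c : R[i]) (x : E) (a : A), ract (c *: x) a = c *: ract x a;
  ractZr : forall (c : R[i]) (x : E) (a : A), ract x (c *: a) = c *: ract x a
}.

#[short(type="rightModType")]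
HB.structure Definition RightModule (R : realType) (A : starAlgType R) :=
  {E of GRing.Lmodule R[i] E & isRightModule R A E}.

Notation "x <* a" := (ract x a) : ring_scope.

Section RightModuleInstances.
Variables (R : realType) (A : starAlgType R).

Definition seq_ract (x : nat -> A) (a : A) : nat -> A := fun n => x n ** a.

Fact seq_ractDl (x y : nat -> A) a :
  seq_ract (x + y) a = seq_ract x a + seq_ract y a.
Proof. by apply/funext => n; exact: smulDl. Qed.

Fact seq_ractDr (x : nat -> A) a b :
  seq_ract x (a + b) = seq_ract x a + seq_ract x b.
Proof. by apply/funext => n; exact: smulDr. Qed.

Fact seq_ractA (x : nat -> A) a b :
  seq_ract x (a ** b) = seq_ract (seq_ract x a) b.
Proof. by apply/funext => n; exact: smulA. Qed.

Fact seq_ractZl (c : R[i]) (x : nat -> A) a :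
  seq_ract (c *: x) a = c *: seq_ract x a.
Proof. by apply/funext => n; exact: smulZl. Qed.

Fact seq_ractZr (c : R[i]) (x : nat -> A) a :
  seq_ract x (c *: a) = c *: seq_ract x a.
Proof. by apply/funext => n; exact: smulZr. Qed.

HB.instance Definition _ := isRightModule.Build R A (nat -> A)
  seq_ractDl seq_ractDr seq_ractA seq_ractZl seq_ractZr.

Variables E F : rightModType A.

Definition pair_ract (x : E * F) (a : A) : E * F := (x.1 <* a, x.2 <* a).

Fact pair_ractDl (x y : E * F) a :
  pair_ract (x + y) a = pair_ract x a + pair_ract y a.
Proof. by rewrite /pair_ract !ractDl. Qed.

Fact pair_ractDr (x : E * F) a b :
  pair_ract x (a + b) = pair_ract x a + pair_ract x b.
Proof. by rewrite /pair_ract !ractDr. Qed.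

Fact pair_ractA (x : E * F) a b :
  pair_ract x (a ** b) = pair_ract (pair_ract x a) b.
Proof. by rewrite /pair_ract !ractA. Qed.

Fact pair_ractZl (c : R[i]) (x : E * F) a :
  pair_ract (c *: x) a = c *: pair_ract x a.
Proof. by rewrite /pair_ract !ractZl. Qed.

Fact pair_ractZr (c : R[i]) (x : E * F) a :
  pair_ract x (c *: a) = c *: pair_ract x a.
Proof. by rewrite /pair_ract !ractZr. Qed.

HB.instance Definition _ := isRightModule.Build R A (E * F)%type
  pair_ractDl pair_ractDr pair_ractA pair_ractZl pair_ractZr.

End RightModuleInstances.

(* A module with an A-valued form is a subset of an ambient right A-module,
   together with a form that is only meaningful on that subset; a module which
   is a type on its own has carrier [setT]. This lets H_A be carved out of the
   module of all sequences. *)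
Record formModule (R : realType) (A : starAlgType R) := FormModule {
  ambient : rightModType A;
  carrier : set ambient;
  ip : ambient -> ambient -> A
}.
Arguments carrier {R A} f _.
Arguments ip {R A} f _ _.

Record submodule (R : realType) (A : starAlgType R) (V : rightModType A)
    (D : set V) : Prop := {
  submodule0 : D 0;
  submoduleD : forall x y, D x -> D y -> D (x + y);
  submoduleZ : forall (c : R[i]) x, D x -> D (c *: x);
  submodule_ract : forall x (a : A), D x -> D (x <* a)
}.

Record preHilbert (R : realType) (A : starAlgType R) (E : formModule A) :
    Prop := {
  preHilbert_submodule : submodule (carrier E);
  ipD : forall x y z, carrier E x -> carrier E y -> carrier E z ->
    ip E x (y + z) = ip E x y + ip E x z;
  ipZ : forall (c : R[i]) x y, carrier E x -> carrier E y ->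
    ip E x (c *: y) = c *: ip E x y;
  ip_ract : forall x y (a : A), carrier E x -> carrier E y ->
    ip E x (y <* a) = ip E x y ** a;
  ip_star : forall x y, carrier E x -> carrier E y ->
    star (ip E x y) = ip E y x;
  ip_pos : forall x, carrier E x -> pos_elt (ip E x x);
  ip_eq0 : forall x, carrier E x -> ip E x x = 0 <-> x = 0
}.

Section Hilbert.
Variables (R : realType) (A : locallyCstarType R).
Implicit Types (E F : formModule A) (p : A -> R).

Definition mod_seminorm E p (x : ambient E) : R := Num.sqrt (p (ip E x x)).

Definition mod_cvg E (Phi : set_system (ambient E)) (x : ambient E) : Prop :=
  forall p, @cont_Cstar_seminorms R A p ->
    (fun y => mod_seminorm p (y - x)) @ Phi --> (0 : R).

Definition mod_cauchy E (Phi : set_system (ambient E)) : Prop :=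
  forall p, @cont_Cstar_seminorms R A p ->
    (fun yz => mod_seminorm p (yz.1 - yz.2)) @ (Phi, Phi) --> (0 : R).

Definition mod_complete E : Prop :=
  forall Phi : set_system (ambient E), ProperFilter Phi -> Phi (carrier E) ->
    mod_cauchy Phi -> exists2 x, carrier E x & mod_cvg Phi x.

Definition hilbert E : Prop := preHilbert E /\ mod_complete E.

Definition mod_closed E (D : set (ambient E)) : Prop :=
  forall Phi : set_system (ambient E), ProperFilter Phi -> Phi D ->
    forall x, carrier E x -> mod_cvg Phi x -> D x.

Definition closed_submodule E (D : set (ambient E)) : Prop :=
  [/\ D `<=` carrier E, submodule D & mod_closed D].

Definition closed_span E (G : set (ambient E)) : set (ambient E) :=
  \bigcap_(D in [set D | closed_submodule D /\ G `<=` D]) D.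

Definition generating E (G : set (ambient E)) : Prop :=
  G `<=` carrier E /\ closed_span G = carrier E.

Definition countably_generated E : Prop :=
  exists2 G : set (ambient E), countable G & generating G.

Definition summable (u : nat -> A) : Prop :=
  exists l : A, series u @ \oo --> l.

(* The library's [lim] needs a pointed type; 0 is a junk value. *)
Definition tsum (u : nat -> A) : A := xget 0 [set l : A | series u @ \oo --> l].

(* Indices start at 0 instead of 1. *)
Definition std_hilbert : formModule A :=
  @FormModule R A (nat -> A)
    [set x : nat -> A | summable (fun n => star (x n) ** x n)]
    (fun x y => tsum (fun n => star (x n) ** y n)).

Definition dsum E F : formModule A :=
  @FormModule R A (ambient E * ambient F)%type
    (carrier E `*` carrier F)
    (fun x y => ip E x.1 y.1 + ip F x.2 y.2).

Record module_hom E F (U : ambient E -> ambient F) : Prop := {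
  module_hom_maps : forall x, carrier E x -> carrier F (U x);
  module_homD : forall x y, carrier E x -> carrier E y -> U (x + y) = U x + U y;
  module_homZ : forall (c : R[i]) x, carrier E x -> U (c *: x) = c *: U x;
  module_hom_ract : forall x (a : A), carrier E x -> U (x <* a) = U x <* a
}.

Definition is_adjoint E F (U : ambient E -> ambient F)
    (V : ambient F -> ambient E) : Prop :=
  (forall y, carrier F y -> carrier E (V y)) /\
  (forall x y, carrier E x -> carrier F y -> ip F (U x) y = ip E x (V y)).

Definition adjointable_hom E F (U : ambient E -> ambient F) : Prop :=
  module_hom U /\ exists V, is_adjoint U V.

Definition unitary_op E F (U : ambient E -> ambient F) : Prop :=
  adjointable_hom U /\
  exists V, [/\ is_adjoint U V, forall x, carrier E x -> V (U x) = x
    & forall y, carrier F y -> U (V y) = y].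

Definition unitarily_equivalent E F : Prop :=
  exists U : ambient E -> ambient F, unitary_op U.

End Hilbert.

Notation "H ~=u K" := (unitarily_equivalent H K) : ring_scope.

(* Main.v *)
(* Let K be the direct sum of E and H_A. The Gram-Schmidt process yields an orthonormal
   basis of K, that is, adjointable maps f_n : A -> K with f_m* f_n = delta_mn whose ranges
   span a dense submodule; then z |-> (f_n* z)_n is the required unitary. Fix a list of
   maps t : A -> K, the standard basis maps of H_A and a |-> x a for the generators x of E,
   each occurring infinitely often. Given f_0, ..., f_(n-1), let t' be the component of t
   orthogonal to them, let e be a basis map of H_A not used so far, and put
   f_n = (t' + eps e) (t'* t' + eps^2)^(-1/2). The inverse square root exists in the
   multiplier algebra of A although t'* t' need not be bounded uniformly over the
   seminorms, and t is within eps of the span of f_0, ..., f_n for every seminorm. Hence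
   neither a unit, nor bounded generators, nor a polar decomposition is needed.

   The inverse square root is a limit of polynomials converging locally uniformly on
   [0, oo), by the bound |q(h)| <= sup |q| over the spectrum for real polynomials q; that
   bound follows from factoring q + delta into positive factors. *)
Require Import Defs.
From HB Require Import structures.
From mathcomp Require Import all_boot all_order all_algebra.
From mathcomp Require Import complex ring lra.
From mathcomp Require Import all_classical all_reals all_analysis.

Set Implicit Arguments.
Unset Strict Implicit.
Unset Printing Implicit Defensive.

Import Order.TTheory GRing.Theory Num.Theory.
Import numFieldNormedType.Exports.

Local Open Scope classical_set_scope.
Local Open Scope ring_scope.

(** * Real polynomials *)

(** The summand H_A is what makes every normalization possible. The Gram operator of [t'] may
    degenerate, but [e] is orthogonal to [t'], so that adding [eps e] raises the Gram operator by
    [eps^2] and makes it bounded below; no step has to decide where [t'] vanishes.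

    No C*-algebra is at hand for a functional calculus: a seminorm may have a kernel, and no
    quotient is formed or completed. Spectral facts are therefore proved for one C*-seminorm [N] at
    a time on a unital algebra, with real polynomials as the only functions and [N (t - a) <= t] as
    the meaning of positivity. Within this calculus only the inverse square root needs a limit. The
    two facts on which the module theory rests are the positivity of [star x ** x] and the
    monotonicity of a seminorm on positive elements; together they give Cauchy-Schwarz and the
    best-approximation property of projections. *)

Lemma normc_real (R : realType) (t : R) : Normc.normc (t%:C)%C = `|t|.
Proof. by rewrite /= expr0n /= addr0 sqrtr_sqr. Qed.

(** Take a complex root [a + ib]. If [b] is nonzero, the remainder of [q] modulo [(X - a)^2 + b^2]
    is real of degree at most one and vanishes at a nonreal point, hence is zero. *)
Lemma real_poly_factor (R : realType) (q : {poly R}) : (1 < size q)%N ->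
  (exists (a : R) (Q : {poly R}), q = Q * ('X - a%:P)) \/
  (exists (a b : R) (Q : {poly R}), b != 0 /\ q = Q * (('X - a%:P) ^+ 2 + (b ^+ 2)%:P)).
Proof.
move=> sq.
have : size (map_poly (real_complex R) q) != 1 by rewrite size_map_poly neq_ltn sq orbT.
case/closed_rootP => -[a b] rz.
have [b0|bn0] := eqVneq b 0.
  left; exists a; move: rz; rewrite b0 fmorph_root => /factor_theorem[Q ->].
  by exists Q.
right; set D := ('X - a%:P) ^+ 2 + (b ^+ 2)%:P.
have sD : size D = 3%N.
  by rewrite size_polyDl size_exp_XsubC // (leq_ltn_trans (size_polyC_leq1 _)).
have Dz : (map_poly (real_complex R) D).[(a +i* b)%C] = 0.
  rewrite rmorphD rmorphXn rmorphB /= map_polyX !map_polyC /= !hornerE /=.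
  have -> : (a +i* b)%C - (a%:C)%C = (0 +i* b)%C.
    by apply/eqP; rewrite eq_complex /= subrr subr0 !eqxx.
  by apply/eqP; rewrite expr2 eq_complex /= !mul0r !mulr0 !addr0 sub0r expr2 addNr !eqxx.
have Dn0 : D != 0 by rewrite -size_poly_eq0 sD.
pose r := q %% D.
have rz0 : (map_poly (real_complex R) r).[(a +i* b)%C] = 0.
  move: rz; rewrite rootE {1}(divp_eq q D) rmorphD rmorphM hornerD hornerM /=.
  by rewrite Dz mulr0 add0r => /eqP.
have sr : (size r <= 2)%N by rewrite -ltnS -[3%N]sD ltn_modp.
have r1 : r = (r`_1)%:P * 'X + (r`_0)%:P.
  apply/polyP => i; rewrite coefD coefMX !coefC.
  by case: i => [|[|i]] /=; rewrite ?add0r ?addr0 // nth_default // (leq_trans sr).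
move: rz0; rewrite r1 rmorphD rmorphM /= !map_polyC map_polyX !hornerE /=.
move/eqP; rewrite eq_complex /= !mul0r subr0 addr0 => /andP[/eqP h1 /eqP h2].
have r10 : r`_1 = 0.
  by apply/eqP; move/eqP: h2; rewrite addr0 mulf_eq0 (negPf bn0) orbF.
exists a, b, (q %/ D); split=> //.
rewrite {1}(divp_eq q D) -/r r1 r10 mul0r add0r.
by move: h1; rewrite r10 mul0r add0r => ->; rewrite addr0.
Qed.

(** * A polynomial iteration for the square root *)

Section SquareRootIteration.
Variable R : realType.

(* The iteration [r' = (u + r^2) / 2] for [1 - sqrt (1 - u)]; its coefficients
   are nonnegative, so the error at [u = 1] bounds the error at every contraction. *)
Fixpoint sqrt_iter (n : nat) : {poly R} :=
  if n is m.+1 then 2^-1 *: ('X + sqrt_iter m ^+ 2) else 0.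

Lemma sqrt_iterS n : sqrt_iter n.+1 = 2^-1 *: ('X + sqrt_iter n ^+ 2).
Proof. by []. Qed.

(** This is [1 - r_n(1)] for the iterates [r_n]: substituting [r = 1 - e] in [(1 + r^2) / 2] turns
    [e] into [e - e^2 / 2]. *)
Fixpoint sqrt_err (n : nat) : R :=
  if n is m.+1 then sqrt_err m - sqrt_err m ^+ 2 / 2 else 1.

(** The reciprocal of the error starts at 1 and grows by at least 1/2 in each step. *)
Lemma sqrt_err_bound n : 0 <= sqrt_err n <= 2 / n.+2%:R.
Proof.
elim: n => [|n /andP[e0 IH]]; first by rewrite /= ler01 divff ?lexx ?pnatr_eq0.
rewrite [sqrt_err _]/=; set e := sqrt_err n in e0 IH *.
have k0 : 0 < n.+2%:R :> R by [].
have k2 : 2 <= n.+2%:R :> R by rewrite ler_nat.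
rewrite [n.+3%:R]mulrSr; move: k0 k2 IH; set k := _%:R => k0 k2.
rewrite ler_pdivlMr // => IH.
have e1 : e <= 1 by nra.
apply/andP; split; first by nra.
rewrite ler_pdivlMr; last by lra.
rewrite -(ler_pM2r k0) -(ler_pM2r k0).
(* With [x = e k <= 2] the goal is [(x k - x^2 / 2) (k + 1) <= 2 k^2]. At [x = 2] the left side is
   [2 k^2 - 2]; the product below is its value at 2 minus its value at [x]. *)
have : 0 <= (2 - e * k) * (k + 1) * (k - (2 + e * k) / 2).
  by rewrite !mulr_ge0 //; lra.
lra.
Qed.

Lemma sqrt_err_small d : 0 < d -> exists n, sqrt_err n <= d.
Proof.
move=> d0; exists (Num.truncn (2 / d)).
have /andP[_ /le_trans -> //] := sqrt_err_bound (Num.truncn (2 / d)).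
rewrite ler_pdivrMr // mulrC -ler_pdivrMr //.
have := Num.Theory.truncnS_gt (2 / d); rewrite -!natr1; lra.
Qed.

End SquareRootIteration.

(** * Polynomial approximation of real functions *)

Section ScalarApproximation.
Variable R : realType.
Implicit Types (d e x M : R).

(** Let [y] be the current approximation and [w] the root. One step turns the error [y - w] into
    [(y - w) (1 - (y + w) / 2)], which is nonnegative and at most [(y - w) - (y - w)^2 / 2]; hence
    [sqrt_err] dominates it for every [x]. *)
Lemma sqrt_poly d : 0 < d -> exists q : {poly R},
  forall x, 0 <= x <= 1 -> 0 <= q.[x] - Num.sqrt x <= d.
Proof.
move=> d0; have [n hn] := sqrt_err_small d0.
exists ((1 - sqrt_iter R n) \Po (1 - 'X)) => x /andP[x0 x1].
have w0 := sqrtr_ge0 x; have w2 := sqr_sqrtr x0.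
rewrite horner_comp; set y := _.[_].
suff : [/\ 0 <= y - Num.sqrt x, y - Num.sqrt x <= sqrt_err R n & y <= 1].
  by case=> h1 h2 _; rewrite h1 (le_trans h2).
rewrite {}/y; elim: n {hn} => [|n IH]; first by rewrite subr0 !hornerE /=; split; nra.
move: IH; rewrite sqrt_iterS !hornerE; have /andP[e0 _] := sqrt_err_bound R n.
have e1 : sqrt_err R n <= 1.
  by elim: (n) => [//|k IH] /=; apply: le_trans IH; rewrite lerBlDr lerDl divr_ge0 ?sqr_ge0.
rewrite [sqrt_err R n.+1]/=; move: (Num.sqrt x) (sqrt_err R n) (sqrt_iter R n).[_] w0 w2 e0 e1.
move=> w e r w0 w2 e0 e1 [h1 h2 h3].
have hy : 1 - 2^-1 * (1 - x + r * r) - w = (1 - r - w) * (1 - (1 - r + w) / 2).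
  by rewrite -w2; field.
have w1 : w <= 1 by nra.
split.
- by rewrite hy mulr_ge0 //; lra.
- rewrite hy; apply: le_trans (_ : (1 - r - w) * (1 - (1 - r - w) / 2) <= _); nra.
- nra.
Qed.

(** The negative part is [(|x| - x) / 2] with [|x| = M sqrt ((x / M)^2)]. Since [sqrt_poly]
    approximates from above, [m] is nonnegative and at least [- x], so both lower bounds are
    exact. *)
Lemma negpart_poly M d : 0 < M -> 0 < d -> exists m : {poly R},
  forall x, - M <= x <= M ->
  (0 <= x -> 0 <= m.[x] <= d) /\ (x <= 0 -> 0 <= m.[x] + x <= d).
Proof.
move=> M0 d0; have [q hq] := sqrt_poly (divr_gt0 d0 M0).
exists (2^-1 *: (M *: (q \Po (M^-1 *: 'X) ^+ 2) - 'X)) => x /andP[x1 x2].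
have := hq ((M^-1 * x) ^+ 2); rewrite !hornerE horner_comp !hornerE sqrtr_sqr.
have x01 : 0 <= (M^-1 * x) ^+ 2 <= 1.
  rewrite sqr_ge0 -real_normK ?num_real // expr_le1 // normrM gtr0_norm ?invr_gt0 //.
  by rewrite mulrC ler_pdivrMr // mul1r ler_norml x1.
move=> /(_ x01); rewrite expr2; move: q.[_] => y.
rewrite normrM gtr0_norm ?invr_gt0 // => /andP[y1 y2].
have z1 : `|x| <= M * y by rewrite -ler_pdivrMl // -subr_ge0.
have z2 : M * y <= `|x| + d.
  by rewrite -ler_pdivlMl // mulrDr [M^-1 * d]mulrC -lerBlDl.
split=> x0; [rewrite ger0_norm // in z1 z2 | rewrite ler0_norm // in z1 z2]; lra.
Qed.

Lemma expr_subr_small t d : 0 < t -> t <= 1 -> 0 < d -> exists j, (1 - t) ^+ j <= d.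
Proof.
move=> t0 t1 d0; exists (Num.truncn (d^-1 / t)).+1.
set j := _.+1.
have hj : d^-1 / t < j%:R by exact: Num.Theory.truncnS_gt.
(* Bernoulli in reciprocal form: [(1 - t) (1 + (k + 1) t) <= 1 + k t]. *)
have h k : (1 - t) ^+ k * (1 + k%:R * t) <= 1.
  elim: k => [|k IH]; first by rewrite expr0 mul0r addr0 mulr1.
  apply: le_trans IH; rewrite exprS -mulrA mulrCA ler_wpM2l ?exprn_ge0 ?subr_ge0 //.
  rewrite -natr1; have : 0 <= k%:R :> R by []. nra.
have p0 : 0 < 1 + j%:R * t by rewrite ltr_wpDr // mulr_ge0 // ltW.
rewrite -(ler_pM2r p0) (le_trans (h j)) // -ler_pdivrMl // mulr1.
by apply: ltW; rewrite ltr_wpDl // -ltr_pdivrMr.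
Qed.

Lemma ler_sqrtB x y : 0 <= x -> x <= y -> Num.sqrt y - Num.sqrt x <= Num.sqrt (y - x).
Proof.
move=> x0 xy; have y0 := le_trans x0 xy.
have := sqrtr_ge0 x; have := sqrtr_ge0 y; have := sqrtr_ge0 (y - x).
have yx : 0 <= y - x by rewrite subr_ge0.
have := sqr_sqrtr x0; have := sqr_sqrtr y0; have := sqr_sqrtr yx.
move: (Num.sqrt _) (Num.sqrt _) (Num.sqrt _) => a b c; nra.
Qed.

(** With [y = (e + x) / c] in [[t, 1]] the target is [sqrt (t / y) / sqrt e]. The geometric series
    for [1 / y] converges uniformly because [1 - y <= 1 - t < 1], and its partial sums keep
    [G <= t / y <= 1], inside the range of [sqrt_poly]. *)
Lemma invsqrt_poly e M d : 0 < e -> 0 <= M -> 0 < d -> exists q : {poly R},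
  forall x, 0 <= x <= M -> `|q.[x] - (Num.sqrt (e + x))^-1| <= d.
Proof.
move=> e0 M0 d0; pose c := e + M; pose t := e / c.
have c0 : 0 < c by rewrite ltr_wpDr.
have t0 : 0 < t by rewrite divr_gt0.
have t1 : t <= 1 by rewrite ler_pdivrMr // mul1r lerDl.
have se0 : 0 < Num.sqrt e by rewrite sqrtr_gt0.
(* Two errors of size [d1] occur, one from the polynomial root and one from truncating the series
   under the root; their sum is divided by [sqrt e]. The root costs a square, so the series is
   truncated with error [d1^2]. *)
pose d1 := d * Num.sqrt e / 2.
have d10 : 0 < d1 by rewrite divr_gt0 // mulr_gt0.
have [s hs] := sqrt_poly d10.
have [j hj] := expr_subr_small t0 t1 (exprn_gt0 2 d10).
pose y : {poly R} := c^-1 *: (e%:P + 'X).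
pose G := t *: \sum_(i < j) (1 - y) ^+ i.
exists ((Num.sqrt e)^-1 *: (s \Po G)) => x /andP[x0 x1].
have ex0 : 0 < e + x by rewrite ltr_wpDr.
have yx : y.[x] = (e + x) / c by rewrite /y !hornerE mulrC.
have y0 : 0 < y.[x] by rewrite yx divr_gt0.
have y1 : y.[x] <= 1 by rewrite yx ler_pdivrMr // mul1r lerD2l.
have ty : t <= y.[x] by rewrite yx ler_pM2r ?invr_gt0 // lerDl.
have yG : y.[x] * G.[x] = t * (1 - (1 - y.[x]) ^+ j).
  have := subrXX (1 : {poly R}) (1 - y) j.
  under eq_bigr do rewrite expr1n mul1r.
  rewrite expr1n subKr => /(congr1 (fun p => p.[x])).
  rewrite [G.[x]]hornerZ mulrCA -[_ * _.[x]]hornerM => <-.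
  by rewrite hornerD hornerN horner_exp hornerD hornerN !hornerC.
have p0 : 0 <= (1 - y.[x]) ^+ j by rewrite exprn_ge0 // subr_ge0.
have p1 : (1 - y.[x]) ^+ j <= d1 ^+ 2.
  by apply: le_trans hj; apply: lerXn2r; rewrite ?nnegrE ?subr_ge0 ?lerD2l ?lerN2.
have p2 : (1 - y.[x]) ^+ j <= 1 by rewrite exprn_ile1 // ?subr_ge0 // gerBl ltW.
have G0 : 0 <= G.[x].
  by rewrite -(pmulr_rge0 _ y0) yG mulr_ge0 ?subr_ge0 // ltW.
have Gt : G.[x] <= t / y.[x].
  by rewrite ler_pdivlMr // mulrC yG ler_piMr ?(ltW t0) // gerBl.
have ty1 : t / y.[x] <= 1 by rewrite ler_pdivrMr // mul1r.
have tG : t / y.[x] - G.[x] <= d1 ^+ 2.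
  rewrite -(ler_pM2l y0) mulrBr yG mulrCA mulfV ?gt_eqF // mulr1; nra.
have /andP[s0 s1] : 0 <= s.[G.[x]] - Num.sqrt G.[x] <= d1.
  by apply: hs; rewrite G0 (le_trans Gt).
have g1 := ler_sqrtB G0 Gt.
have g2 : Num.sqrt (t / y.[x] - G.[x]) <= d1.
  by rewrite -(ger0_norm (ltW d10)) -sqrtr_sqr ler_wsqrtr.
have g3 : Num.sqrt G.[x] <= Num.sqrt (t / y.[x]) by rewrite ler_wsqrtr.
have -> : (Num.sqrt (e + x))^-1 = (Num.sqrt e)^-1 * Num.sqrt (t / y.[x]).
  have -> : t / y.[x] = e / (e + x).
    by rewrite yx /t invf_div mulrA divfK // gt_eqF.
  by rewrite sqrtrM ?(ltW e0) // sqrtrV ?(ltW ex0) // mulKf // gt_eqF.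
rewrite hornerZ horner_comp -mulrBr normrM gtr0_norm ?invr_gt0 //.
rewrite ler_pdivrMl // ler_norml; rewrite /d1 in s1 g2; lra.
Qed.

End ScalarApproximation.

(** * Evaluation of real polynomials in a complex algebra *)

Section PolynomialCalculus.
Variables (R : realType) (B : algType R[i]).
Implicit Types (a b h x y : B) (q r : {poly R}) (s t : R).

Definition rscal t : B := (t%:C)%C%:A.

Definition ev h : {poly R} -> B := horner_alg h \o map_poly (real_complex R).

HB.instance Definition _ h :=
  GRing.RMorphism.copy (ev h) (horner_alg h \o map_poly (real_complex R)).

Lemma evC h t : ev h t%:P = rscal t.
Proof. by rewrite /ev /= map_polyC horner_algC. Qed.

Lemma evX h : ev h 'X = h.
Proof. by rewrite /ev /= map_polyX horner_algX. Qed.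

Lemma evZ h t q : ev h (t *: q) = (t%:C)%C *: ev h q.
Proof. by rewrite -mul_polyC rmorphM /= evC -scalerAl mul1r. Qed.

Lemma evD h q r : ev h (q + r) = ev h q + ev h r.
Proof. exact: rmorphD. Qed.

Lemma evB h q r : ev h (q - r) = ev h q - ev h r.
Proof. exact: rmorphB. Qed.

Lemma evM h q r : ev h (q * r) = ev h q * ev h r.
Proof. exact: rmorphM. Qed.

Lemma evXn h q n : ev h (q ^+ n) = ev h q ^+ n.
Proof. exact: rmorphXn. Qed.

Lemma ev0 h : ev h 0 = 0. Proof. exact: rmorph0. Qed.

Lemma ev1 h : ev h 1 = 1. Proof. exact: rmorph1. Qed.

Lemma ev_comp h q r : ev h (q \Po r) = ev (ev h r) q.
Proof.
elim/poly_ind: q => [|q t IH]; first by rewrite comp_poly0 !rmorph0.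
by rewrite comp_polyD comp_polyM comp_polyC comp_polyX !rmorphD !rmorphM /= IH !evC evX.
Qed.

Lemma ev_comm h b q : GRing.comm h b -> GRing.comm (ev h q) b.
Proof.
move=> hb; elim/poly_ind: q => [|q t IH]; first by rewrite rmorph0; exact/commr_sym/commr0.
rewrite rmorphD rmorphM /= evC evX; apply/commr_sym/commrD.
  by apply/commrM; exact/commr_sym.
by rewrite /GRing.comm /rscal -scalerAr -scalerAl mul1r mulr1.
Qed.

Lemma ev_commE h q r : GRing.comm (ev h q) (ev h r).
Proof. by rewrite /GRing.comm -!rmorphM /= mulrC. Qed.

End PolynomialCalculus.

(** * C*-seminorms on unital algebras *)

Section CstarSeminorm.
Variables (R : realType) (B : algType R[i]).
Implicit Types (a b h x y : B) (q r : {poly R}) (s t : R).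

(* [N] may vanish at nonzero elements, and even at [1]; no completeness is assumed, so
   functional calculus is limited to real polynomials. *)
Record unital_Cstar (st : B -> B) (N : B -> R) : Prop := {
  ucs_stD : {morph st : a b / a + b};
  ucs_stZ : forall (c : R[i]) a, st (c *: a) = conjc c *: st a;
  ucs_stM : forall a b, st (a * b) = st b * st a;
  ucs_stK : involutive st;
  ucs_ge0 : forall a, 0 <= N a;
  ucs_D : forall a b, N (a + b) <= N a + N b;
  ucs_Z : forall (c : R[i]) a, N (c *: a) = Normc.normc c * N a;
  ucs_M : forall a b, N (a * b) <= N a * N b;
  ucs_star : forall a, N (st a * a) = N a ^+ 2;
  ucs_1 : N 1 <= 1
}.

Variables (st : B -> B) (N : B -> R).
Hypothesis H : unital_Cstar st N.

Let N_ge0 a : 0 <= N a := ucs_ge0 H a.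
Let ND := ucs_D H.
Let NZ := ucs_Z H.
Let NM := ucs_M H.
Let stD := ucs_stD H.
Let stZ := ucs_stZ H.
Let stM := ucs_stM H.
Let stK := ucs_stK H.

Local Notation rs := (@rscal R B).

Lemma ucs_st1 : st 1 = 1.
Proof. by have := stM 1 (st 1); rewrite !mul1r !stK mul1r. Qed.

Lemma ucs_st0 : st 0 = 0.
Proof. by rewrite -[0](scale0r (0 : B)) stZ conjc0 !scale0r. Qed.

Lemma ucs_stN a : st (- a) = - st a.
Proof. by apply/eqP; rewrite -addr_eq0 -stD addNr ucs_st0. Qed.

Lemma ucs_stB a b : st (a - b) = st a - st b.
Proof. by rewrite stD ucs_stN. Qed.

Lemma ucs_st_rs t : st (rs t) = rs t.
Proof. by rewrite /rscal stZ ucs_st1 conjc_real. Qed.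

Lemma ucs_0 : N 0 = 0.
Proof. by rewrite -[0](scale0r (0 : B)) NZ Normc.normc0 mul0r. Qed.

Lemma ucs_N a : N (- a) = N a.
Proof. by rewrite -scaleN1r NZ normcN Normc.normc1 mul1r. Qed.

Lemma ucs_B a b : N (a - b) <= N a + N b.
Proof. by apply: (le_trans (ND _ _)); rewrite ucs_N. Qed.

Lemma ucs_BC a b : N (a - b) = N (b - a).
Proof. by rewrite -ucs_N opprB. Qed.

Lemma ucs_D3 c a b : N (a - b) <= N (a - c) + N (c - b).
Proof. by rewrite -(subrKA c) ND. Qed.

Lemma ucs_rs_le t : N (rs t) <= `|t|.
Proof. by rewrite /rscal NZ normc_real ler_piMr // (ucs_1 H). Qed.

Lemma ucs_Zr t a : N ((t%:C)%C *: a) = `|t| * N a.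
Proof. by rewrite NZ normc_real. Qed.

Lemma ucs_st a : N (st a) = N a.
Proof.
have le b : N b <= N (st b).
  have [/eqP ->|b0] := boolP (N b == 0); first exact: N_ge0.
  have bgt : 0 < N b by rewrite lt0r b0 N_ge0.
  by rewrite -(ler_pM2r bgt) -expr2 -(ucs_star H) NM.
by apply/eqP; rewrite eq_le le andbT -[X in _ <= N X]stK le.
Qed.

Definition sa a := st a = a.

Lemma saD a b : sa a -> sa b -> sa (a + b).
Proof. by rewrite /sa stD => -> ->. Qed.

Lemma saB a b : sa a -> sa b -> sa (a - b).
Proof. by rewrite /sa ucs_stB => -> ->. Qed.

Lemma saZ t a : sa a -> sa ((t%:C)%C *: a).
Proof. by rewrite /sa stZ conjc_real => ->. Qed.

Lemma sa_rs t : sa (rs t).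
Proof. exact: ucs_st_rs. Qed.

Lemma sa_ev h q : sa h -> sa (ev h q).
Proof.
move=> hh; elim/poly_ind: q => [|q t IH]; first by rewrite rmorph0; exact: ucs_st0.
rewrite rmorphD rmorphM /= evC evX; apply: saD; last exact: sa_rs.
rewrite /sa stM IH hh; exact/esym/ev_comm.
Qed.

Lemma sa_sq a : sa a -> sa (a ^+ 2).
Proof. by rewrite /sa expr2 stM => ->. Qed.

Lemma ucs_sq a : sa a -> N (a ^+ 2) = N a ^+ 2.
Proof. by move=> aa; rewrite -(ucs_star H) aa expr2. Qed.

(** For self-adjoint [a] the C*-identity used twice gives [N (a^4) = N a ^ 4], and [a^4 = a^3 a]. *)
Lemma ucs_cube a : sa a -> N a ^+ 3 <= N (a ^+ 3).
Proof.
move=> aa; have [/eqP ->|a0] := boolP (N a == 0); first by rewrite expr0n /= N_ge0.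
have agt : 0 < N a by rewrite lt0r a0 N_ge0.
rewrite -(ler_pM2r agt) -exprSr.
have -> : N a ^+ 4 = N (a ^+ 4).
  by rewrite (exprM a 2 2) ucs_sq ?ucs_sq -?exprM //; exact: sa_sq.
by rewrite exprSr NM.
Qed.

Lemma ucs_Dhalf t a b : N a <= t -> N b <= t -> N ((2^-1%:C)%C *: (a + b)) <= t.
Proof.
move=> at_ bt; rewrite ucs_Zr ger0_norm ?invr_ge0 // mulrC ler_pdivrMr //.
by apply: (le_trans (ND _ _)); rewrite mulr_natr mulr2n lerD.
Qed.

Lemma scale_half_double a : (2^-1%:C)%C *: (a + a) = a.
Proof.
rewrite -mulr2n -(scaler_nat 2 a) scalerA -(rmorph_nat (real_complex R)) -rmorphM.
by rewrite mulVf ?pnatr_eq0 // rmorph1 scale1r.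
Qed.

Lemma subr_sqr_comm a b : GRing.comm a b -> (a - b) * (a + b) = a ^+ 2 - b ^+ 2.
Proof.
by move=> ab; rewrite mulrDr !mulrBl -!expr2 -ab addrA subrK.
Qed.

Lemma sqrDB_comm a b :
  GRing.comm a b -> (a + b) ^+ 2 + (a - b) ^+ 2 = (a ^+ 2 + b ^+ 2) *+ 2.
Proof.
move=> ab; rewrite !expr2 !(mulrDl, mulrDr) mulrNN !(mulrN, mulNr) -ab mulr2n.
rewrite [LHS]addrACA [X in X + _]addrACA subrr addr0 [RHS]addrACA.
by rewrite [X in _ + X]addrACA subrr add0r.
Qed.

(* With [u = d + i b] one has [u* u = b^2 + d^2] and [u^2 + u*^2 = 2 (d^2 - b^2)]. *)
Lemma ucs_sqB_le b d : sa b -> sa d -> GRing.comm b d ->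
  N (b ^+ 2 - d ^+ 2) <= N (b ^+ 2 + d ^+ 2).
Proof.
move=> bb dd bd; pose c := 'i%C *: b; pose u := d + c.
have c2 : c ^+ 2 = - b ^+ 2.
  by rewrite /c expr2 -scalerAl -scalerAr scalerA -expr2 sqr_i scaleN1r -expr2.
have cd : GRing.comm d c by rewrite /GRing.comm /c -scalerAl -scalerAr bd.
have su : st u = d - c.
  rewrite /u stD dd stZ bb -scaleNr; congr (_ + _ *: _).
  by apply/eqP; rewrite eq_complex /= oppr0 !eqxx.
have uu : st u * u = b ^+ 2 + d ^+ 2.
  by rewrite su subr_sqr_comm // c2 opprK addrC.
have u2 : d ^+ 2 - b ^+ 2 = (2^-1%:C)%C *: (u ^+ 2 + st u ^+ 2).
  by rewrite su sqrDB_comm // c2 mulr2n scale_half_double.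
rewrite ucs_BC u2 -uu (ucs_star H); apply: ucs_Dhalf; rewrite expr2;
  by apply: (le_trans (NM _ _)); rewrite ?ucs_st.
Qed.

(** A norm description of having spectrum in [[0, 2 t]], which involves no inverses and makes sense
    for a seminorm on an incomplete algebra. By [pos_rsB_le] below, every [t >= N a] is then a
    witness. *)
Definition pos a := sa a /\ exists2 t, 0 <= t & N (rs t - a) <= t.

Lemma rsD s t : rs (s + t) = rs s + rs t.
Proof. by rewrite /rscal rmorphD scalerDl. Qed.

Lemma rsB s t : rs (s - t) = rs s - rs t.
Proof. by rewrite /rscal rmorphB scalerBl. Qed.

Lemma scale_rs s t : (s%:C)%C *: rs t = rs (s * t).
Proof. by rewrite /rscal scalerA rmorphM. Qed.

Lemma rs_comm t a : GRing.comm (rs t) a.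
Proof. by rewrite /GRing.comm /rscal -scalerAl -scalerAr mul1r mulr1. Qed.

Lemma pos_sa a : pos a -> sa a. Proof. by case. Qed.

Lemma posD a b : pos a -> pos b -> pos (a + b).
Proof.
move=> [sa_ [s s0 hs]] [sb [t t0 ht]]; split; first exact: saD.
exists (s + t); first exact: addr_ge0.
by rewrite rsD opprD addrACA (le_trans (ND _ _)) // lerD.
Qed.

Lemma posZ s a : 0 <= s -> pos a -> pos ((s%:C)%C *: a).
Proof.
move=> s0 [aa [t t0 ht]]; split; first exact: saZ.
exists (s * t); first exact: mulr_ge0.
by rewrite -scale_rs -scalerBr ucs_Zr ger0_norm // ler_wpM2l.
Qed.

Lemma pos_rs t : 0 <= t -> pos (rs t).
Proof.
by move=> t0; split; [exact: sa_rs | exists t; rewrite // subrr ucs_0].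
Qed.

Lemma pos_rsB t a : sa a -> N a <= t -> pos (rs t - a).
Proof.
move=> aa at_; split; first by apply: saB => //; exact: sa_rs.
by exists t; [exact: le_trans at_ | rewrite opprB addrC subrK].
Qed.

(** Both bounds are values at [u = 1]: of the iterate itself, and of its next increment. They
    propagate through [r'' - r' = (r' - r) (r' + r) / 2], where [r], [r'], [r''] are consecutive
    iterates. *)
Lemma sqrt_iter_bound u n : N u <= 1 ->
  N (ev u (sqrt_iter R n)) <= 1 - sqrt_err R n /\
  N (ev u (sqrt_iter R n.+1) - ev u (sqrt_iter R n)) <= sqrt_err R n ^+ 2 / 2.
Proof.
move=> u1; elim: n => [|n [IH1 IH2]].
  rewrite /= rmorph0 ucs_0 subrr expr0n /= addr0 subr0 expr1n evZ evX ucs_Zr.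
  by rewrite ger0_norm ?invr_ge0 // div1r; split=> //; rewrite ler_piMr ?invr_ge0.
have /andP[e0 _] := sqrt_err_bound R n.
have IH3 : N (ev u (sqrt_iter R n.+1)) <= 1 - sqrt_err R n.+1.
  rewrite -[ev u (sqrt_iter R n.+1)](subrK (ev u (sqrt_iter R n))).
  by apply: (le_trans (ND _ _)); rewrite /=; lra.
split=> //.
rewrite -evB (sqrt_iterS R n.+1) [X in _ - X]sqrt_iterS -scalerBr.
rewrite opprD addrACA subrr add0r subr_sqr evZ ucs_Zr ger0_norm ?invr_ge0 //.
rewrite mulrC ler_pM2r ?invr_gt0 // evM evB evD.
apply: (le_trans (NM _ _)).
apply: le_trans (_ : (sqrt_err R n ^+ 2 / 2) * ((1 - sqrt_err R n.+1) + (1 - sqrt_err R n)) <= _).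
  by apply: ler_pM; rewrite ?N_ge0 //; apply: (le_trans (ND _ _)); exact: lerD.
by rewrite /=; set e := sqrt_err R n; lra.
Qed.

(** Without completeness the iteration need not have a limit, but none is required:
    [(1 - r)^2 - (1 - u) = 2 (r' - r)], so a small increment already makes [1 - r] an approximate
    root. The defect is at most [sqrt_err n ^ 2], which is below [d] once the error is below both 1
    and [d]. *)
Lemma sqrt_contraction u d : N u <= 1 -> 0 < d ->
  exists q : {poly R}, N (ev u q ^+ 2 - (1 - u)) <= d.
Proof.
move=> u1 d0; have d1 : 0 < Num.min 1 d by rewrite lt_min ltr01.
have [n hn] := sqrt_err_small d1.
exists (1 - sqrt_iter R n).
have [_ b2] := sqrt_iter_bound n u1.
have -> : ev u (1 - sqrt_iter R n) ^+ 2 - (1 - u) =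
    (2%:C)%C *: (ev u (sqrt_iter R n.+1) - ev u (sqrt_iter R n)).
  rewrite -evB -evZ -evXn -{2}(evX u) -(ev1 u) -!evB.
  congr (ev u _); rewrite sqrt_iterS.
  rewrite scalerBr scalerA mulfV ?pnatr_eq0 // scale1r.
  by rewrite scaler_nat; ring.
rewrite ucs_Zr ger0_norm //; move: hn b2; rewrite le_min => /andP[h1 h2].
have /andP[e0 _] := sqrt_err_bound R n; nra.
Qed.

(** A positive witness [t] says exactly that [u = (t - a) / t] is a contraction, and
    [a = t (1 - u)]. The approximate root is a polynomial in [a], so it is self-adjoint and commutes
    with whatever commutes with [a]. *)
Lemma pos_sqrt a d : pos a -> 0 < d -> exists q : {poly R}, N (ev a q ^+ 2 - a) <= d.
Proof.
move=> [aa [t t0 ht]] d0.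
have [t00|tn0] := eqVneq t 0.
  exists 0; rewrite rmorph0 expr0n /= sub0r ucs_N.
  move: ht; rewrite t00 /rscal rmorph0 scale0r sub0r ucs_N => ht.
  exact: le_trans (ltW d0).
have tgt : 0 < t by rewrite lt0r tn0.
pose u := (t^-1%:C)%C *: (rs t - a).
have u1 : N u <= 1.
  by rewrite /u ucs_Zr ger0_norm ?invr_ge0 // mulrC ler_pdivrMr // mul1r.
have [q hq] := sqrt_contraction u1 (divr_gt0 d0 tgt).
exists (Num.sqrt t *: (q \Po (t^-1 *: (t%:P - 'X)))).
rewrite evZ ev_comp evZ rmorphB /= evC evX -/u.
have -> : ((Num.sqrt t)%:C%C *: ev u q) ^+ 2 - a = (t%:C)%C *: (ev u q ^+ 2 - (1 - u)).
  rewrite exprZn -rmorphXn /= sqr_sqrtr // scalerBr; congr (_ - _).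
  rewrite scalerBr scalerA -rmorphM /= mulfV // rmorph1 scale1r.
  by rewrite -/(rs t) opprB addrC subrK.
by rewrite ucs_Zr ger0_norm // mulrC -ler_pdivlMr.
Qed.

Lemma ler_eps s t (k : R) : (forall d, 0 < d -> s <= t + k * d) -> s <= t.
Proof.
move=> h; apply/ler_addgt0Pr => e e0.
have k1 : 0 < `|k| + 1 by rewrite ltr_wpDl.
apply: (le_trans (h _ (divr_gt0 e0 k1))); rewrite lerD2l mulrCA ler_piMr ?(ltW e0) //.
by rewrite ler_pdivrMr // mul1r (le_trans (ler_norm k)) // lerDl.
Qed.

(** This plays the role of [|x - y| <= x + y] for nonnegative reals. Commuting approximate roots
    reduce it to [ucs_sqB_le]; the factor 4 counts the replacement of [a] and of [b] on both
    sides. *)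
Lemma pos_subr_le a b : pos a -> pos b -> GRing.comm a b -> N (a - b) <= N (a + b).
Proof.
move=> pa pb ab; apply: (@ler_eps _ _ 4) => d d0.
have [q hq] := pos_sqrt pa d0; have [r hr] := pos_sqrt pb d0.
have := @ucs_sqB_le (ev a q) (ev b r) (sa_ev _ (pos_sa pa)) (sa_ev _ (pos_sa pb)).
have /[swap]/[apply] : GRing.comm (ev a q) (ev b r).
  by apply: ev_comm; apply/commr_sym; exact/ev_comm/commr_sym.
move: (ev a q ^+ 2) (ev b r ^+ 2) hq hr => x y hx hy hxy.
have h1 : N (a - b) <= N (x - y) + (d + d).
  have -> : a - b = (x - y) - ((x - a) - (y - b)).
    by rewrite [x - a - _](_ : _ = (x - y) - (a - b)) ?subKr // !opprD !opprK addrACA.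
  apply: (le_trans (ucs_B _ _)); rewrite lerD2l (le_trans (ucs_B _ _)) //; exact: lerD.
have h2 : N (x + y) <= N (a + b) + (d + d).
  have -> : x + y = (a + b) + ((x - a) + (y - b)) by rewrite addrACA !subrKC.
  apply: (le_trans (ND _ _)); rewrite lerD2l (le_trans (ND _ _)) //; exact: lerD.
lra.
Qed.

(** The root of [h^2] is known, namely [h], while [s - h^2] is positive by [pos_rsB] and so has an
    approximate root commuting with [h]. Then [ucs_sqB_le] bounds the difference of these two
    elements by their sum [s], and half of this difference is, up to sign, [s / 2 - h^2]. *)
Lemma pos_sq h : sa h -> pos (h ^+ 2).
Proof.
move=> hh; set s := N h ^+ 2; split; first exact: sa_sq.
have s0 : 0 <= s by rewrite exprn_ge0.
exists (s / 2); first by rewrite divr_ge0.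
have e0 : N (h ^+ 2) = s by rewrite ucs_sq.
have pb : pos (rs s - h ^+ 2) by apply: pos_rsB; [exact: sa_sq | rewrite e0].
suff h1 : N (h ^+ 2 - (rs s - h ^+ 2)) <= s.
  have -> : rs (s / 2) - h ^+ 2 = - ((2^-1%:C)%C *: (h ^+ 2 - (rs s - h ^+ 2))).
    rewrite -scalerN opprB -[_ - h ^+ 2 - _]addrA -opprD scalerBr scale_half_double.
    by rewrite scale_rs mulrC.
  by rewrite ucs_N ucs_Zr ger0_norm ?invr_ge0 // mulrC ler_pM2r ?invr_gt0.
apply: (@ler_eps _ _ 2) => d d0.
have [q hq] := pos_sqrt pb d0.
have := @ucs_sqB_le h (ev (rs s - h ^+ 2) q) hh (sa_ev _ (pos_sa pb)).
have /[swap]/[apply] : GRing.comm h (ev (rs s - h ^+ 2) q).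
  apply/commr_sym/ev_comm/commr_sym/commrB; first exact/commr_sym/rs_comm.
  exact: commrX.
move: (ev _ q ^+ 2) hq => x hx hxy.
have h1 : N (h ^+ 2 - (rs s - h ^+ 2)) <= N (h ^+ 2 - x) + d.
  by apply: (le_trans (@ucs_D3 x _ _)); rewrite lerD2l.
have h2 : N (h ^+ 2 + x) <= s + d.
  have -> : h ^+ 2 + x = rs s + (x - (rs s - h ^+ 2)) by rewrite opprB addrCA subrKC addrC.
  by apply: (le_trans (ND _ _)); rewrite lerD // (le_trans (ucs_rs_le _)) // ger0_norm.
lra.
Qed.

(** Apply [pos_subr_le] to [a] and [t - a], whose sum is [t]: this bounds [t - 2 a], and [t - a] is
    the mean of [t] and [t - 2 a]. *)
Lemma pos_rsB_le t a : pos a -> N a <= t -> N (rs t - a) <= t.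
Proof.
move=> pa at_; have pb := pos_rsB (pos_sa pa) at_.
have ab : GRing.comm a (rs t - a) by apply: commrB => //; exact/commr_sym/rs_comm.
have rt : N (rs t) <= t.
  by apply: (le_trans (ucs_rs_le _)); rewrite ger0_norm // (le_trans _ at_).
have := le_trans (pos_subr_le pa pb ab); rewrite subrKC => /(_ t rt).
rewrite ucs_BC => h; have -> : rs t - a = (2^-1%:C)%C *: (rs t + (rs t - a - a)).
  by rewrite -!addrA -opprD addrA -{1}(scale_half_double (rs t)) -{1}(scale_half_double a) -scalerBr.
exact: ucs_Dhalf.
Qed.

(** [a] and [b] need not commute: [M - a] is the sum of the positive elements [M - (a + b)] and [b],
    and it commutes with [a]. Then [a] is the mean of [M] and [2 a - M]. *)
Lemma pos_le_D a b : pos a -> pos b -> N a <= N (a + b).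
Proof.
move=> pa pb; set M := N (a + b).
have pc : pos (rs M - a).
  have -> : rs M - a = rs M - (a + b) + b by rewrite opprD addrA subrK.
  by apply: posD => //; apply: pos_rsB => //; exact/pos_sa/posD.
have ac : GRing.comm a (rs M - a) by apply: commrB => //; exact/commr_sym/rs_comm.
have rM : N (rs M) <= M by apply: (le_trans (ucs_rs_le _)); rewrite ger0_norm // N_ge0.
have := le_trans (pos_subr_le pa pc ac); rewrite subrKC => /(_ M rM) h.
have -> : a = (2^-1%:C)%C *: (rs M + (a - (rs M - a))).
  by rewrite opprB addrCA subrKC scale_half_double.
exact: ucs_Dhalf.
Qed.

Lemma pos_closed a : sa a ->
  (forall d, 0 < d -> exists2 b, pos b & N (a - b) <= d) -> pos a.
Proof.
(* The witnesses of the approximants may vary, but approximants within 1 of [a] all have [N a + 1]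
   as a common witness, by [pos_rsB_le]. *)
move=> aa h; split=> //; exists (N a + 1); first by rewrite addr_ge0.
apply: (@ler_eps _ _ 1) => d d0.
have d1 : 0 < Num.min 1 d by rewrite lt_min ltr01.
have [b pb] := h _ d1; rewrite le_min => /andP[b1 bd].
have : N (rs (N a + 1) - b) <= N a + 1.
  apply: pos_rsB_le => //; rewrite -[b](subrK a) addrC.
  by apply: (le_trans (ND _ _)); rewrite lerD2l ucs_BC.
move=> h1; have -> : rs (N a + 1) - a = rs (N a + 1) - b + (b - a) by rewrite subrKA.
by apply: (le_trans (ND _ _)); rewrite mul1r lerD // ucs_BC.
Qed.

(** The product is a limit of squares of [q(a) r(b)], which is self-adjoint because the two
    approximate roots commute. *)
Lemma posM a b : pos a -> pos b -> GRing.comm a b -> pos (a * b).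
Proof.
move=> pa pb ab.
have [sa_ sb] := (pos_sa pa, pos_sa pb).
apply: pos_closed; first by rewrite /sa stM sa_ sb.
(* The total error is [(d / k) N b + (N a + 1) (d / k) = d], where accuracy 1 of the first root
   gives [N (q(a)^2) <= N a + 1]. *)
move=> d d0; set k := N a + N b + 1.
have k0 : 0 < k by rewrite ltr_wpDl // addr_ge0.
have e0 : 0 < Num.min 1 (d / k) by rewrite lt_min ltr01 divr_gt0.
have [q] := pos_sqrt pa e0; have [r] := pos_sqrt pb e0.
rewrite !le_min => /andP[b1 b2] /andP[a1 a2].
have qr : GRing.comm (ev a q) (ev b r).
  by apply: ev_comm; apply/commr_sym; exact/ev_comm/commr_sym.
exists ((ev a q * ev b r) ^+ 2).
  by apply: pos_sq; rewrite /sa stM !sa_ev.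
rewrite exprMn_comm //.
have -> : a * b - ev a q ^+ 2 * ev b r ^+ 2 =
  (a - ev a q ^+ 2) * b + ev a q ^+ 2 * (b - ev b r ^+ 2).
  by rewrite mulrBl mulrBr addrA subrK.
have n2 : N (ev a q ^+ 2) <= N a + 1.
  by rewrite -[ev a q ^+ 2](subrK a) addrC; apply: (le_trans (ND _ _)); rewrite lerD2l.
apply: (le_trans (ND _ _)); apply: (le_trans (lerD (NM _ _) (NM _ _))).
rewrite ![N (_ - _ ^+ 2)]ucs_BC.
apply: le_trans (_ : d / k * N b + (N a + 1) * (d / k) <= _).
  by apply: lerD; apply: ler_pM.
rewrite mulrC -mulrDl addrC addrAC -/k mulrCA mulfV ?mulr1 //.
exact: lt0r_neq0.
Qed.

(* Strict positivity keeps the real roots of [q] away from [al, be], so that each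
   irreducible factor is, up to sign, positive at [h]. *)
Lemma pos_ev_gt0 (al be : R) h q : sa h -> al <= be ->
  pos (h - rs al) -> pos (rs be - h) ->
  (forall x : R, al <= x <= be -> 0 < q.[x]) -> pos (ev h q).
Proof.
move=> hh alb ph1 ph2; have [n] := ubnP (size q).
elim: n q => // n IH q; rewrite ltnS => sq qgt.
have [s1|s1] := leqP (size q) 1.
  have qE := size1_polyC s1; rewrite {1}qE evC; apply: pos_rs.
  have : 0 < q.[al] by apply: qgt; rewrite lexx.
  by rewrite {1}qE hornerC => /ltW.
have [[a [Q qE]]|[a [b [Q [bn0 qE]]]]] := real_poly_factor s1.
  have Q0 : Q != 0 by apply: contraTneq s1 => Q0; rewrite qE Q0 mul0r size_poly0.
  have sQ : (size Q < n)%N by move: sq; rewrite qE size_Mmonic ?monicXsubC // size_XsubC addn2.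
  have [aal|ala] := ltP a al.
    have pQ : pos (ev h Q).
      apply: IH => // x /andP[x1 x2]; have := qgt x; rewrite qE hornerM hornerXsubC.
      by rewrite pmulr_lgt0; [apply; rewrite x1 | rewrite subr_gt0 (lt_le_trans aal)].
    rewrite qE evM; apply: posM => //; last exact: ev_commE.
    rewrite evB evX evC -(subrK (rs al) h) -addrA -rsB; apply: posD => //.
    by apply: pos_rs; rewrite subr_ge0 ltW.
  have [bea|abe] := ltP be a.
    have pQ : pos (ev h (- Q)).
      apply: IH; rewrite ?size_polyN // => x /andP[x1 x2]; have := qgt x; rewrite qE.
      rewrite hornerM hornerXsubC hornerN -mulrNN opprB.
      by rewrite pmulr_lgt0; [apply; rewrite x1 | rewrite subr_gt0 (le_lt_trans x2)].
    rewrite qE -mulrNN opprB evM; apply: posM => //; last exact: ev_commE.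
    rewrite evB evX evC -(subrK (rs be) (rs a)) -addrA -rsB; apply: posD => //.
    by apply: pos_rs; rewrite subr_ge0 ltW.
  by have := qgt a; rewrite ala abe qE hornerM hornerXsubC subrr mulr0 ltxx => /(_ isT).
set D := _ + _ in qE.
have sD : size D = 3%N.
  by rewrite size_polyDl size_exp_XsubC // (leq_ltn_trans (size_polyC_leq1 _)).
have D0 (x : R) : 0 < D.[x].
  rewrite /D !hornerE ltr_wpDl ?sqr_ge0 //.
  by rewrite lt0r sqr_ge0 sqrf_eq0 bn0.
have Q0 : Q != 0 by apply: contraTneq s1 => Q0; rewrite qE Q0 mul0r size_poly0.
have Dn0 : D != 0 by rewrite -size_poly_eq0 sD.
have sQ : (size Q < n)%N.
  by move: sq; rewrite qE size_mul // sD addn3 /= => /(leq_trans _); apply.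
have pQ : pos (ev h Q).
  apply: IH => // x xx; have := qgt x xx; rewrite qE hornerM.
  by rewrite pmulr_lgt0 ?D0.
rewrite qE evM; apply: posM => //; last exact: ev_commE.
rewrite evD evXn evC; apply: posD; first by apply: pos_sq; exact: sa_ev.
by apply: pos_rs; rewrite sqr_ge0.
Qed.

Lemma pos_ev (al be : R) h q : sa h -> al <= be ->
  pos (h - rs al) -> pos (rs be - h) ->
  (forall x : R, al <= x <= be -> 0 <= q.[x]) -> pos (ev h q).
Proof.
move=> hh alb ph1 ph2 q0; apply: pos_closed; first exact: sa_ev.
move=> d d0; exists (ev h (q + d%:P)).
  apply: (@pos_ev_gt0 al be) => // x xx.
  by rewrite hornerD hornerC ltr_wpDl // q0.
by rewrite evD opprD addrA subrr add0r ucs_N evC (le_trans (ucs_rs_le _)) // ger0_norm // ltW.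
Qed.

(** Both [s + q] and [s - q] are nonnegative on the interval, hence positive at [h]; [pos_subr_le]
    compares their difference [2 q(h)] with their sum [2 s]. This estimate stands in for the
    spectral radius formula. *)
Lemma ev_le (al be : R) h q s : sa h -> al <= be ->
  pos (h - rs al) -> pos (rs be - h) ->
  (forall x : R, al <= x <= be -> `|q.[x]| <= s) -> N (ev h q) <= s.
Proof.
move=> hh alb ph1 ph2 qs.
have s0 : 0 <= s by apply: le_trans (qs al _); rewrite ?normr_ge0 ?lexx ?alb.
have p1 : pos (ev h (s%:P + q)).
  apply: (pos_ev hh alb ph1 ph2) => x /qs; rewrite ler_norml hornerD hornerC; lra.
have p2 : pos (ev h (s%:P - q)).
  apply: (pos_ev hh alb ph1 ph2) => x /qs; rewrite ler_norml hornerD hornerN hornerC; lra.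
have := pos_subr_le p1 p2 (@ev_commE _ _ h _ _).
rewrite -evB -evD (_ : _ - _ = q + q); last by ring.
rewrite (_ : _ + (_ - _) = s%:P + s%:P); last by ring.
rewrite !evD evC.
have le2 : N (rs s + rs s) <= s + s.
  by apply: (le_trans (ND _ _)); apply: lerD; rewrite (le_trans (ucs_rs_le _)) // ger0_norm.
move=> /le_trans/(_ le2) h2; rewrite -(scale_half_double (ev h q)) ucs_Zr.
by rewrite ger0_norm ?invr_ge0 // mulrC ler_pdivrMr // mulr_natr mulr2n.
Qed.

Lemma sa_spectrum h M : sa h -> N h <= M -> pos (h - rs (- M)) /\ pos (rs M - h).
Proof.
move=> hh hM; split; last exact: pos_rsB.
rewrite /rscal rmorphN scaleNr opprK addrC -[h]opprK; apply: pos_rsB; rewrite ?ucs_N //.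
by rewrite /sa ucs_stN hh.
Qed.

Lemma ev_intertwine y v w q : y * v = w * y -> y * ev v q = ev w q * y.
Proof.
move=> yv; elim/poly_ind: q => [|q t IH]; first by rewrite !ev0 mulr0 mul0r.
rewrite !evD !evM !evC !evX mulrDr mulrDl mulrA IH -!mulrA yv.
by rewrite (rs_comm t y).
Qed.

(** This is half the sum of the squares of the self-adjoint elements [y + st y] and [i (y - st y)];
    the terms [y^2] and [(st y)^2] cancel. *)
Lemma pos_star_add y : pos (st y * y + y * st y).
Proof.
pose c := y + st y; pose e := 'i%C *: (y - st y).
have sc : sa c by rewrite /sa /c stD stK addrC.
have se : sa e.
  rewrite /sa /e stZ ucs_stB stK -opprB scalerN -scaleNr; congr (_ *: _).
  by apply/eqP; rewrite eq_complex /= opprK oppr0 !eqxx.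
have -> : st y * y + y * st y = (2^-1%:C)%C *: (c ^+ 2 + e ^+ 2).
  rewrite /e exprZn sqr_i scaleN1r -[LHS]scale_half_double; congr (_ *: _).
  rewrite /c !expr2 !(mulrDl, mulrDr) mulrNN !(mulrN, mulNr).
  rewrite opprD !opprB opprD opprK.
  rewrite [RHS]addrACA [y * y + _]addrC -![_ + _ + (_ - _)]addrA !subrKC.
  by rewrite [RHS]addrC addrACA.
by apply: posZ; [rewrite invr_ge0 | apply: posD; exact: pos_sq].
Qed.

(** * Positivity of [st x * x] *)

Section StarPositive.
Variable x : B.
Let h := st x * x.
Let M := N h + 1.
(** The first summand bounds [N y ^ 2] for [y = x m(h)], since [m <= M + 1] on [[- M, M]] when the
    accuracy is at most 1; the others ensure [M <= L]. *)
Let L := N x ^+ 2 * (M + 1) ^+ 2 + 1 + M.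

Let hh : sa h. Proof. by rewrite /sa /h stM stK. Qed.
Let M1 : 1 <= M. Proof. by rewrite lerDr. Qed.
Let LM : M <= L.
Proof. by rewrite /L lerDr addr_ge0 // mulr_ge0 // exprn_ge0 // addr_ge0 // (le_trans ler01). Qed.

Let h_spec : pos (h - rs (- M)) /\ pos (rs M - h).
Proof. by apply: sa_spectrum => //; rewrite lerDl. Qed.

Let MM : - M <= M. Proof. by move: M1; lra. Qed.

(* Kaplansky's argument. With [m] close to the negative part and [y = x m(h)], the element
   [v = y* y] is nearly negative, so [w = y y* = y* y + y y* - v] is nearly positive.
   But [v n(v)^2] and [w n(w)^2] have the same norm, and for [n] close to the positive
   part the former is small and the latter close to [w^3]. *)
Lemma star_negpart_small (d : R) (m : {poly R}) : 0 < d -> d <= 1 ->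
  (forall t : R, - M <= t <= M ->
    (0 <= t -> 0 <= m.[t] <= d) /\ (t <= 0 -> 0 <= m.[t] + t <= d)) ->
  N (ev h ('X * m ^+ 2)) ^+ 3 <= d * (L + M * (M + 1) ^+ 2 + L * (2 * L + 1) + M * (M ^+ 2 + 1)).
Proof.
move=> d0 d1 hm.
have [hs1 hs2] := h_spec.
pose y := x * ev h m; pose v := st y * y; pose w := y * st y; pose eta := M * d ^+ 2.
have eta0 : 0 <= eta by rewrite mulr_ge0 ?sqr_ge0 // (le_trans ler01).
have M0 : 0 <= M := le_trans ler01 M1.
have etaM : eta <= M by rewrite ler_piMr // exprn_ile1 // ltW.
have vE : v = ev h ('X * m ^+ 2).
  rewrite (_ : 'X * m ^+ 2 = m * 'X * m); last by ring.
  by rewrite !evM evX /v /y stM sa_ev // {2}/h !mulrA.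
have mM : N (ev h m) <= M + 1.
  apply: (ev_le hh MM) => // t tM; have [h1 h2] := hm t tM; rewrite ler_norml.
  by move: M1; have [t0|t0] := leP 0 t; [have := h1 t0 | have := h2 (ltW t0)]; lra.
have Nv : N v = N y ^+ 2 by rewrite /v (ucs_star H).
have Nw : N w = N y ^+ 2 by rewrite -(ucs_st y) -(ucs_star H) stK.
have NyL : N y ^+ 2 <= L.
  apply: le_trans (_ : (N x * (M + 1)) ^+ 2 <= _).
    apply: lerXn2r; rewrite ?nnegrE ?mulr_ge0 //; first by move: M1; lra.
    by apply: (le_trans (NM _ _)); rewrite ler_wpM2l.
  by rewrite exprMn /L; move: M0; lra.
clearbody y.
have sv : sa v by rewrite /sa /v stM stK.
have sw : sa w by rewrite /sa /w stM stK.
have [vs1 _] : pos (v - rs (- L)) /\ pos (rs L - v) by apply: sa_spectrum; rewrite ?Nv.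
have [_ ws2] : pos (w - rs (- L)) /\ pos (rs L - w) by apply: sa_spectrum; rewrite ?Nw.
(* [t m(t)^2] is nonpositive for [t <= 0], and at most [M d^2 = eta] for [t >= 0], where
   [m <= d]. *)
have vs2 : pos (rs eta - v).
  rewrite vE -(evC h) -evB; apply: (pos_ev hh MM) => // t tM; have [h1 h2] := hm t tM.
  rewrite hornerD hornerN hornerC hornerM hornerX horner_exp subr_ge0.
  move: (m.[t]) h1 h2 tM => k h1 h2 /andP[t1 t2].
  have [t0|t0] := leP 0 t.
    have /andP[k0 kd] := h1 t0; rewrite /eta; apply: ler_pM; rewrite ?sqr_ge0 //.
    by rewrite expr2; apply: ler_pM.
  apply: le_trans eta0; rewrite nmulr_rle0 //; nra.
have ws1 : pos (w - rs (- eta)).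
  rewrite /rscal rmorphN scaleNr opprK -/(rs eta).
  have -> : w + rs eta = (v + w) + (rs eta - v) by rewrite [v + w]addrC -addrA subrKC.
  by apply: posD => //; exact: pos_star_add.
have L0 : 0 < L by move: M1 LM; lra.
have [m' hm'] := negpart_poly L0 d0.
pose n := m' + 'X.
have hn (t : R) : - L <= t <= L ->
    (0 <= t -> 0 <= n.[t] - t <= d) /\ (t <= 0 -> 0 <= n.[t] <= d).
  by move=> tL; have [h1 h2] := hm' t tL; rewrite /n hornerD hornerX addrK.
(* For [z = y n(v) = n(w) y] these elements are [st z * z] and [z * st z]. *)
have eqN : N (ev v ('X * n ^+ 2)) = N (ev w ('X * n ^+ 2)).
  pose z := y * ev v n.
  have zE : z = ev w n * y by apply: ev_intertwine; rewrite /v /w mulrA.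
  have -> : ev v ('X * n ^+ 2) = st z * z.
    rewrite (_ : 'X * n ^+ 2 = n * 'X * n); last by ring.
    by rewrite !evM evX /z stM sa_ev // /v !mulrA.
  have -> : ev w ('X * n ^+ 2) = z * st z.
    rewrite (_ : 'X * n ^+ 2 = n * 'X * n); last by ring.
    by rewrite !evM evX zE stM sa_ev // {2}/w !mulrA.
  by rewrite (ucs_star H) -(ucs_st z) -(ucs_star H) stK.
(* On [[- L, eta]], negative [t] have [n <= d], and positive [t] are at most [eta], which is of
   order [d^2]. *)
have b1 : N (ev v ('X * n ^+ 2)) <= d * (L + M * (M + 1) ^+ 2).
  apply: (ev_le sv _ vs1 vs2); first by move: eta0 L0; lra.
  move=> t /andP[t1 t2]; have [|h1 h2] := hn t.
    by rewrite t1 (le_trans t2) // (le_trans etaM).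
  rewrite hornerM hornerX horner_exp normrM [`|_ ^+ 2|]ger0_norm ?sqr_ge0 //.
  move: (n.[t]) h1 h2 => k h1 h2.
  have [t0|t0] := leP 0 t.
    have /andP[k0 kd] := h1 t0; rewrite ger0_norm //.
    apply: le_trans (_ : eta * (M + 1) ^+ 2 <= _).
      by apply: ler_pM; rewrite ?sqr_ge0 //; apply: lerXn2r; rewrite ?nnegrE; lra.
    apply: le_trans (_ : d * (M * (M + 1) ^+ 2) <= _).
      rewrite mulrA ler_wpM2r ?sqr_ge0 // /eta expr2 mulrCA ler_wpM2l //; first exact: ltW.
      by rewrite mulrC ler_piMl // (le_trans ler01).
    by rewrite ler_wpM2l ?lerDr // ltW.
  have /andP[k0 kd] := h2 (ltW t0); rewrite ltr0_norm //.
  apply: le_trans (_ : L * (d * 1) <= _).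
    apply: ler_pM; rewrite ?sqr_ge0 //; first by lra.
      by lra.
    by rewrite expr2; apply: ler_pM => //; lra.
  rewrite mulr1 mulrC ler_wpM2l ?(ltW d0) // lerDl mulr_ge0 ?sqr_ge0 //.
(* The polynomial is [t (t - n) (t + n)]. On [[- eta, L]], the factor [t - n] is small for positive
   [t], and [t] itself is small for negative [t]. *)
have b2 : N (ev w ('X ^+ 3 - 'X * n ^+ 2)) <= d * (L * (2 * L + 1) + M * (M ^+ 2 + 1)).
  apply: (ev_le sw _ ws1 ws2); first by move: eta0 L0; lra.
  move=> t /andP[t1 t2]; have [|h1 h2] := hn t.
    by rewrite t2 andbT (le_trans _ t1) // lerN2 (le_trans etaM).
  have -> : ('X ^+ 3 - 'X * n ^+ 2).[t] = t * ((t - n.[t]) * (t + n.[t])).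
    by rewrite hornerD hornerN hornerXn hornerM hornerX horner_exp; ring.
  move: (n.[t]) h1 h2 => k h1 h2; rewrite !normrM.
  have [t0|t0] := leP 0 t.
    have /andP[k0 kd] := h1 t0.
    apply: le_trans (_ : L * (d * (2 * L + 1)) <= _).
      apply: ler_pM; rewrite ?mulr_ge0 ?normr_ge0 //; first by rewrite ger0_norm.
      by apply: ler_pM => //; rewrite ler_norml; lra.
    rewrite mulrCA ler_wpM2l ?(ltW d0) // lerDl mulr_ge0 ?addr_ge0 ?sqr_ge0 //.
  have /andP[k0 kd] := h2 (ltW t0).
  have te : `|t| <= M * d by rewrite ltr0_norm //; move: t1; rewrite /eta; move: M1; nra.
  apply: le_trans (_ : M * d * ((M + 1) * (M + 1)) <= _).
    apply: ler_pM; rewrite ?mulr_ge0 ?normr_ge0 //.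
    by apply: ler_pM => //; rewrite ler_norml; move: M1 etaM t1; lra.
  have l0 : 0 <= L * L by rewrite mulr_ge0 // ltW.
  have l1 : M * M <= L * L by apply: ler_pM.
  have -> : M * d * ((M + 1) * (M + 1)) = d * (M * M ^+ 2 + 2 * (M * M) + M) by ring.
  by rewrite ler_wpM2l ?(ltW d0) //; lra.
have w3 : N w ^+ 3 <= N (ev w ('X * n ^+ 2)) + N (ev w ('X ^+ 3 - 'X * n ^+ 2)).
  apply: le_trans (ucs_cube sw) _.
  have -> : w ^+ 3 = ev w ('X * n ^+ 2) + ev w ('X ^+ 3 - 'X * n ^+ 2).
    by rewrite -evD subrKC evXn evX.
  exact: ND.
rewrite -vE Nv -Nw -addrA mulrDr.
by apply: (le_trans w3); apply: lerD; rewrite -?eqN.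
Qed.

(** The approximating positive element is [h + m(h)], so [m(h)] has to be small. By [ucs_cube] its
    cube may be bounded instead, and [m^3 = m^2 (m + t) - t m^2]: the first term is small on the
    spectrum, the second by [star_negpart_small]. *)
Lemma pos_star : pos (st x * x).
Proof.
rewrite -/h; apply: pos_closed => // d' d'0.
pose T := d' ^+ 3 / 2.
have T0 : 0 < T by rewrite divr_gt0 // exprn_gt0.
pose C := L + M * (M + 1) ^+ 2 + L * (2 * L + 1) + M * (M ^+ 2 + 1).
have C0 : 0 < C by rewrite /C; move: M1 LM; nra.
have MP : 0 < (M + 1) ^+ 2 by rewrite exprn_gt0 //; move: M1; lra.
(* The last two bounds make [t m^2] and [m^2 (m + t)] at most [T] each, and [2 T = d' ^ 3]. *)
pose d := Num.min 1 (Num.min (T ^+ 3 / C) (T / (M + 1) ^+ 2)).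
have d0 : 0 < d by rewrite !lt_min ltr01 !divr_gt0 // exprn_gt0.
have [d1 [dC dM]] : d <= 1 /\ d <= T ^+ 3 / C /\ d <= T / (M + 1) ^+ 2.
  by rewrite /d !ge_min !lexx !orbT.
have [m hm] := negpart_poly (lt_le_trans ltr01 M1) d0.
have hv := star_negpart_small d0 d1 hm.
have [hs1 hs2] := h_spec.
exists (ev h ('X + m)).
  apply: (pos_ev hh MM) => // t tM; have [h1 h2] := hm t tM; rewrite !hornerE.
  by have [t0|t0] := leP 0 t; [have := h1 t0 | have := h2 (ltW t0)]; lra.
rewrite evD evX opprD addrA subrr add0r ucs_N.
have v1 : N (ev h ('X * m ^+ 2)) <= T.
  rewrite -(@ler_pXn2r _ 3) ?nnegrE ?(ltW T0) //; apply: le_trans hv _.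
  by rewrite -ler_pdivlMr.
have v2 : N (ev h ('X * m ^+ 2 + m ^+ 3)) <= T.
  apply: (ev_le hh MM) => // t tM; have [h1 h2] := hm t tM.
  have -> : ('X * m ^+ 2 + m ^+ 3).[t] = m.[t] ^+ 2 * (m.[t] + t).
    by rewrite hornerD hornerM hornerX !horner_exp; ring.
  rewrite ler_pdivlMr // in dM; apply: le_trans dM; move: (m.[t]) h1 h2 => k h1 h2.
  have k2 : k ^+ 2 * (k + t) >= 0.
    rewrite mulr_ge0 ?sqr_ge0 //.
    by have [t0|t0] := leP 0 t; [have := h1 t0 | have := h2 (ltW t0)]; lra.
  rewrite ger0_norm //; case/andP: tM => t1 t2.
  have [t0|t0] := leP 0 t.
    have /andP[k0 kd] := h1 t0.
    apply: le_trans (_ : d * (M + 1) <= _).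
      by apply: ler_pM; rewrite ?sqr_ge0 //; first lra; [nra | lra].
    by rewrite ler_wpM2l ?(ltW d0) //; move: M1; nra.
  have /andP[k0 kd] := h2 (ltW t0).
  by rewrite mulrC; apply: ler_pM; rewrite ?sqr_ge0 //; apply: lerXn2r; rewrite ?nnegrE; lra.
rewrite -(@ler_pXn2r _ 3) ?nnegrE ?(ltW d'0) //.
apply: le_trans (ucs_cube (sa_ev m hh)) _.
have -> : ev h m ^+ 3 = ev h ('X * m ^+ 2 + m ^+ 3) - ev h ('X * m ^+ 2).
  by rewrite -evB addrAC subrr add0r evXn.
by apply: (le_trans (ucs_B _ _)); rewrite [d' ^+ 3]splitr; exact: lerD.
Qed.

End StarPositive.

(** Up to a small error [c] is [q^2] with [q] self-adjoint, and
    [st a * q^2 * a = st (q a) * (q a)]. *)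
Lemma pos_conj c a : pos c -> pos (st a * c * a).
Proof.
move=> pc; apply: pos_closed; first by rewrite /sa !stM stK (pos_sa pc) mulrA.
move=> d d0; have k0 : 0 < N a ^+ 2 + 1 by rewrite ltr_wpDl ?sqr_ge0.
have [q hq] := pos_sqrt pc (divr_gt0 d0 k0).
exists (st a * ev c q ^+ 2 * a).
  rewrite expr2 mulrA -mulrA -{1}(sa_ev q (pos_sa pc)) -stM; exact: pos_star.
rewrite -mulrBl -mulrBr; apply: (le_trans (NM _ _)).
apply: (le_trans (ler_wpM2r (N_ge0 a) (NM _ _))).
rewrite ucs_st mulrAC -expr2 mulrC ucs_BC.
rewrite ler_pdivlMr // in hq; apply: le_trans hq; rewrite ler_wpM2l ?N_ge0 // lerDl.
exact: ler01.
Qed.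

(** In a module, with [u = <x, x>], [v = <y, y>] and [a = <x, y>], the last hypothesis is positivity
    of [<w, w>] for [w = x (t a) - y]. For [t = 1 / s], adding the positive element
    [t^2 (st a * (s - u) * a)] turns it into [st a * a / s <= v]. *)
Lemma ucs_cauchy_schwarz u v a s : pos u -> 0 < s -> N u <= s ->
  (forall t, pos ((t%:C)%C *: ((t%:C)%C *: (st a * u * a)) -
                  (t%:C)%C *: (st a * a + st a * a) + v)) ->
  N a ^+ 2 <= s * N v.
Proof.
move=> pu s0 us hv.
pose Y := st a * (rs s - u) * a.
have pY : pos Y by apply: pos_conj; apply: pos_rsB => //; exact: pos_sa.
have YE : Y = (s%:C)%C *: (st a * a) - st a * u * a.
  by rewrite /Y mulrBr mulrBl -scalerAr -scalerAl mulr1.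
have sV : (s^-1%:C)%C * (s%:C)%C = 1 :> R[i] by rewrite -rmorphM mulVf ?rmorph1 // gt_eqF.
have vE : v = (s^-1%:C)%C *: (st a * a) +
    (((s^-1%:C)%C *: ((s^-1%:C)%C *: (st a * u * a)) -
      (s^-1%:C)%C *: (st a * a + st a * a) + v) +
     (s^-1%:C)%C *: ((s^-1%:C)%C *: Y)).
  rewrite YE !scalerBr [(s^-1%:C)%C *: (_ *: (st a * a))]scalerA sV scale1r.
  move: ((s^-1%:C)%C *: (_ *: (st a * u * a))) => w.
  rewrite scalerDr; move: ((s^-1%:C)%C *: (st a * a)) => b.
  rewrite [_ + v + _]addrAC [_ + (b - w)]addrC subrKA opprD [b + (_ - b)]addrA.
  by rewrite subrr add0r addrA subrr add0r.
have s0' : 0 <= s^-1 by rewrite invr_ge0 ltW.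
have : N ((s^-1%:C)%C *: (st a * a)) <= N v.
  rewrite [in N v]vE; apply: pos_le_D; first by apply: posZ => //; exact: pos_star.
  by apply: posD => //; do 2 apply: posZ => //.
by rewrite ucs_Zr ger0_norm // (ucs_star H) ler_pdivrMl.
Qed.

End CstarSeminorm.

(** * Locally C*-algebras *)

Section AdditiveMaps.
Variables (U V : zmodType) (f : U -> V).
Hypothesis fD : {morph f : x y / x + y}.

Lemma morphD0 : f 0 = 0.
Proof. by apply: (addIr (f 0)); rewrite -fD !add0r. Qed.

Lemma morphDN : {morph f : x / - x}.
Proof. by move=> x; apply/eqP; rewrite -addr_eq0 -fD addNr morphD0. Qed.

Lemma morphDB : {morph f : x y / x - y}.
Proof. by move=> x y; rewrite fD morphDN. Qed.

Lemma morphD_sum I (r : seq I) (P : pred I) (F : I -> U) :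
  f (\sum_(i <- r | P i) F i) = \sum_(i <- r | P i) f (F i).
Proof. exact: (big_morph f fD morphD0). Qed.

End AdditiveMaps.

Section StarAlgebraTheory.
Variables (R : realType) (A : starAlgType R).
Implicit Types (a b x y : A).

Lemma smul_addl a b x : (a + b) ** x = a ** x + b ** x. Proof. exact: smulDl. Qed.
Lemma smul_addr x a b : x ** (a + b) = x ** a + x ** b. Proof. exact: smulDr. Qed.
Lemma smul_scalel (c : R[i]) a b : (c *: a) ** b = c *: (a ** b). Proof. exact: smulZl. Qed.
Lemma smul_scaler (c : R[i]) a b : a ** (c *: b) = c *: (a ** b). Proof. exact: smulZr. Qed.
Lemma star_add a b : star (a + b) = star a + star b. Proof. exact: starD. Qed.
Lemma star_scale (c : R[i]) a : star (c *: a) = conjc c *: star a. Proof. exact: starZ. Qed.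

Lemma smul0l a : 0 ** a = 0. Proof. exact: (morphD0 (fun x y => smulDl x y a)). Qed.
Lemma smul0r a : a ** 0 = 0. Proof. exact: (morphD0 (smulDr a)). Qed.
Lemma smulBl a b x : (a - b) ** x = a ** x - b ** x.
Proof. exact: (morphDB (fun x y => smulDl x y _)). Qed.
Lemma smulBr x a b : x ** (a - b) = x ** a - x ** b.
Proof. exact: (morphDB (smulDr x)). Qed.
Lemma star0 : star 0 = 0 :> A. Proof. exact: (morphD0 starD). Qed.
Lemma starB a b : star (a - b) = star a - star b. Proof. exact: (morphDB starD). Qed.
Lemma star_sum I (r : seq I) (P : pred I) (F : I -> A) :
  star (\sum_(i <- r | P i) F i) = \sum_(i <- r | P i) star (F i).
Proof. exact: (morphD_sum starD). Qed.

Section OneSeminorm.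
Variable p : A -> R.
Hypothesis pC : Cstar_seminorm p.

Lemma Cstar_ge0 a : 0 <= p a. Proof. exact: Cstar_seminorm_ge0 pC a. Qed.

Lemma CstarN a : p (- a) = p a.
Proof. by rewrite -scaleN1r (Cstar_seminormZ pC) normcN Normc.normc1 mul1r. Qed.

Lemma Cstar0 : p 0 = 0.
Proof. by rewrite -(scale0r (0 : A)) (Cstar_seminormZ pC) Normc.normc0 mul0r. Qed.

Lemma CstarBC a b : p (a - b) = p (b - a). Proof. by rewrite -CstarN opprB. Qed.

Lemma CstarB a b : p (a - b) <= p a + p b.
Proof. by apply: (le_trans (Cstar_seminormD pC _ _)); rewrite CstarN. Qed.

Lemma Cstar_tri c a b : p (a - b) <= p (a - c) + p (c - b).
Proof. by rewrite -(subrKA c) (Cstar_seminormD pC). Qed.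

Lemma Cstar_st a : p (star a) = p a.
Proof.
have le b : p b <= p (star b).
  have [/eqP ->|b0] := boolP (p b == 0); first exact: Cstar_ge0.
  have bgt : 0 < p b by rewrite lt0r b0 Cstar_ge0.
  by rewrite -(ler_pM2r bgt) -expr2 -(Cstar_seminorm_star pC) (Cstar_seminormM pC).
by apply/eqP; rewrite eq_le le andbT -{2}(starK a) le.
Qed.

Lemma Cstar_st2 a : p (a ** star a) = p a ^+ 2.
Proof. by rewrite -{1}(starK a) (Cstar_seminorm_star pC) Cstar_st. Qed.

End OneSeminorm.

End StarAlgebraTheory.

Section LocallyCstarTheory.
Variables (R : realType) (A : locallyCstarType R).
Implicit Types (a b x y l : A) (p : A -> R) (u v : nat -> A).

Local Notation SA := (@cont_Cstar_seminorms R A).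

Definition pcvg u l := forall p, SA p -> forall e, 0 < e ->
  exists N, forall n, (N <= n)%N -> p (u n - l) <= e.

Definition pcauchy u := forall p, SA p -> forall e, 0 < e ->
  exists N, forall m n, (N <= m)%N -> (N <= n)%N -> p (u m - u n) <= e.

(** If all seminorms vanish at [a], the principal filter at [a] converges to 0, so every
    neighbourhood of 0 contains [a]. *)
Lemma seminorms_separate a : (forall p, SA p -> p a = 0) -> a = 0.
Proof.
move=> pa0.
have FP : ProperFilter (globally [set a]) by exact: (@globally_properfilter _ _ a).
have /(cvg0_Cstar_seminorms _ FP) F0 : forall p, SA p -> p @ (globally [set a]) --> (0 : R).
  move=> p pS S /nbhs_singleton S0 x /= ->; by rewrite pa0.
apply: (@Cstar_hausdorff R A) => U V Ua V0.
have Va : V a by exact: (F0 V V0 a erefl).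
by exists a; split => //; exact: nbhs_singleton.
Qed.

Lemma cvg_pcvg u l : u @ \oo --> l <-> pcvg u l.
Proof.
(* The axiom describes convergence to 0 only; continuity of addition moves the limit there. *)
have tr (v : nat -> A) (a b : A) : v @ \oo --> a -> (fun n => v n + b) @ \oo --> a + b.
  move=> va; apply: (@cvg_comp _ _ _ (fun n => (v n, b)) (fun x : A * A => x.1 + x.2)
    _ (nbhs (a, b))).
    by apply: cvg_pair => //=; exact: cvg_cst.
  exact: (@add_continuous A (a, b)).
have -> : u @ \oo --> l <-> (fun n => u n - l) @ \oo --> 0.
  split=> [/(tr _ _ (- l))|/(tr _ _ l)]; first by rewrite subrr.
  by rewrite add0r; under eq_fun do rewrite subrK.
rewrite (cvg0_Cstar_seminorms ((fun n => u n - l) @ \oo)).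
split=> h p pS.
  move=> e e0; have /cvgrPdist_le/(_ e e0) [N _ hN] := h p pS.
  by exists N => n /hN /=; rewrite sub0r normrN; apply: le_trans; exact: ler_norm.
apply/cvgrPdist_le => e e0; have [N hN] := h p pS e e0.
exists N => // n /hN /=; rewrite sub0r normrN ger0_norm //; exact: Cstar_ge0 (proj1 pS) _.
Qed.

Lemma pcauchy_pcvg u : pcauchy u -> exists l, pcvg u l.
Proof.
move=> uc.
have : (fun xy : A * A => xy.1 - xy.2) @ (u @ \oo, u @ \oo) --> (0 : A).
  apply/cvg0_Cstar_seminorms => p pS.
  apply/cvgrPdist_le => e e0; have [N hN] := uc p pS e e0.
  exists ([set x | exists2 n, (N <= n)%N & x = u n], [set x | exists2 n, (N <= n)%N & x = u n]).
    by split; exists N => // n /= Nn; exists n.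
  move=> [x y] /= [[m Nm ->] [n Nn ->]].
  by rewrite sub0r normrN ger0_norm ?hN //; exact: Cstar_ge0 (proj1 pS) _.
by move=> /Cstar_complete[l ul]; exists l; exact/cvg_pcvg.
Qed.

Lemma pcvg_le u l p e : SA p -> pcvg u l ->
  (exists N, forall n, (N <= n)%N -> p (u n) <= e) -> p l <= e.
Proof.
move=> pS ul [N hN]; apply/ler_addgt0Pr => d d0.
have [N' hN'] := ul p pS d d0.
rewrite -(subKr (u (maxn N N')) l); apply: (le_trans (CstarB (proj1 pS) _ _)).
by rewrite lerD ?hN ?leq_maxl // hN' // leq_maxr.
Qed.

Lemma pcvg_unique u l l' : pcvg u l -> pcvg u l' -> l = l'.
Proof.
move=> ul ul'; apply/eqP; rewrite -subr_eq0; apply/eqP/seminorms_separate => p pS.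
apply/eqP; rewrite eq_le Cstar_ge0 ?andbT; last exact: proj1 pS.
apply/ler_addgt0Pr => d d0.
have d2 : 0 < d / 2 by rewrite divr_gt0.
have [N hN] := ul p pS _ d2; have [N' hN'] := ul' p pS _ d2.
apply: (le_trans (Cstar_tri (proj1 pS) (u (maxn N N')) _ _)).
rewrite add0r (splitr d) lerD // ?hN' ?leq_maxr //.
by rewrite (CstarBC (proj1 pS)) hN ?leq_maxl.
Qed.

Lemma pcvg_cst a : pcvg (fun=> a) a.
Proof. by move=> p pS e e0; exists 0 => n _; rewrite subrr (Cstar0 (proj1 pS)) ltW. Qed.

Lemma pcvgD u v l l' : pcvg u l -> pcvg v l' -> pcvg (fun n => u n + v n) (l + l').
Proof.
move=> ul vl p pS e e0; have e2 : 0 < e / 2 by rewrite divr_gt0.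
have [N hN] := ul p pS _ e2; have [N' hN'] := vl p pS _ e2.
exists (maxn N N') => n; rewrite geq_max => /andP[n1 n2].
rewrite opprD addrACA; apply: (le_trans (Cstar_seminormD (proj1 pS) _ _)).
by rewrite (splitr e) lerD ?hN ?hN'.
Qed.

Lemma pcvg_map (f : A -> A) u l : {morph f : x y / x + y} ->
  (forall p, SA p -> exists C, 0 <= C /\ forall x, p (f x) <= C * p x) ->
  pcvg u l -> pcvg (fun n => f (u n)) (f l).
Proof.
move=> fD fb ul p pS e e0; have [C [C0 hC]] := fb p pS.
have C1 : 0 < C + 1 by rewrite ltr_wpDl.
have [N hN] := ul p pS _ (divr_gt0 e0 C1); exists N => n /hN h.
rewrite -(morphDB fD); apply: (le_trans (hC _)).
rewrite ler_pdivlMr // mulrC in h; apply: le_trans h; rewrite ler_wpM2r ?lerDl //.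
exact: Cstar_ge0 (proj1 pS) _.
Qed.

Lemma pcvg_star u l : pcvg u l -> pcvg (fun n => star (u n)) (star l).
Proof.
apply: (@pcvg_map star) => [x y|p pS]; first exact: starD.
by exists 1; split=> // x; rewrite mul1r (Cstar_st (proj1 pS)).
Qed.

Lemma pcvgZ (c : R[i]) u l : pcvg u l -> pcvg (fun n => c *: u n) (c *: l).
Proof.
apply: (@pcvg_map ( *:%R c)) => [x y|p pS]; first exact: scalerDr.
exists (Normc.normc c); split; first by case: (c) => ? ?; rewrite sqrtr_ge0.
by move=> x; rewrite (Cstar_seminormZ (proj1 pS)).
Qed.

Lemma pcvgN u l : pcvg u l -> pcvg (fun n => - u n) (- l).
Proof. by move=> /(pcvgZ (-1)); rewrite scaleN1r; under eq_fun do rewrite scaleN1r. Qed.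

Lemma pcvgB u v l l' : pcvg u l -> pcvg v l' -> pcvg (fun n => u n - v n) (l - l').
Proof. by move=> ul vl; apply: pcvgD => //; exact: pcvgN. Qed.

Lemma pcvgMl a u l : pcvg u l -> pcvg (fun n => a ** u n) (a ** l).
Proof.
apply: (@pcvg_map (smul a)) => [x y|p pS]; first exact: smulDr.
by exists (p a); split=> [|x]; [exact: Cstar_ge0 (proj1 pS) _ | exact: Cstar_seminormM (proj1 pS) _ _].
Qed.

Lemma pcvgMr a u l : pcvg u l -> pcvg (fun n => u n ** a) (l ** a).
Proof.
apply: (@pcvg_map (smul^~ a)) => [x y|p pS]; first exact: smulDl.
exists (p a); split=> [|x]; first exact: Cstar_ge0 (proj1 pS) _.
by rewrite mulrC; exact: Cstar_seminormM (proj1 pS) _ _.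
Qed.

(** Cancellation without a unit: the C*-identity applies at [y = a]. *)
Lemma star_smul_eq0 a : (forall y, star y ** a = 0) -> a = 0.
Proof.
move=> h; apply: seminorms_separate => p pS.
by apply/eqP; rewrite -sqrf_eq0 -(Cstar_seminorm_star (proj1 pS)) h (Cstar0 (proj1 pS)).
Qed.

End LocallyCstarTheory.

(** * The multiplier algebra *)

Local Arguments conjc {R} x : simpl never.

Section Multipliers.
Variables (R : realType) (A : locallyCstarType R).
Implicit Types (a b x y l : A) (p : A -> R).

Local Notation SA := (@cont_Cstar_seminorms R A).

(* The scalar coordinate [msc] only serves to make [1 <> 0] when [A = 0]. *)
Record mult := Mult {
  msc : R[i];
  op : A -> A;
  adj : A -> A;
  op_adj : forall x y, star (op x) ** y = star x ** adj y;
  op_bounded : forall p, SA p -> exists C, 0 <= C /\ forall x, p (op x) <= C * p x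
}.

Lemma multP (S T : mult) : msc S = msc T -> op S =1 op T -> adj S =1 adj T -> S = T.
Proof.
case: S T => [s f g fg fb] [t f' g' fg' fb'] /= st_ /funext ff /funext gg.
by subst; congr Mult; exact: Prop_irrelevance.
Qed.

HB.instance Definition _ := gen_eqMixin mult.
HB.instance Definition _ := gen_choiceMixin mult.

Lemma adj_op (T : mult) x y : star (adj T x) ** y = star x ** op T y.
Proof. by rewrite -[LHS]starK starM starK -op_adj starM !starK. Qed.

Lemma adj_bounded (T : mult) p : SA p -> exists C, 0 <= C /\ forall x, p (adj T x) <= C * p x.
Proof.
move=> pS; have pC := proj1 pS; have [C [C0 hC]] := op_bounded T pS; exists C; split=> // x.
have [/eqP ->|b0] := boolP (p (adj T x) == 0); first by rewrite mulr_ge0 // Cstar_ge0.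
have bgt : 0 < p (adj T x) by rewrite lt0r b0 Cstar_ge0.
rewrite -(ler_pM2r bgt) -expr2 -(Cstar_seminorm_star pC) adj_op.
apply: (le_trans (Cstar_seminormM pC _ _)); rewrite (Cstar_st pC) mulrAC mulrC.
by rewrite ler_wpM2r ?Cstar_ge0.
Qed.

(** Having an adjoint forces linearity, which is why [mult] has no fields for it. *)
Lemma adjoint_additive (f g : A -> A) :
  (forall x y, star (f x) ** y = star x ** g y) -> {morph f : x y / x + y}.
Proof.
move=> fg x y; apply/eqP; rewrite -subr_eq0; apply/eqP/star_smul_eq0 => z.
rewrite -[LHS]starK starM starK starB (star_add (f x)).
by rewrite smulBl !smul_addl !fg (star_add x) !smul_addl subrr star0.
Qed.

Lemma opD (T : mult) : {morph op T : x y / x + y}.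
Proof. exact: adjoint_additive (op_adj T). Qed.

Lemma adjD (T : mult) : {morph adj T : x y / x + y}.
Proof. exact: adjoint_additive (adj_op T). Qed.

Lemma opZ (T : mult) (c : R[i]) x : op T (c *: x) = c *: op T x.
Proof.
apply/eqP; rewrite -subr_eq0; apply/eqP/star_smul_eq0 => z.
rewrite -[LHS]starK starM starK starB.
by rewrite smulBl !star_scale smul_scalel !op_adj !star_scale smul_scalel subrr star0.
Qed.

Lemma adjZ (T : mult) (c : R[i]) x : adj T (c *: x) = c *: adj T x.
Proof.
apply/eqP; rewrite -subr_eq0; apply/eqP/star_smul_eq0 => z.
rewrite -[LHS]starK starM starK starB.
by rewrite smulBl star_scale smul_scalel !adj_op star_scale smul_scalel subrr star0.
Qed.

Lemma op_smul (T : mult) x a : op T (x ** a) = op T x ** a.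
Proof.
apply/eqP; rewrite -subr_eq0; apply/eqP/star_smul_eq0 => z.
rewrite -[LHS]starK starM starK starB.
by rewrite smulBl starM -smulA !op_adj starM -smulA subrr star0.
Qed.

Program Definition mult_add (S T : mult) : mult :=
  @Mult (msc S + msc T) (fun x => op S x + op T x) (fun x => adj S x + adj T x) _ _.
Next Obligation. by move=> S T x y /=; rewrite star_add smul_addl smul_addr !op_adj. Qed.
Next Obligation.
move=> S T p pS; have [C [C0 hC]] := op_bounded S pS; have [D [D0 hD]] := op_bounded T pS.
exists (C + D); split=> [|x]; first exact: addr_ge0.
by rewrite mulrDl (le_trans (Cstar_seminormD (proj1 pS) _ _)) // lerD.
Qed.

Program Definition mult_scale (c : R[i]) (T : mult) : mult :=
  @Mult (c * msc T) (fun x => c *: op T x) (fun x => conjc c *: adj T x) _ _.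
Next Obligation. by move=> c T x y /=; rewrite star_scale smul_scalel smul_scaler op_adj. Qed.
Next Obligation.
move=> c T p pS; have [C [C0 hC]] := op_bounded T pS.
have c0 : 0 <= Normc.normc c by case: (c) => ? ?; rewrite sqrtr_ge0.
exists (Normc.normc c * C); split=> [|x]; first exact: mulr_ge0.
by rewrite (Cstar_seminormZ (proj1 pS)) -mulrA ler_wpM2l.
Qed.

Program Definition mult_one : mult := @Mult 1 id id _ _.
Next Obligation. by []. Qed.
Next Obligation. by move=> p pS; exists 1; split=> // x; rewrite mul1r. Qed.

Definition mult_zero : mult := mult_scale 0 mult_one.
Definition mult_opp (T : mult) : mult := mult_scale (-1) T.

Program Definition mult_mul (S T : mult) : mult :=
  @Mult (msc S * msc T) (op S \o op T) (adj T \o adj S) _ _.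
Next Obligation. by move=> S T x y /=; rewrite !op_adj. Qed.
Next Obligation.
move=> S T p pS; have [C [C0 hC]] := op_bounded S pS; have [D [D0 hD]] := op_bounded T pS.
exists (C * D); split=> [|x]; first exact: mulr_ge0.
by rewrite (le_trans (hC _)) // -mulrA ler_wpM2l.
Qed.

Program Definition mult_star (T : mult) : mult :=
  @Mult (conjc (msc T)) (adj T) (op T) (adj_op T) (fun p => @adj_bounded T p).

Fact mult_addA : associative mult_add.
Proof. by move=> S T U; apply: multP => [|x|x] /=; rewrite addrA. Qed.
Fact mult_addC : commutative mult_add.
Proof. by move=> S T; apply: multP => [|x|x] /=; rewrite addrC. Qed.
Fact mult_add0 : left_id mult_zero mult_add.
Proof. by move=> T; apply: multP => [|x|x] /=; rewrite ?conjc0 ?mul0r ?scale0r add0r. Qed.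
Fact mult_addN : left_inverse mult_zero mult_opp mult_add.
Proof.
by move=> T; apply: multP => [|x|x] /=;
  rewrite ?rmorphN /= ?conjc1 ?conjc0 ?mulN1r ?mul0r ?scaleN1r ?scale0r addNr.
Qed.

HB.instance Definition _ := GRing.isZmodule.Build mult
  mult_addA mult_addC mult_add0 mult_addN.

Fact mult_mulA : associative mult_mul.
Proof. by move=> S T U; apply: multP => [|x|x] //=; rewrite mulrA. Qed.
Fact mult_mul1l : left_id mult_one mult_mul.
Proof. by move=> T; apply: multP => [|x|x] //=; rewrite mul1r. Qed.
Fact mult_mul1r : right_id mult_one mult_mul.
Proof. by move=> T; apply: multP => [|x|x] //=; rewrite mulr1. Qed.
Fact mult_mulDl : left_distributive mult_mul mult_add.
Proof. by move=> S T U; apply: multP => [|x|x] //=; rewrite ?mulrDl ?adjD. Qed.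
Fact mult_mulDr : right_distributive mult_mul mult_add.
Proof. by move=> S T U; apply: multP => [|x|x] //=; rewrite ?mulrDr ?opD. Qed.
Fact mult_one_neq0 : mult_one != mult_zero.
Proof.
by apply/eqP => /(congr1 msc)/eqP; rewrite /= mul0r oner_eq0.
Qed.

HB.instance Definition _ := GRing.Zmodule_isNzRing.Build mult
  mult_mulA mult_mul1l mult_mul1r mult_mulDl mult_mulDr mult_one_neq0.

Fact mult_scaleA (c d : R[i]) T : mult_scale c (mult_scale d T) = mult_scale (c * d) T.
Proof. by apply: multP => [|x|x] /=; rewrite ?rmorphM ?mulrA ?scalerA. Qed.
Fact mult_scale1 : left_id 1 mult_scale.
Proof. by move=> T; apply: multP => [|x|x] /=; rewrite ?conjc1 ?mul1r ?scale1r. Qed.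
Fact mult_scaleDr : right_distributive mult_scale +%R.
Proof. by move=> c S T; apply: multP => [|x|x] /=; rewrite ?mulrDr ?scalerDr. Qed.
Fact mult_scaleDl T : {morph mult_scale^~ T : c d / c + d}.
Proof. by move=> c d; apply: multP => [|x|x] /=; rewrite ?rmorphD ?mulrDl ?scalerDl. Qed.

HB.instance Definition _ := GRing.Zmodule_isLmodule.Build R[i] mult
  mult_scaleA mult_scale1 mult_scaleDr mult_scaleDl.

Fact mult_scalerAl (c : R[i]) (S T : mult) : c *: (S * T) = (c *: S) * T.
Proof. by apply: multP => [|x|x] /=; rewrite ?mulrA ?adjZ. Qed.

HB.instance Definition _ := GRing.Lmodule_isLalgebra.Build R[i] mult mult_scalerAl.

Fact mult_scalerAr (c : R[i]) (S T : mult) : c *: (S * T) = S * (c *: T).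
Proof. by apply: multP => [|x|x] /=; [exact: mulrCA | rewrite opZ | ]. Qed.

HB.instance Definition _ := GRing.Lalgebra_isAlgebra.Build R[i] mult mult_scalerAr.

Lemma op_add (S T : mult) x : op (S + T) x = op S x + op T x. Proof. by []. Qed.
Lemma op_opp (S : mult) x : op (- S) x = - op S x.
Proof. by rewrite -[RHS]scaleN1r. Qed.
Lemma op_sub (S T : mult) x : op (S - T) x = op S x - op T x.
Proof. by rewrite op_add op_opp. Qed.
Lemma op_scale c (S : mult) x : op (c *: S) x = c *: op S x. Proof. by []. Qed.
Lemma op_mul (S T : mult) x : op (S * T) x = op S (op T x). Proof. by []. Qed.
Lemma op_one x : op 1 x = x. Proof. by []. Qed.
Lemma op_rscal t x : op (rscal mult t) x = (t%:C)%C *: x. Proof. by []. Qed.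

(** * Operator seminorms on multipliers *)

Section OperatorSeminorm.
Variable p : A -> R.
Hypothesis pS : SA p.
Let pC : Cstar_seminorm p := proj1 pS.

Definition opnorm (T : mult) : R := sup [set p (op T x) | x in [set x | p x <= 1]].

Let opnorm_has_sup T : has_sup [set p (op T x) | x in [set x | p x <= 1]].
Proof.
have [C [C0 hC]] := op_bounded T pS; split.
  by exists (p (op T 0)), 0 => //=; rewrite (Cstar0 pC).
by exists C => _ [x /= x1 <-]; apply: (le_trans (hC x)); rewrite ler_piMr.
Qed.

Lemma opnorm_ge0 T : 0 <= opnorm T.
Proof.
apply: (@le_trans _ _ (p (op T 0))); first exact: Cstar_ge0.
apply: (sup_upper_bound (opnorm_has_sup T)).
by exists 0 => //=; rewrite (Cstar0 pC).
Qed.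

Lemma opnorm_op T x : p (op T x) <= opnorm T * p x.
Proof.
have [x0|xn0] := eqVneq (p x) 0.
  have [C [C0 hC]] := op_bounded T pS.
  by rewrite x0 mulr0 (le_trans (hC x)) // x0 mulr0.
have xgt : 0 < p x by rewrite lt0r xn0 Cstar_ge0.
rewrite -ler_pdivrMr //; apply: (sup_upper_bound (opnorm_has_sup T)).
exists ((p x)^-1%:C%C *: x) => /=.
  by rewrite (Cstar_seminormZ pC) normc_real gtr0_norm ?invr_gt0 // mulVf.
by rewrite opZ (Cstar_seminormZ pC) normc_real gtr0_norm ?invr_gt0 // mulrC.
Qed.

Lemma opnorm_le T C : 0 <= C -> (forall x, p (op T x) <= C * p x) -> opnorm T <= C.
Proof.
move=> C0 hC; apply: ge_sup; first by case: (opnorm_has_sup T).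
by move=> _ [x /= x1 <-]; apply: (le_trans (hC x)); rewrite ler_piMr.
Qed.

Lemma opnorm_sq_le T : opnorm T ^+ 2 <= opnorm (mult_star T * T).
Proof.
set n := opnorm (_ * _); have n0 : 0 <= n := opnorm_ge0 _.
rewrite -(sqr_sqrtr n0) ler_pXn2r ?nnegrE ?opnorm_ge0 ?sqrtr_ge0 //.
apply: opnorm_le => [|x]; first exact: sqrtr_ge0.
rewrite -(@ler_pXn2r _ 2) ?nnegrE ?mulr_ge0 ?sqrtr_ge0 ?Cstar_ge0 //.
rewrite -(Cstar_seminorm_star pC) op_adj exprMn sqr_sqrtr //.
apply: (le_trans (Cstar_seminormM pC _ _)).
rewrite (Cstar_st pC) expr2 mulrCA ler_wpM2l ?Cstar_ge0 //.
exact: (opnorm_op (mult_star T * T)).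
Qed.

Lemma opnormM S T : opnorm (S * T) <= opnorm S * opnorm T.
Proof.
apply: opnorm_le => [|x]; first by rewrite mulr_ge0 ?opnorm_ge0.
rewrite op_mul; apply: (le_trans (opnorm_op _ _)).
by rewrite -mulrA ler_wpM2l ?opnorm_ge0 ?opnorm_op.
Qed.

Lemma opnorm_star_le T : opnorm T <= opnorm (mult_star T).
Proof.
have [/eqP ->|b0] := boolP (opnorm T == 0); first exact: opnorm_ge0.
have bgt : 0 < opnorm T by rewrite lt0r b0 opnorm_ge0.
by rewrite -(ler_pM2r bgt) -expr2 (le_trans (opnorm_sq_le T)) // opnormM.
Qed.

Lemma mult_starK : involutive mult_star.
Proof. by move=> T; apply: multP => //=; rewrite conjcK. Qed.

Lemma mult_unital_Cstar : unital_Cstar mult_star opnorm.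
Proof.
split.
- by move=> S T; apply: multP => //=; rewrite rmorphD.
- by move=> c S; apply: multP => //= [|x]; rewrite ?rmorphM // conjcK.
- by move=> S T; apply: multP => //=; rewrite rmorphM mulrC.
- exact: mult_starK.
- exact: opnorm_ge0.
- move=> S T; apply: opnorm_le => [|x]; first by rewrite addr_ge0 ?opnorm_ge0.
  by rewrite mulrDl (le_trans (Cstar_seminormD pC _ _)) // lerD ?opnorm_op.
- move=> c T; have le (d : R[i]) S : opnorm (d *: S) <= Normc.normc d * opnorm S.
    have d0 : 0 <= Normc.normc d by case: (d) => ? ?; rewrite sqrtr_ge0.
    apply: opnorm_le => [|x]; first by rewrite mulr_ge0 ?opnorm_ge0.
    by rewrite op_scale (Cstar_seminormZ pC) -mulrA ler_wpM2l ?opnorm_op.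
  apply/eqP; rewrite eq_le le /=.
  have [->|c0] := eqVneq c 0; first by rewrite Normc.normc0 mul0r opnorm_ge0.
  have cn : 0 < Normc.normc c.
    rewrite lt0r; apply/andP; split; last by case: (c) => ? ?; rewrite sqrtr_ge0.
    by apply: contra c0 => /eqP/Normc.eq0_normc ->.
  have := le c^-1 (c *: T); rewrite scalerA mulVf // scale1r Normc.normcV.
  by rewrite ler_pdivlMl.
- exact: opnormM.
- move=> T; apply/eqP; rewrite eq_le opnorm_sq_le andbT.
  apply: (le_trans (opnormM _ _)); rewrite expr2 ler_wpM2r ?opnorm_ge0 //.
  by rewrite -{2}(mult_starK T) opnorm_star_le.
- by apply: opnorm_le => // x; rewrite mul1r.
Qed.

End OperatorSeminorm.

Program Definition lmult a : mult := @Mult 0 (smul a) (smul (star a)) _ _.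
Next Obligation. by move=> a x y /=; rewrite starM smulA. Qed.
Next Obligation.
move=> a p pS; exists (p a); split=> [|x]; first exact: Cstar_ge0 (proj1 pS) _.
exact: Cstar_seminormM (proj1 pS) _ _.
Qed.

Lemma lmultD : {morph lmult : a b / a + b}.
Proof. by move=> a b; apply: multP => [|x|x] /=; rewrite ?addr0 ?star_add // smul_addl. Qed.

Lemma lmultZ (c : R[i]) a : lmult (c *: a) = c *: lmult a.
Proof. by apply: multP => [|x|x] /=; rewrite ?mulr0 ?star_scale // smul_scalel. Qed.

Lemma lmultB : {morph lmult : a b / a - b}.
Proof. exact: (morphDB lmultD). Qed.

Lemma lmultM a b : lmult (a ** b) = lmult a * lmult b.
Proof. by apply: multP => [|x|x] /=; rewrite ?mulr0 ?starM // smulA. Qed.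

Lemma lmult_star a : lmult (star a) = mult_star (lmult a).
Proof. by apply: multP => [|x|x] /=; rewrite ?conjc0 ?starK. Qed.

(** The lower bound comes from evaluating at [star a]. This equality brings the norm estimates
    proved for multipliers back to [A]. *)
Lemma opnorm_lmult p a : SA p -> opnorm p (lmult a) = p a.
Proof.
move=> pS; have pC := proj1 pS; apply/eqP; rewrite eq_le; apply/andP; split.
  apply: (opnorm_le pS) => [|x]; [exact: Cstar_ge0 | exact: Cstar_seminormM].
have [/eqP ->|b0] := boolP (p a == 0); first exact: opnorm_ge0.
have bgt : 0 < p a by rewrite lt0r b0 Cstar_ge0.
rewrite -(ler_pM2r bgt) -expr2 -(Cstar_st2 pC) -(Cstar_st pC a).
exact: (opnorm_op pS (lmult a)).
Qed.

End Multipliers.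

(** * Positivity seminorm by seminorm, and the inverse square root *)

Section Positivity.
Variables (R : realType) (A : locallyCstarType R).
Implicit Types (a b x y l : A) (p : A -> R) (S T : mult A).

Local Notation SA := (@cont_Cstar_seminorms R A).
Local Notation mpos p := (pos (@mult_star R A) (opnorm p)).
Local Notation rs := (@rscal R (mult A)).

(** A seminorm to instantiate [unital_Cstar] with when only its algebraic consequences are wanted,
    such as self-adjointness of polynomials. *)
Lemma zero_seminorm : SA (fun=> 0).
Proof.
by split; [split=> // *; rewrite ?addr0 ?mulr0 ?expr0n | move=> x; exact: cvg_cst].
Qed.

(** Without a unit [t - a] is not an element of [A], so positivity is tested on left multiplication
    by [a]. *)
Definition ppos p a := mpos p (lmult a).

Section OneSeminorm.
Variable p : A -> R.
Hypothesis pS : SA p.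
Let pC : Cstar_seminorm p := proj1 pS.
Let H := mult_unital_Cstar pS.

Lemma ppos_star x : ppos p (star x ** x).
Proof. by rewrite /ppos lmultM lmult_star; exact: pos_star H _. Qed.

Lemma pposD a b : ppos p a -> ppos p b -> ppos p (a + b).
Proof. by rewrite /ppos lmultD; exact: posD H _ _. Qed.

Lemma ppos0 : ppos p 0.
Proof. by rewrite -(smul0r (star (0 : A))); exact: ppos_star. Qed.

Lemma ppos_sum I (r : seq I) (P : pred I) (F : I -> A) :
  (forall i, P i -> ppos p (F i)) -> ppos p (\sum_(i <- r | P i) F i).
Proof. by move=> h; elim/big_rec : _ => [|i x Pi]; [exact: ppos0 | apply: pposD; exact: h]. Qed.

Lemma ppos_le_D a b : ppos p a -> ppos p b -> p a <= p (a + b).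
Proof.
move=> pa pb; have := pos_le_D H pa pb.
by rewrite -lmultD !opnorm_lmult.
Qed.

Lemma ppos_closed a : star a = a ->
  (forall d, 0 < d -> exists2 b, ppos p b & p (a - b) <= d) -> ppos p a.
Proof.
move=> aa h; apply: (pos_closed H); first by rewrite /sa -lmult_star aa.
move=> d /h[b pb bd]; exists (lmult b) => //.
by rewrite -lmultB opnorm_lmult.
Qed.

Lemma pcvg_ppos u l : pcvg u l -> (forall n, ppos p (u n)) -> star l = l -> ppos p l.
Proof.
move=> ul up ll; apply: ppos_closed => // d d0.
by have [N hN] := ul p pS d d0; exists (u N) => //; rewrite (CstarBC pC) hN.
Qed.

Lemma adj_smul T x a : adj T (x ** a) = adj T x ** a.
Proof. exact: (op_smul (mult_star T)). Qed.

Lemma lmult_conj T x :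
  lmult (star x ** op T x) = mult_star (lmult x) * T * lmult x.
Proof.
apply: multP => [|y|y] /=; first by rewrite !mulr0.
  by rewrite op_smul smulA.
by rewrite starM starK op_adj adj_smul smulA.
Qed.

(* The square root [d] of [t - T] satisfies [|d x|^2 <= t |x|^2] because [x* T x >= 0]. *)
Lemma mpos_criterion T : mult_star T = T ->
  (forall x, ppos p (star x ** op T x)) -> mpos p T.
Proof.
move=> sT hT; split=> //; set t := opnorm p T; have t0 : 0 <= t := opnorm_ge0 pS _.
exists t => //; set S := rs t - T.
have pSS : mpos p S by exact: pos_rsB.
apply: (@ler_eps _ _ _ 2) => e e0.
have [q hq] := pos_sqrt H pSS e0; set d := ev S q in hq.
have sd : mult_star d = d by apply: (sa_ev H); exact: pos_sa pSS.
have dt : opnorm p d ^+ 2 <= t + e.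
  have te : 0 <= t + e by rewrite addr_ge0 // ltW.
  rewrite -(sqr_sqrtr te) ler_pXn2r ?nnegrE ?sqrtr_ge0 ?opnorm_ge0 //.
  apply: (opnorm_le pS) => [|x]; first exact: sqrtr_ge0.
  rewrite -(@ler_pXn2r _ 2) ?nnegrE ?mulr_ge0 ?sqrtr_ge0 ?(Cstar_ge0 pC) //.
  rewrite exprMn sqr_sqrtr // -(Cstar_seminorm_star pC) op_adj.
  have -> : adj d (op d x) = op (d ^+ 2 - S) x + op S x.
    by rewrite -op_add subrK expr2 op_mul -{1}sd.
  rewrite smul_addr mulrDl [X in _ <= X]addrC.
  apply: (le_trans (Cstar_seminormD pC _ _)); apply: lerD.
    apply: (le_trans (Cstar_seminormM pC _ _)); rewrite (Cstar_st pC) expr2 mulrCA.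
    rewrite ler_wpM2l ?(Cstar_ge0 pC) // (le_trans (opnorm_op pS _ _)) //.
    by rewrite ler_wpM2r ?(Cstar_ge0 pC).
  apply: (le_trans (_ : _ <= p (star x ** op S x + star x ** op T x))).
    apply: ppos_le_D => //; rewrite /ppos lmult_conj; exact: pos_conj.
  rewrite -smul_addr -op_add /S subrK op_rscal smul_scaler (Cstar_seminormZ pC) normc_real.
  by rewrite ger0_norm // (Cstar_seminorm_star pC).
have := ucs_D3 H (d ^+ 2) S 0; rewrite !subr0 => /le_trans; apply.
rewrite (ucs_sq H sd) (ucs_BC H); lra.
Qed.

End OneSeminorm.

(** Operators and adjoints converge pointwise, and the adjoint relation passes to the limit. The
    Cauchy bound is uniform relative to [p x], which upgrades pointwise convergence to convergence
    in [opnorm p]. *)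
Lemma mult_complete (T : nat -> mult A) :
  (forall p, SA p -> forall e, 0 < e -> exists N, forall m n, (N <= m)%N -> (N <= n)%N ->
     opnorm p (T m - T n) <= e) ->
  exists S, forall p, SA p -> forall e, 0 < e -> exists N, forall n, (N <= n)%N ->
     opnorm p (T n - S) <= e.
Proof.
move=> Tc.
have lim (U : nat -> mult A) : (forall p, SA p -> forall e, 0 < e ->
     exists N, forall m n, (N <= m)%N -> (N <= n)%N -> opnorm p (U m - U n) <= e) ->
    exists f, forall x, pcvg (fun n => op (U n) x) (f x).
  move=> Uc; suff /choice[f hf] : forall x, exists l, pcvg (fun n => op (U n) x) l by exists f.
  move=> x; apply: pcauchy_pcvg => p pS e e0.
  have k0 : 0 < p x + 1 by rewrite ltr_wpDl // (Cstar_ge0 (proj1 pS)).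
  have [N hN] := Uc p pS _ (divr_gt0 e0 k0); exists N => m n Nm Nn.
  rewrite -op_sub (le_trans (opnorm_op pS _ _)) //.
  have := hN m n Nm Nn; rewrite ler_pdivlMr // => /(le_trans _); apply.
  by rewrite ler_wpM2l ?opnorm_ge0 // lerDl.
have [f hf] := lim T Tc.
have [g hg] : exists g, forall x, pcvg (fun n => adj (T n) x) (g x).
  apply: (lim (fun n => mult_star (T n))) => p pS e e0; have [N hN] := Tc p pS e e0.
  have H := mult_unital_Cstar pS; exists N => m n Nm Nn.
  by rewrite -(ucs_stB H) (ucs_st H) hN.
have fg x y : star (f x) ** y = star x ** g y.
  apply: (@pcvg_unique _ _ (fun n => star (op (T n) x) ** y)).
    by apply: pcvgMr; exact: pcvg_star.
  by under eq_fun do rewrite op_adj; exact: pcvgMl.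
have fT p : SA p -> forall e, 0 < e -> exists N, forall n, (N <= n)%N ->
    forall x, p (op (T n) x - f x) <= e * p x.
  move=> pS e e0; have [N hN] := Tc p pS e e0; exists N => n Nn x.
  apply: (pcvg_le pS (u := fun m => op (T n) x - op (T m) x)).
    by apply: pcvgB => //; exact: pcvg_cst.
  exists N => m Nm; rewrite -op_sub (le_trans (opnorm_op pS _ _)) //.
  by rewrite ler_wpM2r ?(Cstar_ge0 (proj1 pS)) ?hN.
have fb p : SA p -> exists C, 0 <= C /\ forall x, p (f x) <= C * p x.
  move=> pS; have [N hN] := fT p pS 1 ltr01.
  exists (opnorm p (T N) + 1); split=> [|x]; first by rewrite addr_ge0 ?opnorm_ge0.
  rewrite -(subKr (op (T N) x) (f x)) (le_trans (CstarB (proj1 pS) _ _)) // mulrDl.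
  by rewrite lerD ?opnorm_op ?hN.
(* [opnorm] does not see the scalar coordinate, so 0 is a harmless value for it. *)
exists (Mult 0 fg fb) => p pS e e0; have [N hN] := fT p pS e e0; exists N => n Nn.
by apply: (opnorm_le pS) => [|x]; [exact: ltW | rewrite op_sub hN].
Qed.

Lemma opnorm_op_cvg (T : nat -> mult A) S :
  (forall p, SA p -> forall e, 0 < e -> exists N, forall n, (N <= n)%N ->
     opnorm p (T n - S) <= e) -> forall x, pcvg (fun n => op (T n) x) (op S x).
Proof.
move=> TS x p pS e e0.
have k0 : 0 < p x + 1 by rewrite ltr_wpDl // (Cstar_ge0 (proj1 pS)).
have [N hN] := TS p pS _ (divr_gt0 e0 k0); exists N => n Nn.
rewrite -op_sub (le_trans (opnorm_op pS _ _)) //.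
have := hN n Nn; rewrite ler_pdivlMr // => /(le_trans _); apply.
by rewrite ler_wpM2l ?opnorm_ge0 // lerDl.
Qed.

(** The [n]-th polynomial approximates on [[0, n]]; each seminorm sees only [[0, opnorm p T]], which
    is contained in almost all of these intervals although no interval serves all seminorms. The
    conclusions are pointwise because the scalar coordinate of a limit of multipliers carries no
    information. *)
Lemma mult_invsqrt T (e : R) : mult_star T = T -> (forall p, SA p -> mpos p T) -> 0 < e ->
  exists k : mult A, [/\ forall x, adj k x = op k x,
    forall x, op k (op T x) = op T (op k x) &
    forall x, op k (op k (op T x + (e%:C)%C *: x)) = x].
Proof.
move=> sT pT e0; pose f (x : R) := (Num.sqrt (e + x))^-1.
have [q hq] : exists q : nat -> {poly R}, forall n, forall x : R, 0 <= x <= n%:R ->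
    `|(q n).[x] - f x| <= n.+1%:R^-1.
  suff /choice[q hq] : forall n, exists q : {poly R}, forall x : R, 0 <= x <= n%:R ->
      `|q.[x] - f x| <= n.+1%:R^-1 by exists q.
  by move=> n; apply: invsqrt_poly; rewrite // invr_gt0.
have spec p (pS : SA p) : [/\ mpos p (T - rs 0), mpos p (rs (opnorm p T) - T) & 0 <= opnorm p T].
  have H := mult_unital_Cstar pS.
  split; rewrite ?opnorm_ge0 //; last exact: pos_rsB.
  by rewrite /rscal rmorph0 scale0r subr0; exact: pT.
pose Tn n := ev T (q n).
have small (F : nat -> {poly R}) p : SA p ->
    (forall M, 0 <= M -> exists2 C, 0 <= C & forall n (x : R),
      M <= n%:R -> 0 <= x <= M -> `|(F n).[x]| <= C / n.+1%:R) ->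
    forall d, 0 < d -> exists N, forall n, (N <= n)%N -> opnorm p (ev T (F n)) <= d.
  move=> pS hF d d0; have [s1 s2 M0] := spec p pS; have [C C0 hC] := hF _ M0.
  pose N := maxn (Num.truncn (opnorm p T)).+1 (Num.truncn (C / d)).+1.
  exists N => n; rewrite geq_max => /andP[n1 n2].
  have H := mult_unital_Cstar pS.
  apply: (ev_le H sT M0 s1 s2) => x xM; apply: (le_trans (hC n x _ xM)).
    apply: ltW; apply: lt_le_trans (Num.Theory.truncnS_gt _) _; by rewrite ler_nat.
  rewrite ler_pdivrMr // mulrC -ler_pdivrMr // ltW //.
  apply: lt_le_trans (Num.Theory.truncnS_gt _) _; rewrite ler_nat.
  exact: leq_trans n2 _.
have f0 (x : R) : 0 <= x -> 0 <= f x by move=> x0; rewrite invr_ge0 sqrtr_ge0.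
have Tc p : SA p -> forall d, 0 < d -> exists N, forall m n, (N <= m)%N -> (N <= n)%N ->
     opnorm p (Tn m - Tn n) <= d.
  move=> pS d d0; have [s1 s2 M0] := spec p pS; have H := mult_unital_Cstar pS.
  pose N := maxn (Num.truncn (opnorm p T)).+1 (Num.truncn (2 / d)).+1.
  have hN n (x : R) : (N <= n)%N -> 0 <= x <= opnorm p T -> `|(q n).[x] - f x| <= d / 2.
    rewrite geq_max => /andP[n1 n2] /andP[x0 xM].
    apply: le_trans (hq n x _) _.
      rewrite x0 (le_trans xM) // ltW //.
      apply: lt_le_trans (Num.Theory.truncnS_gt _) _; by rewrite ler_nat.
    rewrite -[d / 2]invrK lef_pV2 ?posrE ?invr_gt0 ?divr_gt0 // invf_div ltW //.
    apply: lt_le_trans (Num.Theory.truncnS_gt _) _; rewrite ler_nat.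
    exact: leq_trans n2 _.
  exists N => m n Nm Nn; rewrite -evB; apply: (ev_le H sT M0 s1 s2) => x xM.
  rewrite hornerD hornerN -(subrKA (f x)) (le_trans (ler_normD _ _)) //.
  by rewrite [d]splitr lerD ?hN // distrC hN.
have [k hk] := mult_complete Tc.
have cT n : Tn n * T = T * Tn n by apply: ev_comm; exact: erefl.
exists k; split=> x.
- have sn n : mult_star (Tn n) = Tn n.
    exact: (sa_ev (mult_unital_Cstar zero_seminorm)).
  apply: (pcvg_unique (u := fun n => op (Tn n) x)); last exact: opnorm_op_cvg.
  under eq_fun do rewrite -sn.
  apply: (@opnorm_op_cvg (fun n => mult_star (Tn n)) (mult_star k)) => p pS d d0.
  have H := mult_unital_Cstar pS.
  have [N hN] := hk p pS d d0; exists N => n Nn.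
  by rewrite -(ucs_stB H) (ucs_st H) hN.
- apply: (pcvg_unique (u := fun n => op (Tn n) (op T x))); first exact: opnorm_op_cvg.
  under eq_fun do rewrite -op_mul cT op_mul.
  apply: pcvg_map; [exact: opD | exact: op_bounded | exact: opnorm_op_cvg].
- pose y := op T x + (e%:C)%C *: x.
  apply: (pcvg_unique (u := fun n => op (Tn n) (op (Tn n) y))).
    (* Here [Tn (Tn y - k y)] tends to 0 because [opnorm p (Tn n)] is eventually at most
       [opnorm p k + 1]. *)
    rewrite -[op k (op k y)]add0r.
    have -> : (fun n => op (Tn n) (op (Tn n) y)) =
        (fun n => op (Tn n) (op (Tn n) y - op k y) + op (Tn n) (op k y)).
      by apply/funext => n; rewrite -opD subrK.
    apply: pcvgD; last exact: opnorm_op_cvg.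
    move=> p pS d d0; have H := mult_unital_Cstar pS.
    have k0 : 0 < opnorm p k + 1 by rewrite ltr_wpDl ?opnorm_ge0.
    have [N hN] := opnorm_op_cvg hk y pS (divr_gt0 d0 k0).
    have [N' hN'] := hk p pS _ ltr01.
    exists (maxn N N') => n; rewrite geq_max subr0 => /andP[n1 n2].
    apply: (le_trans (opnorm_op pS _ _)); have := hN n n1; rewrite ler_pdivlMr // mulrC.
    move/(le_trans _); apply; rewrite ler_wpM2r ?(Cstar_ge0 (proj1 pS)) //.
    rewrite -(subrKC k (Tn n)) (le_trans (ucs_D H _ _)) // lerD2l.
    exact: hN'.
  pose F n := q n ^+ 2 * ('X + e%:P) - 1.
  have -> : (fun n => op (Tn n) (op (Tn n) y)) = (fun n => op (ev T (F n)) x + x).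
    apply/funext => n; rewrite /F evB ev1 op_sub op_one subrK evM evXn evD evX evC.
    by rewrite expr2 !op_mul op_add op_rscal.
  rewrite -[X in pcvg _ X]add0r; apply: pcvgD; last exact: pcvg_cst.
  move=> p pS d d0.
  have k0 : 0 < p x + 1 by rewrite ltr_wpDl // (Cstar_ge0 (proj1 pS)).
  have FC M : 0 <= M -> exists2 C, 0 <= C & forall n z, (M <= n%:R) -> 0 <= z <= M ->
      `|(F n).[z]| <= C / n.+1%:R.
    move=> M0; pose K := (Num.sqrt e)^-1.
    have K0 : 0 <= K by rewrite invr_ge0 sqrtr_ge0.
    (* Since [f^2 (z + e) = 1], the polynomial is [(q - f) (q + f) (z + e)]; [K] bounds [f], and
       [|q - f| <= 1], so [|q + f| <= 2 K + 1]. *)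
    exists ((2 * K + 1) * (M + e)) => [|n z Mn /andP[z0 zM]].
      by rewrite mulr_ge0 ?addr_ge0 ?mulr_ge0 // ltW.
    have ez : 0 < e + z by rewrite ltr_wpDr.
    have fz : f z ^+ 2 * (z + e) = 1.
      by rewrite /f exprVn sqr_sqrtr ?(ltW ez) // [z + e]addrC mulVf ?gt_eqF.
    have -> : (F n).[z] = ((q n).[z] - f z) * (((q n).[z] + f z) * (z + e)).
      rewrite /F hornerD hornerN hornerM horner_exp hornerD hornerX !hornerC -fz.
      by ring.
    have fK : 0 <= f z <= K.
      rewrite f0 //= /f /K lef_pV2 ?posrE ?sqrtr_gt0 //.
      by rewrite ler_wsqrtr // lerDl.
    have := hq n z; rewrite z0 (le_trans zM) // => /(_ isT) hqz.
    have n1 : n.+1%:R^-1 <= 1 :> R by rewrite invf_le1 // ler1n.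
    rewrite normrM mulrC ler_pM // normrM (ger0_norm (_ : 0 <= z + e)); last by lra.
    apply: ler_pM => //; [by lra | | by lra].
    have := le_trans hqz n1; rewrite !ler_norml; lra.
  have [N hN] := small F p pS FC _ (divr_gt0 d0 k0); exists N => n Nn.
  rewrite subr0 (le_trans (opnorm_op pS _ _)) //.
  have := hN n Nn; rewrite ler_pdivlMr // => /(le_trans _); apply.
  by rewrite ler_wpM2l ?opnorm_ge0 // lerDl.
Qed.

End Positivity.

(** * Hilbert modules *)

Section RightModuleTheory.
Variables (R : realType) (A : starAlgType R) (V : rightModType A).
Implicit Types (x y : V) (a b : A).

Lemma ract_addl x y a : (x + y) <* a = x <* a + y <* a. Proof. exact: ractDl. Qed.
Lemma ract_subl x y a : (x - y) <* a = x <* a - y <* a.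
Proof. exact: (morphDB (fun x y => ract_addl x y a)). Qed.

Variable D : set V.
Hypothesis hD : submodule D.

Lemma submoduleN x : D x -> D (- x).
Proof. by move=> Dx; rewrite -scaleN1r; exact: submoduleZ. Qed.

Lemma submoduleB x y : D x -> D y -> D (x - y).
Proof. by move=> Dx Dy; apply: submoduleD => //; exact: submoduleN. Qed.

Lemma submodule_sum I (r : seq I) (P : pred I) (F : I -> V) :
  (forall i, P i -> D (F i)) -> D (\sum_(i <- r | P i) F i).
Proof.
by move=> h; elim/big_rec : _ => [|i x Pi]; [exact: submodule0 | apply: submoduleD => //; exact: h].
Qed.

End RightModuleTheory.

(** * Semi-Hilbert modules and Cauchy-Schwarz *)

Section SemiHilbert.
Variables (R : realType) (A : locallyCstarType R).
Local Notation SA := (@cont_Cstar_seminorms R A).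

(* Positivity is only required seminorm by seminorm: this condition is visibly
   stable under sums and limits, unlike having the form [star b ** b]. *)
Record semi_hilbert (F : formModule A) : Prop := {
  sh_sub : submodule (carrier F);
  sh_ipD : forall x y z, carrier F x -> carrier F y -> carrier F z ->
    ip F x (y + z) = ip F x y + ip F x z;
  sh_ipZ : forall (c : R[i]) x y, carrier F x -> carrier F y ->
    ip F x (c *: y) = c *: ip F x y;
  sh_ipr : forall x y (a : A), carrier F x -> carrier F y ->
    ip F x (y <* a) = ip F x y ** a;
  sh_star : forall x y, carrier F x -> carrier F y -> star (ip F x y) = ip F y x;
  sh_pos : forall p x, SA p -> carrier F x -> ppos p (ip F x x)
}.

Lemma preHilbert_semi (F : formModule A) : preHilbert F -> semi_hilbert F.
Proof.
case=> h1 h2 h3 h4 h5 h6 h7; split=> // p x pS /h6[b ->].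
exact: ppos_star.
Qed.

Section Theory.
Variable F : formModule A.
Hypothesis hF : semi_hilbert F.
Let hD := sh_sub hF.
Local Notation C := (carrier F).
Implicit Types (x y z : ambient F) (a b : A) (p : A -> R).

Lemma ip_addl x y z : C x -> C y -> C z -> ip F (x + y) z = ip F x z + ip F y z.
Proof.
move=> Cx Cy Cz; have Cxy := submoduleD hD Cx Cy.
by rewrite -(sh_star hF Cz Cxy) (sh_ipD hF) // star_add !(sh_star hF).
Qed.

Lemma ip_scalel (c : R[i]) x y : C x -> C y -> ip F (c *: x) y = conjc c *: ip F x y.
Proof.
move=> Cx Cy; have Cc := submoduleZ hD c Cx.
by rewrite -(sh_star hF Cy Cc) (sh_ipZ hF) // star_scale (sh_star hF).
Qed.

Lemma ip_ractl x y a : C x -> C y -> ip F (x <* a) y = star a ** ip F x y.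
Proof.
move=> Cx Cy; have Cc := submodule_ract hD a Cx.
by rewrite -(sh_star hF Cy Cc) (sh_ipr hF) // starM (sh_star hF).
Qed.

Lemma ip_oppr x y : C x -> C y -> ip F x (- y) = - ip F x y.
Proof. by move=> Cx Cy; rewrite -scaleN1r (sh_ipZ hF) // scaleN1r. Qed.

Lemma ip_oppl x y : C x -> C y -> ip F (- x) y = - ip F x y.
Proof. by move=> Cx Cy; rewrite -scaleN1r ip_scalel // rmorphN rmorph1 scaleN1r. Qed.

Lemma ip_subr x y z : C x -> C y -> C z -> ip F x (y - z) = ip F x y - ip F x z.
Proof. by move=> Cx Cy Cz; rewrite (sh_ipD hF) // ?ip_oppr //; exact: submoduleN. Qed.

Lemma ip_subl x y z : C x -> C y -> C z -> ip F (x - y) z = ip F x z - ip F y z.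
Proof. by move=> Cx Cy Cz; rewrite ip_addl // ?ip_oppl //; exact: submoduleN. Qed.

Lemma ip_0r x : C x -> ip F x 0 = 0.
Proof. by move=> Cx; rewrite -(scale0r (0 : ambient F)) (sh_ipZ hF) ?scale0r //; exact: submodule0. Qed.

Lemma ip_0l x : C x -> ip F 0 x = 0.
Proof.
by move=> Cx; rewrite -(sh_star hF Cx (submodule0 hD)) ip_0r // star0.
Qed.

Lemma ip_sumr I (r : seq I) (P : pred I) (G : I -> ambient F) x : C x ->
  (forall i, P i -> C (G i)) ->
  ip F x (\sum_(i <- r | P i) G i) = \sum_(i <- r | P i) ip F x (G i).
Proof.
move=> Cx CG; suff [] : C (\sum_(i <- r | P i) G i) /\
  ip F x (\sum_(i <- r | P i) G i) = \sum_(i <- r | P i) ip F x (G i) by [].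
elim/big_rec2 : _ => [|i y z Pi [Cz <-]]; first by rewrite ip_0r //; split=> //; exact: submodule0.
by split; [apply: submoduleD => //; exact: CG | rewrite (sh_ipD hF) //; exact: CG].
Qed.

Lemma ip_suml I (r : seq I) (P : pred I) (G : I -> ambient F) x : C x ->
  (forall i, P i -> C (G i)) ->
  ip F (\sum_(i <- r | P i) G i) x = \sum_(i <- r | P i) ip F (G i) x.
Proof.
move=> Cx CG; rewrite -(sh_star hF) //; last exact: submodule_sum.
rewrite ip_sumr // star_sum; apply: eq_bigr => i Pi; rewrite (sh_star hF) //; exact: CG.
Qed.

Section Norm.
Variable p : A -> R.
Hypothesis pS : SA p.
Let pC : Cstar_seminorm p := proj1 pS.

Definition nrm x := @mod_seminorm R A F p x.

Lemma nrm_ge0 x : 0 <= nrm x. Proof. exact: sqrtr_ge0. Qed.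

Lemma nrm_sq x : nrm x ^+ 2 = p (ip F x x).
Proof. by rewrite /nrm /mod_seminorm sqr_sqrtr ?(Cstar_ge0 pC). Qed.

Lemma nrm_le x e : 0 <= e -> (nrm x <= e) = (p (ip F x x) <= e ^+ 2).
Proof. by move=> e0; rewrite -nrm_sq ler_pXn2r ?nnegrE ?nrm_ge0. Qed.

Lemma cauchy_schwarz x y : C x -> C y -> p (ip F x y) <= nrm x * nrm y.
Proof.
move=> Cx Cy; rewrite -(@ler_pXn2r _ 2) ?nnegrE ?mulr_ge0 ?nrm_ge0 ?(Cstar_ge0 pC) //.
rewrite exprMn !nrm_sq; set a := ip F x y; set u := ip F x x; set v := ip F y y.
(* [ucs_cauchy_schwarz] requires a positive [s], while [p u] may be 0; hence [s = p u + d]. *)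
apply: (@ler_eps _ _ _ (p v)) => d d0.
have s0 : 0 < p u + d by rewrite ltr_wpDl ?(Cstar_ge0 pC).
rewrite [p v * d]mulrC -mulrDl.
have := @ucs_cauchy_schwarz _ _ _ _ (mult_unital_Cstar pS) (lmult u) (lmult v) (lmult a)
  _ (sh_pos hF pS Cx) s0.
rewrite !opnorm_lmult // lerDl ltW // => /(_ isT); apply=> t.
rewrite -lmult_star -!lmultM -!lmultZ -lmultD -lmultZ -lmultB -lmultD.
pose w := x <* ((t%:C)%C *: a) - y.
suff -> : (t%:C)%C *: ((t%:C)%C *: (star a ** u ** a)) -
    (t%:C)%C *: (star a ** a + star a ** a) + v = ip F w w.
  apply: sh_pos => //; apply: (submoduleB hD) => //; exact: submodule_ract.
have Cxa : C (x <* ((t%:C)%C *: a)) by exact: submodule_ract.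
rewrite /w ip_subl ?ip_subr //; last exact: submoduleB.
rewrite !ip_ractl ?(sh_ipr hF) // -/u -/a -/v -(sh_star hF Cx Cy) -/a.
rewrite star_scale conjc_real !smul_scalel !smul_scaler smulA.
by rewrite opprB scalerDr opprD -!addrA; congr (_ + (_ + _)); rewrite addrC.
Qed.

Lemma nrmD x y : C x -> C y -> nrm (x + y) <= nrm x + nrm y.
Proof.
move=> Cx Cy; rewrite nrm_le ?addr_ge0 ?nrm_ge0 //.
have Cxy := submoduleD hD Cx Cy.
rewrite ip_addl // !(sh_ipD hF) // (le_trans (Cstar_seminormD pC _ _)) //.
apply: (le_trans (lerD (Cstar_seminormD pC _ _) (Cstar_seminormD pC _ _))).
have := cauchy_schwarz Cx Cy; have := cauchy_schwarz Cy Cx; rewrite -!nrm_sq; nra.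
Qed.

Lemma nrmN x : C x -> nrm (- x) = nrm x.
Proof.
by move=> Cx; rewrite /nrm /mod_seminorm ip_oppl ?ip_oppr ?opprK //; exact: submoduleN.
Qed.

Lemma nrmB x y : C x -> C y -> nrm (x - y) <= nrm x + nrm y.
Proof. by move=> Cx Cy; rewrite -(nrmN Cy); apply: nrmD => //; exact: submoduleN. Qed.

Lemma nrmBC x y : C x -> C y -> nrm (x - y) = nrm (y - x).
Proof. by move=> Cx Cy; rewrite -nrmN ?opprB //; exact: submoduleB. Qed.

Lemma nrm_tri z x y : C x -> C y -> C z -> nrm (x - y) <= nrm (x - z) + nrm (z - y).
Proof. by move=> Cx Cy Cz; rewrite -(subrKA z); apply: nrmD; exact: submoduleB. Qed.

Lemma nrmZ (c : R[i]) x : C x -> nrm (c *: x) = Normc.normc c * nrm x.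
Proof.
move=> Cx; have c0 (d : R[i]) : 0 <= Normc.normc d by case: d => ? ?; rewrite sqrtr_ge0.
apply/eqP; rewrite -(@eqrXn2 _ 2) ?mulr_ge0 ?nrm_ge0 //; apply/eqP.
rewrite exprMn !nrm_sq ip_scalel ?(sh_ipZ hF) //; last exact: submoduleZ.
have -> : p (conjc c *: (c *: ip F x x)) = Normc.normc c * (Normc.normc c * p (ip F x x)).
  by rewrite !(Cstar_seminormZ pC); congr (_ * _); case: (c) => u v /=; rewrite sqrrN.
by rewrite mulrA expr2.
Qed.

Lemma nrm_ract x a : C x -> nrm (x <* a) <= nrm x * p a.
Proof.
move=> Cx; rewrite nrm_le ?mulr_ge0 ?nrm_ge0 ?(Cstar_ge0 pC) //.
rewrite ip_ractl ?(sh_ipr hF) //; last exact: submodule_ract.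
rewrite (le_trans (Cstar_seminormM pC _ _)) // (Cstar_st pC).
apply: (le_trans (ler_wpM2l (Cstar_ge0 pC _) (Cstar_seminormM pC _ _))).
by rewrite exprMn nrm_sq mulrCA -expr2.
Qed.

Lemma nrm0 : nrm 0 = 0.
Proof. by rewrite /nrm /mod_seminorm ip_0r ?(Cstar0 pC) ?sqrtr0 //; exact: submodule0. Qed.

End Norm.

End Theory.

Lemma dsum_semi (E F : formModule A) : semi_hilbert E -> semi_hilbert F ->
  semi_hilbert (dsum E F).
Proof.
move=> hE hF; have [sE sF] := (sh_sub hE, sh_sub hF); split.
- split=> [|x y [x1 x2] [y1 y2]|c x [x1 x2]|x a [x1 x2]].
  + by split; exact: submodule0.
  + by split; exact: submoduleD.
  + by split; exact: submoduleZ.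
  + by split; exact: submodule_ract.
- move=> x y z [x1 x2] [y1 y2] [z1 z2] /=.
  by rewrite (sh_ipD hE) // (sh_ipD hF) // addrACA.
- move=> c x y [x1 x2] [y1 y2] /=; by rewrite (sh_ipZ hE) // (sh_ipZ hF) // scalerDr.
- move=> x y a [x1 x2] [y1 y2] /=; by rewrite (sh_ipr hE) // (sh_ipr hF) // smul_addl.
- move=> x y [x1 x2] [y1 y2] /=; by rewrite star_add (sh_star hE) // (sh_star hF).
- by move=> p x pS [x1 x2] /=; apply: (pposD pS); apply: sh_pos.
Qed.

End SemiHilbert.

(** * The standard module H_A *)

Section StandardModule.
Variables (R : realType) (A : locallyCstarType R).
Local Notation SA := (@cont_Cstar_seminorms R A).
Local Notation HA := (std_hilbert A).
Local Notation C := (carrier HA).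
Implicit Types (x y z : nat -> A) (p : A -> R) (u : nat -> A).

Definition win (m n : nat) x y : A := \sum_(m <= i < n) star (x i) ** y i.

(** Each finite window of coordinates is a form on all sequences, degenerate off the window, so
    Cauchy-Schwarz and the triangle inequality hold for sums over [[m, n)] before any summability is
    known. *)
Definition winF m n : formModule A := @FormModule R A (nat -> A) setT (win m n).

Lemma win_semi m n : semi_hilbert (winF m n).
Proof.
split=> //=.
- move=> x y z _ _ _; rewrite /win -big_split; apply: eq_bigr => i _; exact: smul_addr.
- move=> c x y _ _; rewrite /win scaler_sumr; apply: eq_bigr => i _; exact: smul_scaler.
- move=> x y a _ _; rewrite /win (morphD_sum (fun b c : A => smul_addl b c a)).
  by apply: eq_bigr => i _; rewrite -smulA.
- move=> x y _ _; rewrite /win star_sum; apply: eq_bigr => i _; by rewrite starM starK.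
- by move=> p x pS _; apply: (ppos_sum pS) => i _; exact: ppos_star.
Qed.

Local Notation wn p m n x := (@nrm R A (winF m n) p x).

Lemma summableP u : Defs.summable u <-> forall p, SA p -> forall e, 0 < e ->
  exists N, forall m n, (N <= m)%N -> (m <= n)%N -> p (\sum_(m <= i < n) u i) <= e.
Proof.
have dif m n : (m <= n)%N -> series u n - series u m = \sum_(m <= i < n) u i.
  by move=> mn; rewrite /series /= (big_cat_nat _ mn) //= addrAC subrr add0r.
split=> [[l /cvg_pcvg ul] p pS e e0|h].
  have e2 : 0 < e / 2 by rewrite divr_gt0.
  have [N hN] := ul p pS _ e2; exists N => m n Nm mn; rewrite -dif //.
  apply: (le_trans (Cstar_tri (proj1 pS) l _ _)); rewrite (splitr e) lerD ?hN //.
    exact: leq_trans mn.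
  by rewrite (CstarBC (proj1 pS)) hN.
suff /pcauchy_pcvg[l ul] : pcauchy (series u) by exists l; apply/cvg_pcvg.
move=> p pS e e0; have [N hN] := h p pS e e0; exists N => m n Nm Nn.
have [mn|/ltnW nm] := leqP m n; last by rewrite dif ?hN.
by rewrite (CstarBC (proj1 pS)) dif ?hN.
Qed.

Lemma tsumE u l : pcvg (series u) l -> tsum u = l.
Proof.
move=> ul; rewrite /tsum; apply: xget_unique; first exact/cvg_pcvg.
by move=> l' /cvg_pcvg ul'; exact: pcvg_unique ul' ul.
Qed.

Lemma tsum_cvg u : Defs.summable u -> pcvg (series u) (tsum u).
Proof. by move=> [l /cvg_pcvg ul]; rewrite (tsumE ul). Qed.

Lemma wn_le p m n x e : SA p -> 0 <= e -> (wn p m n x <= e) = (p (win m n x x) <= e ^+ 2).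
Proof. by move=> pS e0; rewrite nrm_le. Qed.

(** The Cauchy criterion for the defining series, phrased in window norms, which unlike the sums
    themselves are subadditive in [x]. *)
Lemma car_tail x : C x <-> forall p, SA p -> forall e, 0 < e ->
  exists N, forall m n, (N <= m)%N -> (m <= n)%N -> wn p m n x <= e.
Proof.
rewrite /= summableP; split=> h p pS e e0.
  have [N hN] := h p pS _ (exprn_gt0 2 e0); exists N => m n Nm mn.
  by rewrite wn_le ?(ltW e0) // hN.
have s0 : 0 < Num.sqrt e by rewrite sqrtr_gt0.
have [N hN] := h p pS _ s0; exists N => m n Nm mn.
by have := hN m n Nm mn; rewrite wn_le ?(ltW s0) // sqr_sqrtr // ltW.
Qed.

Lemma ip_summable x y : C x -> C y -> Defs.summable (fun n => star (x n) ** y n).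
Proof.
move=> /car_tail Cx /car_tail Cy; apply/summableP => p pS e e0.
have s0 : 0 < Num.sqrt e by rewrite sqrtr_gt0.
have [N hN] := Cx p pS _ s0; have [N' hN'] := Cy p pS _ s0.
exists (maxn N N') => m n; rewrite geq_max => /andP[m1 m2] mn.
apply: (le_trans (cauchy_schwarz (win_semi m n) pS (x := x) (y := y) I I)).
have -> : e = Num.sqrt e * Num.sqrt e by rewrite -expr2 sqr_sqrtr // ltW.
by rewrite ler_pM ?nrm_ge0 ?hN ?hN'.
Qed.

Lemma ip_win_cvg x y : C x -> C y -> pcvg (fun n => win 0 n x y) (ip HA x y).
Proof. by move=> Cx Cy; exact: tsum_cvg (ip_summable Cx Cy). Qed.

Lemma ip_winE x y l : pcvg (fun n => win 0 n x y) l -> ip HA x y = l.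
Proof. exact: tsumE. Qed.

Lemma std_submodule : submodule C.
Proof.
split.
- apply/car_tail => p pS e e0; exists 0 => m n _ _.
  by rewrite (nrm0 (win_semi m n) pS) ltW.
- move=> x y /car_tail Cx /car_tail Cy; apply/car_tail => p pS e e0.
  have e2 : 0 < e / 2 by rewrite divr_gt0.
  have [N hN] := Cx p pS _ e2; have [N' hN'] := Cy p pS _ e2.
  exists (maxn N N') => m n; rewrite geq_max => /andP[m1 m2] mn.
  apply: (le_trans (nrmD (win_semi m n) pS (x := x) (y := y) I I)).
  by rewrite (splitr e) lerD ?hN ?hN'.
- move=> c x /car_tail Cx; apply/car_tail => p pS e e0.
  have c0 : 0 <= Normc.normc c by case: (c) => ? ?; rewrite sqrtr_ge0.
  have c1 : 0 < Normc.normc c + 1 by rewrite ltr_wpDl.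
  have [N hN] := Cx p pS _ (divr_gt0 e0 c1); exists N => m n Nm mn.
  rewrite (nrmZ (win_semi m n) pS) //; have := hN m n Nm mn.
  rewrite ler_pdivlMr // mulrC; apply: le_trans.
  by rewrite ler_wpM2r ?nrm_ge0 // lerDl.
- move=> x a /car_tail Cx; apply/car_tail => p pS e e0.
  have c0 := Cstar_ge0 (proj1 pS) a.
  have c1 : 0 < p a + 1 by rewrite ltr_wpDl.
  have [N hN] := Cx p pS _ (divr_gt0 e0 c1); exists N => m n Nm mn.
  apply: (le_trans (nrm_ract (win_semi m n) pS a (x := x) I)); have := hN m n Nm mn.
  rewrite ler_pdivlMr //; apply: le_trans.
  by rewrite ler_wpM2l ?nrm_ge0 // lerDl.
Qed.

Lemma std_semi : semi_hilbert HA.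
Proof.
have sub := std_submodule.
have stE x y : C x -> C y -> star (ip HA x y) = ip HA y x.
  move=> Cx Cy; apply/esym/ip_winE.
  have -> : (fun n => win 0 n y x) = (fun n => star (win 0 n x y)).
    by apply/funext => n; exact/esym/(sh_star (win_semi 0 n) (x := x) (y := y) I I).
  by apply: pcvg_star; exact: ip_win_cvg.
split=> //.
- move=> x y z Cx Cy Cz; apply: ip_winE.
  have -> : (fun n => win 0 n x (y + z)) = (fun n => win 0 n x y + win 0 n x z).
    by apply/funext => n; exact: (sh_ipD (win_semi 0 n) (x := x) (y := y) (z := z) I I I).
  by apply: pcvgD; exact: ip_win_cvg.
- move=> c x y Cx Cy; apply: ip_winE.
  have -> : (fun n => win 0 n x (c *: y)) = (fun n => c *: win 0 n x y).
    by apply/funext => n; exact: (sh_ipZ (win_semi 0 n) c (x := x) (y := y) I I).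
  by apply: pcvgZ; exact: ip_win_cvg.
- move=> x y a Cx Cy; apply: ip_winE.
  have -> : (fun n => win 0 n x (y <* a)) = (fun n => win 0 n x y ** a).
    by apply/funext => n; exact: (sh_ipr (win_semi 0 n) (x := x) (y := y) a I I).
  by apply: pcvgMr; exact: ip_win_cvg.
- move=> p x pS Cx; apply: (pcvg_ppos pS (ip_win_cvg Cx Cx)); last exact: stE.
  by move=> n; exact: (sh_pos (win_semi 0 n) pS I).
Qed.

Lemma win_cat x m n k : (m <= n)%N -> (n <= k)%N -> win m k x x = win m n x x + win n k x x.
Proof. by move=> mn nk; rewrite /win (big_cat_nat mn nk). Qed.

Lemma win_mono p x m n k : SA p -> (m <= n)%N -> (n <= k)%N ->
  p (win m n x x) <= p (win m k x x) /\ p (win n k x x) <= p (win m k x x).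
Proof.
move=> pS mn nk; rewrite (win_cat x mn nk).
have pos a b : ppos p (win a b x x) by exact: (sh_pos (win_semi a b) pS I).
by split; [|rewrite addrC]; exact: ppos_le_D.
Qed.

Lemma win_le_ip p x m n : SA p -> C x -> p (win m n x x) <= p (ip HA x x).
Proof.
move=> pS Cx; have [nm|mn] := leqP n m.
  by rewrite /win big_geq // (Cstar0 (proj1 pS)) (Cstar_ge0 (proj1 pS)).
apply/ler_addgt0Pr => e e0; have [N hN] := ip_win_cvg Cx Cx pS e0.
have [_ h1] := win_mono x pS (leq0n m) (ltnW mn).
have [h2 _] := win_mono x pS (leq0n n) (leq_maxr N n).
rewrite (le_trans h1) // (le_trans h2) //.
rewrite -{1}(subrKC (ip HA x x) (win 0 (maxn N n) x x)) (le_trans (Cstar_seminormD (proj1 pS) _ _)) //.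
by rewrite lerD2l hN // leq_maxl.
Qed.

Lemma ip_le_win p x e : SA p -> C x -> (forall n, p (win 0 n x x) <= e) -> p (ip HA x x) <= e.
Proof.
by move=> pS Cx h; apply: (pcvg_le pS (ip_win_cvg Cx Cx)); exists 0 => n _; exact: h.
Qed.

Lemma coord_le p x j : SA p -> C x -> p (x j) <= @nrm R A HA p x.
Proof.
move=> pS Cx; rewrite -(@ler_pXn2r _ 2) ?nnegrE ?nrm_ge0 ?(Cstar_ge0 (proj1 pS)) //.
rewrite nrm_sq // -(Cstar_seminorm_star (proj1 pS)).
by have := win_le_ip j j.+1 pS Cx; rewrite /win big_nat1.
Qed.

Lemma win_cvg0 p m n (z : nat -> nat -> A) x : SA p ->
  (forall j, pcvg (z ^~ j) (x j)) -> forall e, 0 < e ->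
  exists N, forall k, (N <= k)%N -> p (win m n (z k - x) (z k - x)) <= e.
Proof.
move=> pS zx; elim: n => [|n IH] e e0.
  by exists 0 => k _; rewrite /win big_geq // (Cstar0 (proj1 pS)) ltW.
have [mn|nm] := leqP m n; last first.
  by exists 0 => k _; rewrite /win big_geq // (Cstar0 (proj1 pS)) ltW.
have e2 : 0 < e / 2 by rewrite divr_gt0.
have s2 : 0 < Num.sqrt (e / 2) by rewrite sqrtr_gt0.
have [N hN] := IH _ e2; have [N' hN'] := zx n p pS _ s2.
exists (maxn N N') => k; rewrite geq_max => /andP[k1 k2].
rewrite /win big_nat_recr //= (le_trans (Cstar_seminormD (proj1 pS) _ _)) //.
rewrite (splitr e) lerD ?hN // (Cstar_seminorm_star (proj1 pS)).
rewrite -[e / 2]sqr_sqrtr ?(ltW e2) // ler_pXn2r ?nnegrE ?sqrtr_ge0 ?(Cstar_ge0 (proj1 pS)) //.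
exact: hN'.
Qed.

(** The limit is taken coordinatewise. On a given window [z k - x] is compared with [z k - z l],
    where [l] is chosen after the window; the resulting bound is the same for all windows and yields
    both membership of [x] and convergence in norm. *)
Lemma std_complete (z : nat -> nat -> A) : (forall k, C (z k)) ->
  (forall p, SA p -> forall e, 0 < e -> exists N, forall k l, (N <= k)%N -> (N <= l)%N ->
     @nrm R A HA p (z k - z l) <= e) ->
  exists2 x, C x & forall p, SA p -> forall e, 0 < e -> exists N, forall k, (N <= k)%N ->
     @nrm R A HA p (z k - x) <= e.
Proof.
move=> Cz zc.
have /choice[x zx] : forall j, exists l, pcvg (z ^~ j) l.
  move=> j; apply: pcauchy_pcvg => p pS e e0; have [N hN] := zc p pS e e0.
  exists N => k l Nk Nl; apply: le_trans (hN k l Nk Nl).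
  by apply: (coord_le j pS (x := z k - z l)); exact: (submoduleB std_submodule).
have wx p : SA p -> forall e, 0 < e -> exists N, forall k, (N <= k)%N ->
    forall m n, wn p m n (z k - x) <= e.
  move=> pS e e0; have [N hN] := zc p pS e e0; exists N => k Nk m n.
  apply/ler_addgt0Pr => d d0; have [N' hN'] := win_cvg0 m n pS zx (exprn_gt0 2 d0).
  pose l := maxn N N'.
  apply: (le_trans (nrm_tri (win_semi m n) pS (z := z l) I I I)); apply: lerD.
    rewrite wn_le ?(ltW e0) // (le_trans (win_le_ip _ _ pS _)) //.
      exact: (submoduleB std_submodule).
    by rewrite -nrm_sq // ler_pXn2r ?nnegrE ?nrm_ge0 ?(ltW e0) // hN // leq_maxl.
  by rewrite wn_le ?(ltW d0) // hN' // leq_maxr.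
have Cx : C x.
  apply/car_tail => p pS e e0; have e2 : 0 < e / 2 by rewrite divr_gt0.
  have [N hN] := wx p pS _ e2.
  have /car_tail/(_ p pS _ e2)[N' hN'] := Cz N.
  exists N' => m n m1 mn; have -> : x = z N - (z N - x) by rewrite subKr.
  apply: (le_trans (nrmB (win_semi m n) pS (x := z N) (y := z N - x) I I)).
  by rewrite (splitr e) lerD ?hN ?hN'.
exists x => // p pS e e0; have [N hN] := wx p pS e e0; exists N => k Nk.
rewrite nrm_le ?(ltW e0) //; apply: ip_le_win => // [|n].
  exact: (submoduleB std_submodule).
by rewrite -wn_le ?(ltW e0) // hN.
Qed.

Definition coord_vec (j : nat) (a : A) : nat -> A := fun i => if i == j then a else 0.

Lemma win_coord j a z n : (j < n)%N -> win 0 n (coord_vec j a) z = star a ** z j.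
Proof.
move=> jn; rewrite /win big_mkord (bigD1 (Ordinal jn)) //= big1 => [|i ij].
  by rewrite addr0 /coord_vec eqxx.
by rewrite /coord_vec ifN ?star0 ?smul0l.
Qed.

Lemma coord_car j a : C (coord_vec j a).
Proof.
exists (star a ** a); apply/cvg_pcvg => p pS e e0; exists j.+1 => n jn.
rewrite [X in X - _](_ : _ = win 0 n (coord_vec j a) (coord_vec j a)) // win_coord //.
by rewrite /coord_vec eqxx subrr (Cstar0 (proj1 pS)) ltW.
Qed.

Lemma ip_coordl j a z : ip HA (coord_vec j a) z = star a ** z j.
Proof.
apply: ip_winE => p pS e e0; exists j.+1 => n jn.
by rewrite win_coord // subrr (Cstar0 (proj1 pS)) ltW.
Qed.

Lemma std_truncate p x e : SA p -> C x -> 0 < e ->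
  exists J, @nrm R A HA p (x - \sum_(j < J) coord_vec j (x j)) <= e.
Proof.
move=> pS Cx e0; have /car_tail/(_ p pS e e0)[J hJ] := Cx; exists J.
have Ct : C (\sum_(j < J) coord_vec j (x j)).
  by apply: (submodule_sum std_submodule) => j _; exact: coord_car.
rewrite nrm_le ?(ltW e0) //; apply: ip_le_win => // [|n].
  exact: (submoduleB std_submodule).
set d := x - _.
have dE i : d i = if (i < J)%N then 0 else x i.
  have -> : d i = x i - \sum_(j < J) coord_vec j (x j) i by rewrite /d /= fct_sumE.
  case: ltnP => iJ.
    rewrite (bigD1 (Ordinal iJ)) //= big1 => [|j ij]; first by rewrite /coord_vec eqxx addr0 subrr.
    by rewrite /coord_vec ifN // eq_sym.
  rewrite big1 ?subr0 // => j _; rewrite /coord_vec ifN // neq_ltn.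
  by rewrite (leq_trans (ltn_ord j) iJ) orbT.
have [nJ|Jn] := leqP n J.
  rewrite /win big_nat big1 ?(Cstar0 (proj1 pS)) ?exprn_ge0 ?(ltW e0) // => i /andP[_ iN].
  by rewrite dE (leq_trans iN nJ) smul0r.
rewrite (win_cat d (leq0n J) (ltnW Jn)) {1}/win big_nat big1 ?add0r; last first.
  by move=> i /andP[_ iJ]; rewrite dE iJ smul0r.
have -> : win J n d d = win J n x x.
  by rewrite /win; apply: eq_big_nat => i /andP[iJ _]; rewrite dE ltnNge iJ.
by rewrite -wn_le ?(ltW e0) // hJ // ltnW.
Qed.

Lemma std_definite x : C x -> ip HA x x = 0 -> x = 0.
Proof.
move=> Cx x0; apply/funext => j; apply: seminorms_separate => p pS.
apply/eqP; rewrite eq_le (Cstar_ge0 (proj1 pS)) andbT (le_trans (coord_le j pS Cx)) //.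
by rewrite /nrm /mod_seminorm x0 (Cstar0 (proj1 pS)) sqrtr0.
Qed.

End StandardModule.

(** * Gram-Schmidt orthonormalization *)

Section GramSchmidt.
Variables (R : realType) (A : locallyCstarType R) (K : formModule A).
Local Notation SA := (@cont_Cstar_seminorms R A).
Hypothesis hK : semi_hilbert K.
Hypothesis K_definite : forall x, carrier K x -> ip K x x = 0 -> x = 0.
Local Notation C := (carrier K).
Let hD := sh_sub hK.
Implicit Types (a b : A) (z w : ambient K) (p : A -> R).
Implicit Types (f t e : A -> ambient K) (g : ambient K -> A).

Lemma ip_sep z w : C z -> C w -> (forall y, C y -> ip K z y = ip K w y) -> z = w.
Proof.
move=> Cz Cw h; have Cd := submoduleB hD Cz Cw.
apply/eqP; rewrite -subr_eq0; apply/eqP/K_definite => //.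
by rewrite (ip_subl hK) // h // subrr.
Qed.

(* [f] plays the role of a vector of the multiplier module of [K], with adjoint [g];
   for nonunital [A] the standard basis of [std_hilbert A] only exists in this sense. *)
Record mvec f g : Prop := {
  mv_car : forall a, C (f a);
  mv_ip : forall a z, C z -> ip K (f a) z = star a ** g z;
  mv_bounded : forall p, SA p -> exists c, 0 <= c /\ forall a, nrm p (f a) <= c * p a
}.

Section OneVector.
Variables (f : A -> ambient K) (g : ambient K -> A).
Hypothesis fg : mvec f g.
Let Cf := mv_car fg.
Let fgE := mv_ip fg.

Lemma mv_ipr a z : C z -> ip K z (f a) = star (g z) ** a.
Proof. by move=> Cz; rewrite -(sh_star hK (Cf a) Cz) fgE // starM starK. Qed.

Lemma mv_adjD z w : C z -> C w -> g (z + w) = g z + g w.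
Proof.
move=> Cz Cw; apply/eqP; rewrite -subr_eq0; apply/eqP/star_smul_eq0 => a.
by rewrite smulBr smul_addr -!fgE ?(sh_ipD hK) ?subrr //; exact: submoduleD.
Qed.

Lemma mv_adjZ (c : R[i]) z : C z -> g (c *: z) = c *: g z.
Proof.
move=> Cz; apply/eqP; rewrite -subr_eq0; apply/eqP/star_smul_eq0 => a.
by rewrite smulBr smul_scaler -!fgE ?(sh_ipZ hK) ?subrr //; exact: submoduleZ.
Qed.

Lemma mv_adjr z a : C z -> g (z <* a) = g z ** a.
Proof.
move=> Cz; apply/eqP; rewrite -subr_eq0; apply/eqP/star_smul_eq0 => b.
by rewrite smulBr smulA -!fgE ?(sh_ipr hK) ?subrr //; exact: submodule_ract.
Qed.

Lemma mv_adjN z : C z -> g (- z) = - g z.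
Proof. by move=> Cz; rewrite -scaleN1r mv_adjZ // scaleN1r. Qed.

Lemma mv_adjB z w : C z -> C w -> g (z - w) = g z - g w.
Proof. by move=> Cz Cw; rewrite mv_adjD ?mv_adjN //; exact: submoduleN. Qed.

Lemma mv_adj0 : g 0 = 0.
Proof. by rewrite -(scale0r (0 : ambient K)) mv_adjZ ?scale0r //; exact: submodule0. Qed.

Lemma mv_adj_sum I (r : seq I) (P : pred I) (G : I -> ambient K) :
  (forall i, P i -> C (G i)) ->
  g (\sum_(i <- r | P i) G i) = \sum_(i <- r | P i) g (G i).
Proof.
move=> CG; suff [] : C (\sum_(i <- r | P i) G i) /\
  g (\sum_(i <- r | P i) G i) = \sum_(i <- r | P i) g (G i) by [].
elim/big_rec2 : _ => [|i y z Pi [Cz <-]]; first by rewrite mv_adj0; split=> //; exact: submodule0.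
by split; [apply: submoduleD => //; exact: CG | rewrite mv_adjD //; exact: CG].
Qed.

Lemma mvD : {morph f : a b / a + b}.
Proof.
move=> a b; apply: ip_sep => [||y Cy]; rewrite ?fgE //; first exact: submoduleD.
by rewrite (ip_addl hK) // !fgE // star_add smul_addl.
Qed.

Lemma mvB : {morph f : a b / a - b}. Proof. exact: morphDB mvD. Qed.

Lemma mvZ (c : R[i]) a : f (c *: a) = c *: f a.
Proof.
apply: ip_sep => [||y Cy]; rewrite ?fgE //; first exact: submoduleZ.
by rewrite (ip_scalel hK) // fgE // star_scale smul_scalel.
Qed.

Lemma mvr a b : f (a ** b) = f a <* b.
Proof.
apply: ip_sep => [||y Cy]; rewrite ?fgE //; first exact: submodule_ract.
by rewrite (ip_ractl hK) // fgE // starM smulA.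
Qed.

Lemma mv_adj_bounded p : SA p -> exists c, 0 <= c /\ forall z, C z -> p (g z) <= c * nrm p z.
Proof.
move=> pS; have [c [c0 hc]] := mv_bounded fg pS; exists c; split=> // z Cz.
have pC := proj1 pS.
have [/eqP ->|b0] := boolP (p (g z) == 0); first by rewrite mulr_ge0 ?nrm_ge0.
have bgt : 0 < p (g z) by rewrite lt0r b0 Cstar_ge0.
rewrite -(ler_pM2r bgt) -expr2 -(Cstar_seminorm_star pC) -fgE //.
apply: (le_trans (cauchy_schwarz hK pS (Cf _) Cz)).
by rewrite mulrAC ler_wpM2r ?nrm_ge0.
Qed.

End OneVector.

Lemma mv_sym f g f' g' : mvec f g -> mvec f' g' -> forall a b,
  star a ** g (f' b) = star (g' (f a)) ** b.
Proof.
move=> fg fg' a b; rewrite -(mv_ip fg); last exact: mv_car fg' _.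
by rewrite (mv_ipr fg') //; exact: mv_car fg _.
Qed.

Lemma mv_orth_sym f g f' g' : mvec f g -> mvec f' g' ->
  (forall b, g (f' b) = 0) -> forall a, g' (f a) = 0.
Proof.
move=> fg fg' h a; rewrite -[LHS]starK -[RHS]starK star0; congr star.
rewrite -[LHS]starK; apply/eqP; rewrite (inv_eq (@starK R A)) star0; apply/eqP.
apply: star_smul_eq0 => y; have := mv_sym fg fg' a y.
rewrite h smul0r => /esym/(congr1 star); rewrite starM starK star0.
exact.
Qed.

(** The inner product of two multiplier vectors: a multiplier in place of an element of [A]. *)
Lemma mvec_gram f g f' g' : mvec f g -> mvec f' g' ->
  exists T : mult A, op T =1 g \o f' /\ adj T =1 g' \o f.
Proof.
move=> fg fg'.
have adjP x y : star (g (f' x)) ** y = star x ** g' (f y).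
  by rewrite (mv_sym fg' fg).
have bdd p : SA p -> exists c, 0 <= c /\ forall x, p (g (f' x)) <= c * p x.
  move=> pS; have [c [c0 hc]] := mv_adj_bounded fg pS.
  have [d [d0 hd]] := mv_bounded fg' pS.
  exists (c * d); split=> [|x]; first exact: mulr_ge0.
  by rewrite (le_trans (hc _ (mv_car fg' _))) // -mulrA ler_wpM2l.
by exists (Mult 0 adjP bdd).
Qed.

Lemma mvec_mult f g (T : mult A) : mvec f g -> mvec (f \o op T) (adj T \o g).
Proof.
move=> fg; split=> [a|a z Cz|p pS] /=; first exact: mv_car fg _.
  by rewrite (mv_ip fg) // op_adj.
have [c [c0 hc]] := mv_bounded fg pS; have [d [d0 hd]] := op_bounded T pS.
exists (c * d); split=> [|x]; first exact: mulr_ge0.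
by rewrite (le_trans (hc _)) // -mulrA ler_wpM2l.
Qed.

Lemma mvecD f g f' g' : mvec f g -> mvec f' g' ->
  mvec (fun a => f a + f' a) (fun z => g z + g' z).
Proof.
move=> fg fg'; have [Cf Cf'] := (mv_car fg, mv_car fg').
split=> [a|a z Cz|p pS]; first exact: submoduleD.
  by rewrite (ip_addl hK) // (mv_ip fg) // (mv_ip fg') // smul_addr.
have [c [c0 hc]] := mv_bounded fg pS; have [d [d0 hd]] := mv_bounded fg' pS.
exists (c + d); split=> [|x]; first exact: addr_ge0.
by rewrite (le_trans (nrmD hK pS _ _)) // mulrDl lerD.
Qed.

Lemma mvecZ f g (r : R) : mvec f g ->
  mvec (fun a => (r%:C)%C *: f a) (fun z => (r%:C)%C *: g z).
Proof.
move=> fg; split=> [a|a z Cz|p pS].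
- by apply: submoduleZ => //; exact: mv_car fg _.
- rewrite (ip_scalel hK) //; last exact: mv_car fg _.
  by rewrite (mv_ip fg) // conjc_real smul_scaler.
have [c [c0 hc]] := mv_bounded fg pS; exists (`|r| * c); split=> [|x]; first exact: mulr_ge0.
by rewrite (nrmZ hK pS) ?normc_real -?mulrA ?ler_wpM2l //; exact: mv_car fg _.
Qed.

Lemma mvec0 : mvec (fun=> 0) (fun=> 0).
Proof.
split=> [a|a z Cz|p pS]; first exact: submodule0.
  by rewrite (ip_0l hK) // smul0r.
by exists 0; split=> // a; rewrite (nrm0 hK) // mul0r.
Qed.

Definition vec : Type := (A -> ambient K) * (ambient K -> A).
Definition is_vec (v : vec) := mvec v.1 v.2.

Section Orthonormal.
Variables (F : nat -> vec) (n : nat).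
Hypothesis Fv : forall i, (i < n)%N -> is_vec (F i).
Hypothesis Fo : forall i j, (i < n)%N -> (j < n)%N ->
  forall a, (F i).2 ((F j).1 a) = if i == j then a else 0.

Definition comb (c : nat -> A) : ambient K := \sum_(i < n) (F i).1 (c i).
Definition oproj z : ambient K := comb (fun i => (F i).2 z).

Lemma comb_car c : C (comb c).
Proof. by apply: (submodule_sum hD) => i _; exact: mv_car (Fv (ltn_ord i)) _. Qed.

Lemma adj_comb c i : (i < n)%N -> (F i).2 (comb c) = c i.
Proof.
move=> ni; rewrite (mv_adj_sum (Fv ni)) => [|j _]; last exact: mv_car (Fv (ltn_ord j)) _.
rewrite (bigD1 (Ordinal ni)) //= Fo // eqxx big1 ?addr0 // => j ij.
by rewrite Fo // ifN // eq_sym.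
Qed.

Lemma ip_comb c z : C z -> ip K (comb c) z = \sum_(i < n) star (c i) ** (F i).2 z.
Proof.
move=> Cz; rewrite (ip_suml hK) // => [|i _]; last exact: mv_car (Fv (ltn_ord i)) _.
by apply: eq_bigr => i _; rewrite (mv_ip (Fv (ltn_ord i))).
Qed.

Lemma ip_sub_proj z w : C z -> C w ->
  ip K (z - oproj z) (w - oproj w) = ip K z w - \sum_(i < n) star ((F i).2 z) ** (F i).2 w.
Proof.
move=> Cz Cw; have [Cpz Cpw] : C (oproj z) /\ C (oproj w) by split; exact: comb_car.
have Cwp := submoduleB hD Cw Cpw.
rewrite (ip_subl hK) // [ip K (oproj z) _]ip_comb // big1 ?subr0; last first.
  by move=> i _; rewrite (mv_adjB (Fv (ltn_ord i))) // adj_comb // subrr smul0r.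
rewrite (ip_subr hK) //; congr (_ - _); rewrite -(sh_star hK) // ip_comb // star_sum.
by apply: eq_bigr => i _; rewrite starM starK.
Qed.

(** Pythagoras: [z - comb c] is the sum of the orthogonal vectors [z - P z] and [P z - comb c], and
    dropping a positive summand of the inner product does not increase [p]. Density then follows
    from any approximation by combinations. *)
Lemma proj_best p z c : SA p -> C z -> nrm p (z - oproj z) <= nrm p (z - comb c).
Proof.
move=> pS Cz; have [Cpz Cc] : C (oproj z) /\ C (comb c) by split; exact: comb_car.
have C1 := submoduleB hD Cz Cpz; have C2 := submoduleB hD Cz Cc.
have C3 := submoduleB hD Cpz Cc.
rewrite (nrm_le pS) ?nrm_ge0 // nrm_sq //.
have orth : ip K (oproj z - comb c) (z - oproj z) = 0.
  have -> : oproj z - comb c = comb (fun i => (F i).2 z - c i).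
    rewrite /oproj /comb -sumrB; apply: eq_bigr => i _.
    by rewrite (mvB (Fv (ltn_ord i))).
  rewrite ip_comb // big1 // => i _.
  by rewrite (mv_adjB (Fv (ltn_ord i))) // adj_comb // subrr smul0r.
have -> : z - comb c = (z - oproj z) + (oproj z - comb c) by rewrite subrKA.
rewrite (ip_addl hK C1 C3 (submoduleD hD C1 C3)) (sh_ipD hK C1 C1 C3) (sh_ipD hK C3 C1 C3).
rewrite orth -(sh_star hK C3 C1) orth star0 addr0 add0r.
by apply: (ppos_le_D pS); exact: sh_pos.
Qed.

Lemma projD_le p z w : SA p -> C z -> C w ->
  nrm p (z + w - oproj (z + w)) <= nrm p (z - oproj z) + nrm p (w - oproj w).
Proof.
move=> pS Cz Cw; have [Cpz Cpw] : C (oproj z) /\ C (oproj w) by split; exact: comb_car.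
have Czw := submoduleD hD Cz Cw.
apply: le_trans (nrmD hK pS (submoduleB hD Cz Cpz) (submoduleB hD Cw Cpw)).
rewrite addrACA -opprD /oproj /comb -big_split /=.
under [X in _ <= nrm p (_ - X)]eq_bigr do rewrite -(mvD (Fv (ltn_ord _))).
exact: (proj_best (fun i => (F i).2 z + (F i).2 w)).
Qed.

Lemma proj_ract z a : C z -> (z <* a) - oproj (z <* a) = (z - oproj z) <* a.
Proof.
move=> Cz; rewrite ract_subl; congr (_ - _).
rewrite /oproj /comb (morphD_sum (fun x y => ract_addl x y a)); apply: eq_bigr => i _.
by rewrite (mv_adjr (Fv (ltn_ord i))) // (mvr (Fv (ltn_ord i))).
Qed.

Lemma projZ (c : R[i]) z : C z -> c *: z - oproj (c *: z) = c *: (z - oproj z).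
Proof.
move=> Cz; rewrite scalerBr; congr (_ - _).
rewrite /oproj /comb scaler_sumr; apply: eq_bigr => i _.
by rewrite (mv_adjZ (Fv (ltn_ord i))) // (mvZ (Fv (ltn_ord i))).
Qed.

Lemma proj_le p z : SA p -> C z -> nrm p (z - oproj z) <= nrm p z.
Proof.
move=> pS Cz; have := proj_best (fun=> 0) pS Cz.
by rewrite [comb _]big1 ?subr0 // => i _; rewrite (morphD0 (mvD (Fv (ltn_ord i)))).
Qed.

End Orthonormal.

Lemma mvec_proj (F : nat -> vec) n t tg : (forall i, (i < n)%N -> is_vec (F i)) ->
  mvec t tg -> exists g, mvec (fun a => oproj F n (t a)) g.
Proof.
move=> Fv tv; elim: n Fv => [|n IH] Fv.
  exists (fun=> 0); rewrite [X in mvec X](_ : _ = fun=> 0); first exact: mvec0.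
  by apply/funext => a; rewrite /oproj /comb big_ord0.
have [i /ltnW/Fv//|g hg] := IH.
have vn := Fv n (leqnn _); have [T [T1 _]] := mvec_gram vn tv.
exists (fun z => g z + (adj T \o (F n).2) z).
rewrite [X in mvec X](_ : _ = fun a => oproj F n (t a) + ((F n).1 \o op T) a).
  by apply: mvecD => //; exact: mvec_mult.
by apply/funext => a; rewrite /oproj /comb big_ord_recr /= T1.
Qed.

(* The new vector is the normalization [f = (t' + eps e) (t'* t' + eps^2)^(-1/2)], where
   [t'] is the component of [t] orthogonal to the previous vectors; then
   [t' = f f* t' - eps (e - f f* e)]. *)
Lemma gs_step (F : nat -> vec) n t tg e eg (eps : R) :
  (forall i, (i < n)%N -> is_vec (F i)) ->
  (forall i j, (i < n)%N -> (j < n)%N ->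
    forall a, (F i).2 ((F j).1 a) = if i == j then a else 0) ->
  mvec t tg -> mvec e eg -> (forall a, eg (e a) = a) -> (forall a, eg (t a) = 0) ->
  (forall i, (i < n)%N -> forall a, eg ((F i).1 a) = 0) -> 0 < eps ->
  exists v : vec, [/\ is_vec v, forall a, v.2 (v.1 a) = a,
    forall i, (i < n)%N -> forall a, (F i).2 (v.1 a) = 0,
    forall D : set (ambient K), submodule D -> (forall a, D (t a)) ->
      (forall i, (i < n)%N -> forall a, D ((F i).1 a)) -> (forall a, D (e a)) ->
      forall a, D (v.1 a) &
    forall p, SA p -> forall a,
      nrm p (t a - (oproj F n (t a) + v.1 (v.2 (t a)))) <= eps * p a].
Proof.
move=> Fv Fo tv ev ee et eF eps0.
have Ct a : C (t a) := mv_car tv a.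
have Ce a : C (e a) := mv_car ev a.
have [pg pv] := mvec_proj Fv tv.
pose tp a := t a - oproj F n (t a); pose tpg z := tg z + ((-1)%:C)%C *: pg z.
have tpv : mvec tp tpg.
  rewrite [tp](_ : _ = fun a => t a + ((-1)%:C)%C *: oproj F n (t a)).
    by apply: mvecD => //; exact: mvecZ.
  by apply/funext => a; rewrite rmorphN rmorph1 scaleN1r.
have Ctp a : C (tp a) := mv_car tpv a.
have Ftp i a : (i < n)%N -> (F i).2 (tp a) = 0.
  move=> ni; rewrite /tp (mv_adjB (Fv i ni)) //; last exact: comb_car.
  by rewrite [(F i).2 (oproj _ _ _)](adj_comb Fv Fo) // subrr.
have etp a : eg (tp a) = 0.
  rewrite /tp (mv_adjB ev) ?et //; last exact: comb_car.
  rewrite /oproj /comb (mv_adj_sum ev) => [|i _]; last exact: mv_car (Fv i (ltn_ord i)) _.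
  by rewrite big1 ?subr0 // => i _; rewrite eF.
have tpe a : tpg (e a) = 0 by exact: (mv_orth_sym ev tpv etp).
have [h0 [h1 h2]] := mvec_gram tpv tpv.
(* The scalar coordinate of [h0] is unspecified; 0 makes [h] self-adjoint in that coordinate too. *)
pose h : mult A := Mult 0 (op_adj h0) (op_bounded h0).
have sh : mult_star h = h by apply: multP => [|x|x] /=; rewrite ?conjc0 // h1 h2.
have hp p : SA p -> pos (@mult_star R A) (opnorm p) h.
  move=> pS; apply: (mpos_criterion pS sh) => x /=; rewrite h1 /= -(mv_ip tpv) //.
  exact: sh_pos.
have [k [k1 k2 k3]] := mult_invsqrt sh hp (exprn_gt0 2 eps0).
pose q := ((eps ^+ 2)%:C)%C.
pose T a := tp a + (eps%:C)%C *: e a; pose Tg z := tpg z + (eps%:C)%C *: eg z.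
have Tv : mvec T Tg by apply: mvecD => //; exact: mvecZ.
have fv := mvec_mult k Tv.
pose f := T \o op k; pose g := adj k \o Tg.
(* The cross terms vanish because [tp] and [e] are orthogonal. *)
have TgT a : Tg (T a) = op h a + q *: a.
  have Cee : C ((eps%:C)%C *: e a) by apply: submoduleZ => //; exact: Ce.
  rewrite /Tg /T (mv_adjD tpv) // (mv_adjD ev) // (mv_adjZ tpv) // (mv_adjZ ev) //.
  rewrite tpe etp ee scaler0 addr0 add0r scalerA -rmorphM -expr2.
  by rewrite /= h1.
have gf a : g (f a) = a.
  rewrite /g /f /= TgT k1 -[RHS]k3; congr (op k _).
  by rewrite [RHS]opD opZ k2.
have gT a : g (T a) = op k (op h a + q *: a) by rewrite /g /= TgT k1.
have fT a : f (g (T a)) = T a by rewrite gT /f /= k3.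
have Ff i a : (i < n)%N -> (F i).2 (f a) = 0.
  move=> ni; rewrite /f /= /T (mv_adjD (Fv i ni)) //; last by apply: submoduleZ => //; exact: Ce.
  rewrite Ftp // add0r (mv_adjZ (Fv i ni)) //.
  by rewrite (mv_orth_sym ev (Fv i ni)) ?scaler0 //; exact: eF.
have gB z w : C z -> C w -> g (z - w) = g z - g w by exact: (mv_adjB fv).
have gZ (c : R[i]) z : C z -> g (c *: z) = c *: g z by exact: (mv_adjZ fv).
have fB a b : f (a - b) = f a - f b by exact: (mvB fv).
have fZ (c : R[i]) a : f (c *: a) = c *: f a by exact: (mvZ fv).
exists (f, g); split=> //=.
- by move=> i ni a; exact: Ff.
- move=> D sD Dt DF De a; rewrite /f /= /T; apply: submoduleD => //.
    by apply: (submoduleB sD) => //; apply: (submodule_sum sD) => i _; exact: DF.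
  exact: submoduleZ.
- move=> p pS a.
  have gtp : g (t a) = g (tp a).
    have Cp : C (oproj F n (t a)) by exact: comb_car.
    rewrite /tp gB // [X in _ - X](_ : _ = 0) ?subr0 //.
    rewrite /oproj /comb /g (mv_adj_sum fv) => [|i _]; last exact: mv_car (Fv i (ltn_ord i)) _.
    rewrite big1 // => i _; apply: (mv_orth_sym (Fv i (ltn_ord i)) fv) => b.
    exact: Ff.
  have tpE : tp a = T a - (eps%:C)%C *: e a by rewrite /T addrK.
  have Cee : C ((eps%:C)%C *: e a) by apply: submoduleZ => //; exact: Ce.
  have Cfe : C (e a - f (g (e a))) by apply: (submoduleB hD); [exact: Ce | exact: mv_car fv _].
  have -> : t a - (oproj F n (t a) + f (g (t a))) = - ((eps%:C)%C *: (e a - f (g (e a)))).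
    rewrite opprD addrA -/(tp a) gtp tpE gB //; last exact: mv_car Tv _.
    rewrite fB fT gZ // fZ scalerBr !opprB.
    by rewrite addrC addrA subrK.
  rewrite (nrmN hK) //; last exact: submoduleZ.
  rewrite (nrmZ hK pS) // normc_real gtr0_norm // ler_wpM2l ?(ltW eps0) //.
  have ne : nrm p (e a) <= p a.
    rewrite (nrm_le pS) ?(Cstar_ge0 (proj1 pS)) // (mv_ip ev) // ee.
    by rewrite (Cstar_seminorm_star (proj1 pS)).
  apply: le_trans ne.
  (* [e - f f* e] is the residual of [e] for the one-element orthonormal family [f], so its norm is
     at most that of [e]. *)
  have := @proj_le (fun=> (f, g)) 1 _ _ p (e a) pS (Ce a).
  rewrite /oproj /comb big_ord1 /=; apply => // i j.
  by rewrite !ltnS !leqn0 => /eqP-> /eqP-> b; rewrite gf.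
Qed.

(** The filtration [D] keeps track of the basis maps already used: whatever lies in [D m] is
    orthogonal to [e m]. The state of the recursion is the list of vectors so far with a level [m]
    containing their ranges; a step raises the level to [M] so as to include the target, uses [e M],
    and moves to level [M + 1]. *)
Lemma gs_sequence (t e : nat -> vec) (D : nat -> set (ambient K)) (eps : nat -> R) :
  (forall n, is_vec (t n)) -> (forall m, is_vec (e m)) ->
  (forall m a, (e m).2 ((e m).1 a) = a) ->
  (forall m, submodule (D m)) -> (forall m m', (m <= m')%N -> D m `<=` D m') ->
  (forall n, exists m, forall a, D m ((t n).1 a)) ->
  (forall m a, D m.+1 ((e m).1 a)) -> (forall m z, D m z -> (e m).2 z = 0) ->
  (forall n, 0 < eps n) ->
  exists F : nat -> vec, [/\ forall i, is_vec (F i),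
    forall i j a, (F i).2 ((F j).1 a) = if i == j then a else 0 &
    forall n p, SA p -> forall a,
      nrm p ((t n).1 a - oproj F n.+1 ((t n).1 a)) <= eps n * p a].
Proof.
move=> tv ev ee sD Dm tD eD De eps0.
pose v0 : vec := (fun=> 0, fun=> 0).
pose Inv n (s : seq vec * nat) := [/\ size s.1 = n,
  forall i, (i < n)%N -> is_vec (nth v0 s.1 i),
  forall i j, (i < n)%N -> (j < n)%N ->
    forall a, (nth v0 s.1 i).2 ((nth v0 s.1 j).1 a) = if i == j then a else 0 &
  forall i, (i < n)%N -> forall a, D s.2 ((nth v0 s.1 i).1 a)].
(* The invariant is a premise inside the existential, so that [choice] yields a function on all
   states. *)
have step (x : nat * (seq vec * nat)) : exists y : seq vec * nat, Inv x.1 x.2 ->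
    [/\ Inv x.1.+1 y, forall i, (i < x.1)%N -> nth v0 y.1 i = nth v0 x.2.1 i &
     forall p, SA p -> forall a, nrm p ((t x.1).1 a - (oproj (nth v0 x.2.1) x.1 ((t x.1).1 a) +
       (nth v0 y.1 x.1).1 ((nth v0 y.1 x.1).2 ((t x.1).1 a)))) <= eps x.1 * p a].
  case: x => n [s m] /=.
  have [[sn sv so sDm]|nI] := pselect (Inv n (s, m)); last by exists (s, m).
  have [m' tm'] := tD n; pose M := maxn m m'.
  have tM a : D M ((t n).1 a) by apply: Dm (tm' a); exact: leq_maxr.
  have sM i : (i < n)%N -> forall a, D M ((nth v0 s i).1 a).
    by move=> ni a; apply: Dm (sDm i ni a); exact: leq_maxl.
  have [v [vv v1 v2 v3 v4]] := gs_step sv so (tv n) (ev M) (ee M)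
    (fun a => De _ _ (tM a)) (fun i ni a => De _ _ (sM i ni a)) (eps0 n).
  exists (rcons s v, M.+1) => _; split=> /=.
  - split=> /=; rewrite ?size_rcons ?sn //.
    + move=> i; rewrite ltnS leq_eqVlt nth_rcons sn => /orP[/eqP ->|ni].
        by rewrite ltnn eqxx.
      by rewrite ni; exact: sv.
    + move=> i j; rewrite !ltnS !nth_rcons sn (leq_eqVlt i) (leq_eqVlt j).
      move=> /orP[/eqP ->|ni] /orP[/eqP ->|nj] a.
      * by rewrite ltnn !eqxx.
      * rewrite ltnn nj eqxx gtn_eqF //.
        by apply: (mv_orth_sym (sv j nj) vv) => b; exact: v2.
      * by rewrite ltnn ni eqxx ltn_eqF // v2.
      * by rewrite ni nj so.
    + move=> i; rewrite ltnS leq_eqVlt nth_rcons sn => /orP[/eqP ->|ni] a.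
        rewrite ltnn eqxx; apply: v3 => [|b|j nj b|b]; [exact: sD | | | exact: eD].
          exact: Dm (tM b).
        exact: Dm (sM j nj b).
      by rewrite ni; apply: Dm (sM i ni a).
  - by move=> i ni; rewrite nth_rcons sn ni.
  - by move=> p pS a; rewrite nth_rcons sn ltnn eqxx; exact: v4.
have [next hnext] := choice step.
pose S := fix S n := if n is k.+1 then next (k, S k) else ([::], 0%N).
have IS n : Inv n (S n).
  elim: n => [|n IH]; first by split=> // i; rewrite ltn0.
  by have [] := hnext (n, S n) IH.
pose F n := nth v0 (S n.+1).1 n.
have FS n i : (i < n)%N -> nth v0 (S n).1 i = F i.
  elim: n => // n IH; rewrite ltnS leq_eqVlt => /orP[/eqP -> //|ni].
  by have [_ h _] := hnext (n, S n) (IS n); rewrite [LHS]h //= IH.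
exists F; split=> [i|i j a|n p pS a].
- by have [_ h _ _] := IS i.+1; exact: h.
- have [_ _ h _] := IS (maxn i j).+1.
  have [li lj] : (i < (maxn i j).+1)%N /\ (j < (maxn i j).+1)%N.
    by rewrite !ltnS leq_maxl leq_maxr.
  by rewrite -(FS _ _ li) -(FS _ _ lj) h.
- have [_ _ h] := hnext (n, S n) (IS n); have := h p pS a.
  rewrite /oproj /comb big_ord_recr /=.
  under eq_bigr do rewrite (FS n _ (ltn_ord _)).
  by [].
Qed.

End GramSchmidt.

(** * The unitary defined by an orthonormal basis *)

Section Basis.
Variables (R : realType) (A : locallyCstarType R) (K : formModule A).
Local Notation SA := (@cont_Cstar_seminorms R A).
Local Notation HA := (std_hilbert A).
Hypothesis hK : semi_hilbert K.
Hypothesis K_definite : forall x, carrier K x -> ip K x x = 0 -> x = 0.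
Local Notation C := (carrier K).
Let hD := sh_sub hK.
Implicit Types (a b : A) (z w : ambient K) (p : A -> R).

(** With a unit one would take [a = 1]; here [a = w = <z, z>] serves. The hypothesis reads
    [p (w^3) <= c^2 p(w)^2], and [p(w)^4 = p (w^4) <= p (w^3) p(w)], whence [p w <= c^2]. *)
Lemma nrm_le_action p z c : SA p -> C z -> 0 <= c ->
  (forall a, nrm p (z <* a) <= c * p a) -> nrm p z <= c.
Proof.
move=> pS Cz c0 h; have pC := proj1 pS; rewrite (nrm_le pS) //.
set w := ip K z z.
have [/eqP ->|w0] := boolP (p w == 0); first exact: exprn_ge0.
have wgt : 0 < p w by rewrite lt0r w0 Cstar_ge0.
have sw : star w = w by rewrite /w (sh_star hK).
have w2 : p (w ** w) = p w ^+ 2 by rewrite -{1}sw (Cstar_seminorm_star pC).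
have := h w; rewrite (nrm_le pS) ?mulr_ge0 ?(ltW wgt) //.
rewrite (ip_ractl hK) ?(sh_ipr hK) //; last exact: submodule_ract.
rewrite -/w sw smulA => h3.
have h4 : p w ^+ 4 <= p (w ** w ** w) * p w.
  apply: le_trans (Cstar_seminormM pC _ _); rewrite -(smulA (w ** w)).
  have sww : star (w ** w) = w ** w by rewrite starM sw.
  by rewrite -{1}sww (Cstar_seminorm_star pC) w2 -exprM.
have : p w ^+ 3 * p w <= (c * p w) ^+ 2 * p w.
  by rewrite -exprSr (le_trans h4) // ler_wpM2r // ltW.
by rewrite ler_pM2r // exprMn exprSr [p w ^+ 2 * _]mulrC ler_pM2r // exprn_gt0.
Qed.

Variable F : nat -> vec K.
Hypothesis Fv : forall i, is_vec (F i).
Hypothesis Fo : forall i j a, (F i).2 ((F j).1 a) = if i == j then a else 0.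

Local Notation P := (oproj F).
(** One index per error is enough, because the distance to the span decreases with [N] by
    [proj_mono]. *)
Definition dense_at z := forall p, SA p -> forall d, 0 < d ->
  exists N, nrm p (z - P N z) <= d.

Let Fvn n i : (i < n)%N -> is_vec (F i). Proof. by []. Qed.
Let Fon n i j : (i < n)%N -> (j < n)%N ->
  forall a, (F i).2 ((F j).1 a) = if i == j then a else 0.
Proof. by []. Qed.

Lemma CP n z : C (P n z). Proof. exact: (comb_car hK (@Fvn n)). Qed.

Lemma proj_mono p m n z : SA p -> C z -> (m <= n)%N ->
  nrm p (z - P n z) <= nrm p (z - P m z).
Proof.
move=> pS Cz mn.
have -> : P m z = comb F n (fun i => if (i < m)%N then (F i).2 z else 0).
  rewrite /oproj /comb (big_ord_widen n (fun i => (F i).1 ((F i).2 z)) mn) big_mkcond.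
  apply: eq_bigr => i _; case: ifP => // _.
  by rewrite (morphD0 (mvD hK K_definite (Fv i))).
exact: (proj_best hK K_definite (@Fvn n) (@Fon n)).
Qed.

Lemma dense_approx z : C z ->
  (forall p, SA p -> forall d, 0 < d -> exists w, [/\ C w, dense_at w & nrm p (z - w) <= d]) ->
  dense_at z.
Proof.
move=> Cz h p pS d d0; have d2 : 0 < d / 2 by rewrite divr_gt0.
have [w [Cw dw zw]] := h p pS _ d2; have [N hN] := dw p pS _ d2.
exists N; have Czw := submoduleB hD Cz Cw.
rewrite -{1 2}(subrKC w z).
apply: (le_trans (projD_le hK K_definite (@Fvn N) (@Fon N) pS Cw Czw)).
rewrite (splitr d) lerD //; apply: le_trans zw.
exact: (proj_le hK K_definite (@Fvn N) (@Fon N)).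
Qed.

Lemma denseD z w : C z -> C w -> dense_at z -> dense_at w -> dense_at (z + w).
Proof.
move=> Cz Cw dz dw p pS d d0; have d2 : 0 < d / 2 by rewrite divr_gt0.
have [N hN] := dz p pS _ d2; have [N' hN'] := dw p pS _ d2.
exists (maxn N N').
apply: (le_trans (projD_le hK K_definite (@Fvn _) (@Fon _) pS Cz Cw)).
rewrite (splitr d); apply: lerD; [apply: le_trans hN | apply: le_trans hN'].
  by apply: proj_mono => //; exact: leq_maxl.
by apply: proj_mono => //; exact: leq_maxr.
Qed.

Lemma denseZ (c : R[i]) z : C z -> dense_at z -> dense_at (c *: z).
Proof.
move=> Cz dz p pS d d0.
have c0 : 0 <= Normc.normc c by case: (c) => ? ?; rewrite sqrtr_ge0.
have c1 : 0 < Normc.normc c + 1 by rewrite ltr_wpDl.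
have [N hN] := dz p pS _ (divr_gt0 d0 c1); exists N.
rewrite (projZ hK K_definite (@Fvn N)) // (nrmZ hK pS); last exact: (submoduleB hD Cz (CP _ _)).
rewrite ler_pdivlMr // mulrC in hN; apply: le_trans hN.
by rewrite ler_wpM2r ?nrm_ge0 // lerDl.
Qed.

Lemma dense_ract z a : C z -> dense_at z -> dense_at (z <* a).
Proof.
move=> Cz dz p pS d d0.
have c0 := Cstar_ge0 (proj1 pS) a.
have c1 : 0 < p a + 1 by rewrite ltr_wpDl.
have [N hN] := dz p pS _ (divr_gt0 d0 c1); exists N.
rewrite (proj_ract hK K_definite (@Fvn N)) // (le_trans (nrm_ract hK pS _ _)) //.
  exact: (submoduleB hD Cz (CP _ _)).
rewrite ler_pdivlMr // in hN; apply: le_trans hN.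
by rewrite ler_wpM2l ?nrm_ge0 // lerDl.
Qed.

Definition coef z : nat -> A := fun n => (F n).2 z.

Hypothesis Fdense : forall z, C z -> dense_at z.

(** Polarized Parseval: by [ip_sub_proj] the error of the [n]-th partial sum is the inner product of
    the two residuals, to which Cauchy-Schwarz applies. *)
Lemma coef_win_cvg z w : C z -> C w ->
  pcvg (fun n => win 0 n (coef z) (coef w)) (ip K z w).
Proof.
move=> Cz Cw p pS e e0; have s0 : 0 < Num.sqrt e by rewrite sqrtr_gt0.
have [N hN] := Fdense Cz pS s0; have [N' hN'] := Fdense Cw pS s0.
exists (maxn N N') => n; rewrite geq_max => /andP[n1 n2].
rewrite (CstarBC (proj1 pS)) /win big_mkord -(ip_sub_proj hK (@Fvn n) (@Fon n)) //.
have [C1 C2] := (submoduleB hD Cz (CP n z), submoduleB hD Cw (CP n w)).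
apply: (le_trans (cauchy_schwarz hK pS C1 C2)).
have -> : e = Num.sqrt e * Num.sqrt e by rewrite -expr2 sqr_sqrtr // ltW.
by apply: ler_pM; rewrite ?nrm_ge0 //; [apply: le_trans hN | apply: le_trans hN'];
  exact: proj_mono.
Qed.

Lemma coef_car z : C z -> carrier HA (coef z).
Proof.
move=> Cz; exists (ip K z z); apply/cvg_pcvg; exact: (coef_win_cvg Cz Cz).
Qed.

Lemma coef_ip z w : C z -> C w -> ip HA (coef z) (coef w) = ip K z w.
Proof. by move=> Cz Cw; apply: ip_winE; exact: coef_win_cvg. Qed.

Lemma coefB z w : C z -> C w -> coef (z - w) = coef z - coef w.
Proof. by move=> Cz Cw; apply/funext => n; rewrite /coef (mv_adjB hK (Fv n)). Qed.

Lemma coef_inj z w : C z -> C w -> coef z = coef w -> z = w.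
Proof.
move=> Cz Cw zw; have Cd := submoduleB hD Cz Cw.
apply/eqP; rewrite -subr_eq0; apply/eqP/K_definite => //.
rewrite -coef_ip // coefB // zw subrr.
by apply: (ip_0r (std_semi A)); exact: submodule0 (std_submodule A).
Qed.

Hypothesis K_complete : forall u : nat -> ambient K, (forall n, C (u n)) ->
  (forall p, SA p -> forall e, 0 < e -> exists N, forall m n, (N <= m)%N -> (N <= n)%N ->
     nrm p (u m - u n) <= e) ->
  exists2 z, C z & forall p, SA p -> forall e, 0 < e -> exists N, forall n, (N <= n)%N ->
     nrm p (u n - z) <= e.

(** Riesz-Fischer: differences of the partial sums have the windows of [x] as inner squares, so
    these sums are Cauchy. The bounded map [(F n).2] takes the value [x n] on every partial sum
    beyond [n], hence also at the limit. *)
Lemma coef_surj (x : nat -> A) : carrier HA x -> exists2 z, C z & coef z = x.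
Proof.
move=> Cx; pose u n := comb F n x.
have Cu n : C (u n) by exact: (comb_car hK (@Fvn n)).
have uB m n : (n <= m)%N -> ip K (u m - u n) (u m - u n) = win n m x x.
  move=> nm; pose c i := if (i < n)%N then 0 else x i.
  have -> : u m - u n = comb F m c.
    apply/eqP; rewrite subr_eq; apply/eqP.
    rewrite /u /comb (big_ord_widen m (fun i => (F i).1 (x i)) nm) [X in _ + X]big_mkcond -big_split /=.
    apply: eq_bigr => i _; rewrite /c; case: ifP => _; last by rewrite addr0.
    by rewrite (morphD0 (mvD hK K_definite (Fv i))) add0r.
  rewrite (ip_comb hK (@Fvn m)); last exact: (comb_car hK (@Fvn m)).
  under eq_bigr do rewrite (adj_comb hK (@Fvn m) (@Fon m)) //.
  rewrite -(big_mkord xpredT (fun i => star (c i) ** c i)) (big_cat_nat (leq0n n) nm) /=.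
  rewrite big_nat big1 => [|i /andP[_ i_n]]; last by rewrite /c i_n smul0r.
  by rewrite add0r; apply: eq_big_nat => i /andP[ni _]; rewrite /c ltnNge ni.
have cauchy p : SA p -> forall e, 0 < e -> exists N, forall m n, (N <= m)%N -> (N <= n)%N ->
    nrm p (u m - u n) <= e.
  move=> pS e e0; have /car_tail/(_ p pS e e0)[N hN] := Cx.
  exists N => m n Nm Nn; wlog nm : m n Nm Nn / (n <= m)%N.
    by move=> h; have [/h|/ltnW/h] := leqP n m; [apply | rewrite (nrmBC hK) //; apply].
  by rewrite (nrm_le pS) ?(ltW e0) // uB // -(@wn_le R A) ?(ltW e0) // hN.
have [z Cz uz] := K_complete Cu cauchy.
exists z => //; apply/funext => n; apply/eqP; rewrite -subr_eq0; apply/eqP.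
apply: seminorms_separate => p pS; apply/eqP; rewrite eq_le (Cstar_ge0 (proj1 pS)) andbT.
apply/ler_addgt0Pr => e e0; rewrite add0r.
have [c [c0 hc]] := mv_adj_bounded hK (Fv n) pS.
have c1 : 0 < c + 1 by rewrite ltr_wpDl.
have [N hN] := uz p pS _ (divr_gt0 e0 c1).
have Nn : (n < maxn N n.+1)%N by exact: leq_maxr.
rewrite (CstarBC (proj1 pS)) -(adj_comb hK (@Fvn (maxn N n.+1)) (@Fon _) x Nn) /coef.
rewrite -(mv_adjB hK (Fv n) (Cu _) Cz); apply: le_trans (hc _ (submoduleB hD (Cu _) Cz)) _.
have := hN _ (leq_maxl N n.+1); rewrite ler_pdivlMr // mulrC; apply: le_trans.
by rewrite ler_wpM2r ?nrm_ge0 // lerDl.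
Qed.

(** [U] is a chosen inverse of [coef], with value 0 off the carrier. Since [coef] is injective and
    preserves inner products, [U] inherits its linearity and has it as adjoint. *)
Lemma std_hilbert_equiv : HA ~=u K.
Proof.
have [U hU] : exists U : (nat -> A) -> ambient K,
    forall x, carrier HA x -> C (U x) /\ coef (U x) = x.
  suff /choice[U hU] : forall x : nat -> A, exists z, carrier HA x -> C z /\ coef z = x by exists U.
  move=> x; have [Cx|nCx] := pselect (carrier HA x); last by exists 0.
  by have [z Cz zx] := coef_surj Cx; exists z.
have UC x : carrier HA x -> C (U x) by move=> /hU[].
have VU x : carrier HA x -> coef (U x) = x by move=> /hU[].
have sH := std_submodule A.
have adjP : @is_adjoint R A HA K U coef.
  split=> [y Cy|x y Cx Cy]; first exact: coef_car.
  by rewrite -coef_ip ?VU //; exact: UC.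
have uniq x z : carrier HA x -> C z -> coef z = x -> U x = z.
  by move=> Cx Cz zx; apply: coef_inj; rewrite ?VU //; exact: UC.
exists U; split; first split; last 2 first.
- by exists coef.
- by exists coef; split=> // y Cy; apply: uniq => //; exact: coef_car.
split=> //.
- move=> x y Cx Cy; apply: uniq; [exact: submoduleD | by apply: submoduleD => //; exact: UC |].
  by apply/funext => n; rewrite -{2}(VU x Cx) -{2}(VU y Cy) /coef (mv_adjD hK (Fv n)) //; exact: UC.
- move=> c x Cx; apply: uniq; [exact: submoduleZ | by apply: submoduleZ => //; exact: UC |].
  by apply/funext => n; rewrite -{2}(VU x Cx) /coef (mv_adjZ hK (Fv n)) //; exact: UC.
- move=> x a Cx; apply: uniq; [exact: submodule_ract | by apply: submodule_ract => //; exact: UC |].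
  by apply/funext => n; rewrite -{2}(VU x Cx) /coef (mv_adjr hK (Fv n)) //; exact: UC.
Qed.

End Basis.

(** * Stabilization *)

Section Stabilization.
Variables (R : realType) (A : locallyCstarType R) (E : formModule A).
Local Notation SA := (@cont_Cstar_seminorms R A).
Local Notation HA := (std_hilbert A).
Hypothesis hE : hilbert E.
Local Notation K := (dsum E HA).
Local Notation CE := (carrier E).
Let sE : semi_hilbert E := preHilbert_semi hE.1.
Let sH : semi_hilbert HA := std_semi A.
Let hK : semi_hilbert K := dsum_semi sE sH.
Let dE := sh_sub sE.
Let dH := std_submodule A.
Implicit Types (a b : A) (x y : ambient E) (p : A -> R).

Lemma ip_dsum x y (h k : ambient HA) : ip K (x, h) (y, k) = ip E x y + ip HA h k.
Proof. by []. Qed.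

Lemma dsum_definite (z : ambient K) : carrier K z -> ip K z z = 0 -> z = 0.
Proof.
move=> [C1 C2] z0.
have z1 : ip E z.1 z.1 = 0.
  apply: seminorms_separate => p pS; apply/eqP; rewrite eq_le (Cstar_ge0 (proj1 pS)) andbT.
  rewrite -(Cstar0 (proj1 pS)) -z0; apply: (ppos_le_D pS).
    exact: (sh_pos sE pS C1).
  exact: (sh_pos sH pS C2).
have z2 : ip HA z.2 z.2 = 0 by move: z0 => /=; rewrite z1 add0r.
have e1 : z.1 = 0 by apply/(ip_eq0 hE.1).
have e2 : z.2 = 0 by exact: std_definite.
by case: (z) e1 e2 => u v /= -> ->.
Qed.

Lemma nrm_dsum_le p (z : ambient K) : SA p -> carrier K z ->
  nrm p z <= @nrm R A E p z.1 + @nrm R A HA p z.2.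
Proof.
move=> pS [C1 C2]; have n1 := @nrm_ge0 R A E p z.1; have n2 := @nrm_ge0 R A HA p z.2.
rewrite (nrm_le pS) ?addr_ge0 //.
apply: le_trans (Cstar_seminormD (proj1 pS) (ip E z.1 z.1) (ip HA z.2 z.2)) _.
by rewrite -!nrm_sq // sqrrD addrAC lerDl mulrn_wge0 ?mulr_ge0.
Qed.

Lemma nrm_fst_le p (z : ambient K) : SA p -> carrier K z -> @nrm R A E p z.1 <= nrm p z.
Proof.
move=> pS [C1 C2]; rewrite (nrm_le pS) ?nrm_ge0 // nrm_sq //=.
by apply: (ppos_le_D pS); [exact: (sh_pos sE pS C1) | exact: (sh_pos sH pS C2)].
Qed.

Lemma nrm_snd_le p (z : ambient K) : SA p -> carrier K z -> @nrm R A HA p z.2 <= nrm p z.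
Proof.
move=> pS [C1 C2]; rewrite (nrm_le pS) ?nrm_ge0 // nrm_sq //= addrC.
by apply: (ppos_le_D pS); [exact: (sh_pos sH pS C2) | exact: (sh_pos sE pS C1)].
Qed.

Lemma E_complete (u : nat -> ambient E) : (forall n, CE (u n)) ->
  (forall p, SA p -> forall e, 0 < e -> exists N, forall m n, (N <= m)%N -> (N <= n)%N ->
     nrm p (u m - u n) <= e) ->
  exists2 x, CE x & forall p, SA p -> forall e, 0 < e -> exists N, forall n, (N <= n)%N ->
     nrm p (u n - x) <= e.
Proof.
move=> Cu uc; have [x Cx ux] : exists2 x, CE x & mod_cvg (u @ \oo) x.
  apply: hE.2; first by exists 0%N => // n _; exact: Cu.
  move=> p pS; apply/cvgrPdist_le => e e0; have [N hN] := uc p pS e e0.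
  exists ([set y | exists2 n, (N <= n)%N & y = u n], [set y | exists2 n, (N <= n)%N & y = u n]).
    by split; exists N => // n /= Nn; exists n.
  move=> [y z] /= [[m Nm ->] [n Nn ->]].
  by rewrite sub0r normrN ger0_norm ?sqrtr_ge0 // hN.
exists x => // p pS e e0; have /cvgrPdist_le/(_ e e0)[N _ hN] := ux p pS.
by exists N => n /hN /=; rewrite sub0r normrN ger0_norm ?sqrtr_ge0.
Qed.

Lemma dsum_complete (u : nat -> ambient K) : (forall n, carrier K (u n)) ->
  (forall p, SA p -> forall e, 0 < e -> exists N, forall m n, (N <= m)%N -> (N <= n)%N ->
     nrm p (u m - u n) <= e) ->
  exists2 z, carrier K z & forall p, SA p -> forall e, 0 < e ->
    exists N, forall n, (N <= n)%N -> nrm p (u n - z) <= e.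
Proof.
move=> Cu uc; have sK := sh_sub hK.
have [x Cx ux] : exists2 x, CE x & forall p, SA p -> forall e, 0 < e ->
    exists N, forall n, (N <= n)%N -> nrm p ((u n).1 - x) <= e.
  apply: E_complete => [n|p pS e e0]; first by case: (Cu n).
  have [N hN] := uc p pS e e0; exists N => m n Nm Nn; apply: le_trans (hN m n Nm Nn).
  exact: (nrm_fst_le pS (submoduleB sK (Cu m) (Cu n))).
have [y Cy uy] : exists2 y, carrier HA y & forall p, SA p -> forall e, 0 < e ->
    exists N, forall n, (N <= n)%N -> @nrm R A HA p ((u n).2 - y) <= e.
  apply: std_complete => [n|p pS e e0]; first by case: (Cu n).
  have [N hN] := uc p pS e e0; exists N => m n Nm Nn; apply: le_trans (hN m n Nm Nn).
  exact: (nrm_snd_le pS (submoduleB sK (Cu m) (Cu n))).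
have Cxy : carrier K (x, y) by [].
exists (x, y) => // p pS e e0; have e2 : 0 < e / 2 by rewrite divr_gt0.
have [N hN] := ux p pS _ e2; have [N' hN'] := uy p pS _ e2.
exists (maxn N N') => n; rewrite geq_max => /andP[n1 n2].
apply: le_trans (nrm_dsum_le pS (submoduleB sK (Cu n) Cxy)) _.
by rewrite (splitr e) lerD ?hN ?hN'.
Qed.

Definition gen_vec x : vec K := (fun a => (x <* a, 0), fun z => ip E x z.1).
Definition std_vec j : vec K := (fun a => (0, coord_vec j a), fun z => z.2 j).

Lemma gen_is_vec x : CE x -> is_vec (gen_vec x).
Proof.
move=> Cx; have Cxa a : CE (x <* a) by exact: submodule_ract.
have H0 : carrier HA 0 := submodule0 dH.
split=> [a|a [y h] [C1 C2]|p pS]; first by split=> /=.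
  by rewrite ip_dsum (ip_0l sH) // addr0 (ip_ractl sE).
exists (nrm p x); split=> [|a]; first exact: nrm_ge0.
apply: le_trans (nrm_ract sE pS a Cx); rewrite (nrm_le pS) ?nrm_ge0 // nrm_sq // ip_dsum.
by rewrite (ip_0l sH) // addr0.
Qed.

Lemma std_is_vec j : is_vec (std_vec j).
Proof.
have E0 : CE 0 := submodule0 dE.
split=> [a|a [y h] [C1 C2]|p pS]; first by split=> //; exact: coord_car.
  by rewrite ip_dsum (ip_0l sE) // add0r; exact: ip_coordl.
exists 1; split=> // a; rewrite mul1r (nrm_le pS) ?(Cstar_ge0 (proj1 pS)) // ip_dsum.
rewrite (ip_0l sE) // add0r ip_coordl.
by rewrite /coord_vec eqxx (Cstar_seminorm_star (proj1 pS)).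
Qed.

(** The filtration for [gs_sequence]. It restricts only the H_A component, so the ranges of all
    [gen_vec] already lie in level 0. *)
Definition supported m : set (ambient K) := [set z | forall j, (m <= j)%N -> z.2 j = 0].

Lemma supported_submodule m : submodule (supported m).
Proof.
split=> [j _ //|z w hz hw j mj|c z hz j mj|z a hz j mj].
- by rewrite -[LHS]/(z.2 j + w.2 j) hz // hw // addr0.
- by rewrite -[LHS]/(c *: z.2 j) hz // scaler0.
- by rewrite -[LHS]/(z.2 j ** a) hz // smul0l.
Qed.

(** Take [n + 1 = 2^j (2 N + 1)], whose odd part leaves the 2-adic valuation equal to [j]. *)
Lemma logn2_recurrent j N : exists2 n, (N <= n)%N & logn 2 n.+1 = j.
Proof.
exists (2 ^ j * N.*2.+1).-1.
  rewrite -ltnS prednK ?muln_gt0 ?expn_gt0 //.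
  apply: leq_trans (leq_pmull _ _); last by rewrite expn_gt0.
  by rewrite ltnS -addnn leq_addr.
rewrite prednK ?muln_gt0 ?expn_gt0 // lognM ?expn_gt0 // pfactorK //.
by rewrite lognE /= dvdn2 /= odd_double /= addn0.
Qed.

Lemma kasparov_stabilization : countably_generated E -> HA ~=u K.
Proof.
move=> [G /countable_injP[idx idxI] [GE spanG]].
have sK := sh_sub hK; have E0 : CE 0 := submodule0 dE; have H0 : carrier HA 0 := submodule0 dH.
have Cl x : CE x -> carrier K (x, 0) by split.
have Cr (h : nat -> A) : carrier HA h -> carrier K (0, h) by split.
have [xs [Cxs Gxs]] : exists xs : nat -> ambient E, (forall n, CE (xs n)) /\
    forall x, G x -> exists n, xs n = x.
  (* [G] may be finite or empty; indices outside the image of [idx] receive the vector 0. *)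
  have /choice[xs hxs] : forall n, exists x, CE x /\ forall y, G y -> idx y = n -> x = y.
    move=> n; have [[x [Gx xn]]|nx] := pselect (exists x, G x /\ idx x = n).
      exists x; split=> [|y Gy yn]; first exact: GE.
      by apply: idxI; rewrite ?inE ?xn.
    by exists 0; split=> // y Gy yn; case: nx; exists y.
  exists xs; split=> [n|x Gx]; first by case: (hxs n).
  by exists (idx x); have [_ h] := hxs (idx x); exact: h.
pose target j := if odd j then std_vec j./2 else gen_vec (xs j./2).
have target_vec j : is_vec (target j).
  by rewrite /target; case: ifP => _; [exact: std_is_vec | exact: gen_is_vec].
(* [logn 2 n.+1] takes every value infinitely often, so that each target is
   approximated with arbitrarily small error. *)
have [||||m m' mm' z zm j mj|n|m a j mj|m z hz|n|F [Fv Fo Fr]] :=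
  @gs_sequence R A K hK dsum_definite (fun n => target (logn 2 n.+1))
    std_vec supported (fun n => n.+1%:R^-1).
- by move=> n; exact: target_vec.
- exact: std_is_vec.
- by move=> m a; rewrite /= /coord_vec eqxx.
- exact: supported_submodule.
- by apply: zm; exact: leq_trans mj.
- rewrite /target; case: ifP => _; last by exists 0%N => a j.
  exists (logn 2 n.+1)./2.+1 => a j mj /=.
  by rewrite /coord_vec gtn_eqF.
- by rewrite /= /coord_vec gtn_eqF.
- exact: hz.
- by rewrite invr_gt0.
(* [N] does not depend on [a]. This uniformity lets [nrm_le_action] pass from the vectors [(x a, 0)]
   to [(x, 0)] itself. *)
have targetP j p d : SA p -> 0 < d -> exists N, forall a,
    nrm p ((target j).1 a - oproj F N ((target j).1 a)) <= d * p a.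
  move=> pS d0; have [n Nn nj] := logn2_recurrent j (Num.truncn d^-1).+1.
  exists n.+1 => a; rewrite -nj; apply: le_trans (Fr n p pS a) _.
  rewrite ler_wpM2r ?(Cstar_ge0 (proj1 pS)) // -[d]invrK lef_pV2 ?posrE ?invr_gt0 //.
  apply: ltW; apply: lt_le_trans (Num.Theory.truncnS_gt _) _.
  by rewrite ler_nat; apply: leq_trans (leqnSn _).
have target_dense j a : dense_at F ((target j).1 a).
  move=> p pS d d0; have c1 : 0 < p a + 1 by rewrite ltr_wpDl ?(Cstar_ge0 (proj1 pS)).
  have [N hN] := targetP j p _ pS (divr_gt0 d0 c1); exists N.
  apply: (le_trans (hN a)); rewrite mulrAC ler_pdivrMr // ler_wpM2l ?lerDl //.
  exact: ltW.
have gen_dense n : dense_at F (xs n, 0).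
  move=> p pS d d0; have [N hN] := targetP n.*2 p _ pS d0; exists N.
  have Cx := Cl _ (Cxs n).
  apply: (nrm_le_action hK pS) => [||a]; [exact: (submoduleB sK Cx (CP hK Fv _ _)) | exact: ltW |].
  rewrite -(proj_ract hK dsum_definite (fun i _ => Fv i)) //.
  have := hN a; rewrite /target odd_double doubleK /=.
  suff -> : ((xs n, 0 : nat -> A) : ambient K) <* a = (xs n <* a, 0) by [].
  by congr (_, _); apply/funext => i; exact: smul0l.
have std_dense j a : dense_at F (0, coord_vec j a).
  by have := target_dense j.*2.+1 a; rewrite /target /= odd_double /= uphalf_double.
(* [DE] is a closed submodule containing [G], hence contains the closed span, which is all of
   [E]. *)
pose DE := [set x | CE x /\ dense_at F (x, 0)].
have E_dense x : CE x -> dense_at F (x, 0).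
  move=> Cx; suff [] : DE x by [].
  have : closed_span G x by rewrite spanG.
  apply; split; last first.
    by move=> y Gy; have [n <-] := Gxs y Gy; split; [exact: Cxs | exact: gen_dense].
  split; first by move=> y [].
    split.
    - split=> // p pS d d0; exists 0%N.
      by rewrite /oproj /comb big_ord0 subr0 (nrm0 hK pS) ltW.
    - move=> y z [Cy dy] [Cz dz]; split; first exact: submoduleD.
      have -> : (y + z, 0) = (y, 0) + (z, 0) :> ambient K by congr (_, _); rewrite addr0.
      exact: (denseD hK dsum_definite Fv Fo).
    - move=> c y [Cy dy]; split; first exact: submoduleZ.
      have -> : (c *: y, 0) = c *: (y, 0) :> ambient K by congr (_, _); rewrite scaler0.
      exact: (denseZ hK dsum_definite Fv).
    - move=> y a [Cy dy]; split; first exact: submodule_ract.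
      have -> : (y <* a, 0) = ((y, 0) : ambient K) <* a.
        by congr (_, _); apply/funext => i; exact/esym/smul0l.
      exact: (dense_ract hK dsum_definite Fv).
  move=> Phi PPhi PhiD y Cy Phiy; split=> //.
  apply: (dense_approx hK dsum_definite Fv Fo) => // p pS d d0.
  have /cvgrPdist_le/(_ d d0) hd := Phiy p pS.
  have [w [[Cw dw] hw]] := filter_ex (filterI PhiD hd).
  exists (w, 0); split=> //.
  move: hw; rewrite sub0r normrN ger0_norm ?sqrtr_ge0 // => hw.
  have Cyw : carrier K ((y, 0) - (w, 0)) by exact: (submoduleB sK).
  apply: (le_trans (nrm_dsum_le pS Cyw)) => /=.
  rewrite subr0 (nrm0 sH pS) addr0 (nrmBC sE) //; exact: hw.
have H_dense (h : nat -> A) : carrier HA h -> dense_at F (0, h).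
  move=> Ch; apply: (dense_approx hK dsum_definite Fv Fo) => // p pS d d0.
  have [J hJ] := std_truncate pS Ch d0.
  pose s J := (0, \sum_(j < J) coord_vec j (h j)) : ambient K.
  have Cs k : carrier K (s k).
    by split=> //; apply: (submodule_sum dH) => j _; exact: coord_car.
  exists (s J); split=> //.
    elim: (J) => [|k IH].
      by rewrite /s big_ord0; exact: E_dense.
    have -> : s k.+1 = s k + (0, coord_vec k (h k)).
      by rewrite /s big_ord_recr; congr (_, _); rewrite addr0.
    apply: (denseD hK dsum_definite Fv Fo) => //; split=> //; exact: coord_car.
  have Cd : carrier K ((0, h) - s J) by exact: (submoduleB sK).
  apply: (le_trans (nrm_dsum_le pS Cd)) => /=.
  by rewrite subr0 (nrm0 sE pS) add0r.
apply: (std_hilbert_equiv hK dsum_definite Fv Fo); last exact: dsum_complete.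
move=> [x h] [Cx Ch].
have -> : (x, h) = (x, 0) + (0, h) :> ambient K by congr (_, _); rewrite ?addr0 ?add0r.
by apply: (denseD hK dsum_definite Fv Fo) => //; [exact: E_dense | exact: H_dense].
Qed.

End Stabilization.

Unset Implicit Arguments.

Theorem theorem4p2 (R : realType) (A : locallyCstarType R) (E : formModule A)
    (hE : hilbert E) (cgE : countably_generated E) :
  std_hilbert A ~=u dsum E (std_hilbert A).
Proof. exact: kasparov_stabilization. Qed.
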